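(* Let $s\in(0,1)$, $N>2s$, $2_s^*=2N/(N-2s)$, $\alpha>1$, $\beta>1$, $1\le p\le q<2<\alpha+\beta<2_s^*$, $\theta>0$, and let $V_1,V_2:\mathbb{R}^N\to\mathbb{R}$ be continuous with $V_i(x)\ge V_0$ for all $x\in\mathbb{R}^N$ and some constant $V_0>0$, and $1/V_i\in L^1(\mathbb{R}^N)$ ($i=1,2$). Then for each $\lambda\in(0,\lambda^* )$ the system $$\begin{cases}(-\Delta)^su+V_1(x)u=\lambda|u|^{p-2}u+\frac{\alpha}{\alpha+\beta}\theta|u|^{\alpha-2}u|v|^\beta & \text{in }\mathbb{R}^N,\\ (-\Delta)^sv+V_2(x)v=\lambda|v|^{q-2}v+\frac{\beta}{\alpha+\beta}\theta|u|^{\alpha}|v|^{\beta-2}v & \text{in }\mathbb{R}^N,\end{cases}$$ admits at least one weak solution $(z,w)\in\mathcal{A}$, and $(z,w)$ satisfies: (i) $E_\lambda''(z,w)(z,w)^2<0$, that is, $(z,w)\in\mathcal{N}_\lambda^-$; (ii) if $\lambda\in(0,\lambda_* )$, then $E_\lambda(z,w)>0$; (iii) if $\lambda=\lambda_*$, then $E_\lambda(z,w)=0$; (iv) if $\lambda\in(\lambda_*,\lambda^* )$, then $E_\lambda(z,w)<0$.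
   Context: $H^s(\mathbb{R}^N)$ is the fractional Sobolev space, with $[u]^2=\int_{\mathbb{R}^N}\int_{\mathbb{R}^N}\frac{|u(x)-u(y)|^2}{|x-y|^{N+2s}}\,dx\,dy$. For $i=1,2$, $X_i=\{u\in H^s(\mathbb{R}^N):\int_{\mathbb{R}^N} V_iu^2\,dx<\infty\}$, and $X=X_1\times X_2$ is the Hilbert space with norm $\|(u,v)\|^2=[u]^2+[v]^2+\int_{\mathbb{R}^N}(V_1u^2+V_2v^2)\,dx$ and associated inner product $\langle\cdot,\cdot\rangle$. $\|\cdot\|_r$ is the $L^r(\mathbb{R}^N)$ norm. Set $\mathcal{A}=\{(u,v)\in X:\int_{\mathbb{R}^N}|u|^\alpha|v|^\beta\,dx>0\}$. For $(u,v)\in\mathcal{A}$ define $$R_n(u,v)=\frac{\|(u,v)\|^2-\theta\int|u|^\alpha|v|^\beta dx}{\|u\|_p^p+\|v\|_q^q},\qquad R_e(u,v)=\frac{\frac12\|(u,v)\|^2-\frac{\theta}{\alpha+\beta}\int|u|^\alpha|v|^\beta dx}{\frac1p\|u\|_p^p+\frac1q\|v\|_q^q},$$ $\Lambda_n(u,v)=\sup_{t>0}R_n(tu,tv)$, $\Lambda_e(u,v)=\sup_{t>0}R_e(tu,tv)$, $\lambda^*=\inf_{\mathcal{A}}\Lambda_n$, $\lambda_*=\inf_{\mathcal{A}}\Lambda_e$. The energy functional is $E_\lambda(u,v)=\frac12\|(u,v)\|^2-\frac{\lambda}{p}\|u\|_p^p-\frac{\lambda}{q}\|v\|_q^q-\frac{\theta}{\alpha+\beta}\int|u|^\alpha|v|^\beta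 dx$ on $X$, and for $(u,v),(\varphi,\psi)\in X$ $$E_\lambda'(u,v)(\varphi,\psi)=\langle(u,v),(\varphi,\psi)\rangle-\lambda\int|u|^{p-2}u\varphi-\lambda\int|v|^{q-2}v\psi-\tfrac{\theta\alpha}{\alpha+\beta}\int|u|^{\alpha-2}u\varphi|v|^\beta-\tfrac{\theta\beta}{\alpha+\beta}\int|u|^\alpha|v|^{\beta-2}v\psi .$$ (Expressions $|t|^{r-2}t$ are $0$ at $t=0$.) A weak solution of the system is $(u,v)\in X$ with $E_\lambda'(u,v)(\varphi,\psi)=0$ for all $(\varphi,\psi)\in X$. Further, $E_\lambda''(u,v)(u,v)^2=\|(u,v)\|^2-\lambda(p-1)\|u\|_p^p-\lambda(q-1)\|v\|_q^q-\theta(\alpha+\beta-1)\int|u|^\alpha|v|^\beta dx$. The Nehari set is $\mathcal{N}_\lambda=\{(u,v)\in X\setminus\{(0,0)\}:\lambda\|u\|_p^p+\lambda\|v\|_q^q=\|(u,v)\|^2-\theta\int|u|^\alpha|v|^\beta dx\}$, and $\mathcal{N}_\lambda^-=\{(u,v)\in\mathcal{N}_\lambda:E_\lambda''(u,v)(u,v)^2<0\}$. *)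

(* Defs.v *)
From HB Require Import structures.
From mathcomp Require Import all_boot all_order all_algebra.
From mathcomp Require Import all_classical all_reals all_analysis.

Set Implicit Arguments.
Unset Strict Implicit.
Unset Printing Implicit Defensive.

Import Order.TTheory GRing.Theory Num.Theory.
Import numFieldTopology.Exports numFieldNormedType.Exports.

Local Open Scope classical_set_scope.
Local Open Scope ring_scope.

Definition measure_rV_display : measure_display.
Proof. exact: default_measure_display. Qed.

(* ['rV[R]_n] carries the sigma-algebra generated by the coordinates, i.e. the
   Borel sigma-algebra of [R^n]. *)

Section measurable_rV.
Context {R : realType} (n : nat).

Let coord : 'I_n -> 'rV[R]_n -> R := fun i x => x ord0 i.

Let rV_set0 : g_sigma_preimage coord set0.
Proof. exact: sigma_algebra0. Qed.

Let rV_setC A : g_sigma_preimage coord A -> g_sigma_preimage coord (~` A).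
Proof. exact: sigma_algebraC. Qed.

Let rV_bigcup (F : _^nat) : (forall i, g_sigma_preimage coord (F i)) ->
  g_sigma_preimage coord (\bigcup_i (F i)).
Proof. exact: sigma_algebra_bigcup. Qed.

HB.instance Definition _ := @isMeasurable.Build measure_rV_display
  'rV[R]_n (g_sigma_preimage coord) rV_set0 rV_setC rV_bigcup.

Lemma measurable_coord (i : 'I_n) :
  measurable_fun [set: 'rV[R]_n] (fun x : 'rV[R]_n => x ord0 i).
Proof.
move=> _ Y mY; rewrite setTI; apply: sub_sigma_algebra => /=.
rewrite -bigcup_seq/=; exists i => /=; first by rewrite mem_index_enum.
by exists Y => //; rewrite setTI.
Qed.

Lemma measurable_fun_coordP d (T : measurableType d) (f : T -> 'rV[R]_n) :
  (forall i, measurable_fun [set: T] (fun x => f x ord0 i)) ->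
  measurable_fun [set: T] f.
Proof.
move=> mf.
have fS : preimage_set_system setT f (g_sigma_preimage coord) `<=` measurable.
  rewrite -g_sigma_preimage_comp; apply: smallest_sub.
    exact: sigma_algebra_measurable.
  rewrite -bigcup_seq => A [i _] [B mB <-]; exact: mf.
by move=> _ A mA; apply: fS; exists A.
Qed.

End measurable_rV.
Section lebesgue_rV.
Context {R : realType}.

Definition rV_cons n (z : measurableTypeR R * 'rV[R]_n) : 'rV[R]_n.+1 :=
  \row_i (if unlift ord0 i is Some j then z.2 ord0 j else z.1).

Definition rV_uncons n (x : 'rV[R]_n.+1) : measurableTypeR R * 'rV[R]_n :=
  (x ord0 ord0, \row_j x ord0 (lift ord0 j)).

Lemma rV_consK n : cancel (@rV_cons n) (@rV_uncons n).
Proof.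
move=> [a y]; rewrite /rV_uncons /rV_cons mxE unlift_none; congr pair.
by apply/rowP => j; rewrite !mxE liftK.
Qed.

Lemma rV_unconsK n : cancel (@rV_uncons n) (@rV_cons n).
Proof.
by move=> x; apply/rowP => i; rewrite !mxE; case: unliftP => [j|] -> //=;
  rewrite mxE.
Qed.

Lemma measurable_rV_cons n : measurable_fun [set: _] (@rV_cons n).
Proof.
apply: measurable_fun_coordP => i; under eq_fun do rewrite mxE.
case: (unlift ord0 i) => [j|]; last exact: measurable_fst.
exact: (measurableT_comp (measurable_coord j) measurable_snd).
Qed.

Lemma measurable_rV_uncons n : measurable_fun [set: _] (@rV_uncons n).
Proof.
apply/measurable_fun_pairP; split => /=; first exact: measurable_coord.
apply: measurable_fun_coordP => i /=; under eq_fun do rewrite mxE.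
exact: measurable_coord.
Qed.

Section lebesgue_cons.
Variables (n : nat) (m : {sigma_finite_measure set 'rV[R]_n -> \bar R}).

Definition lebesgue_cons : set 'rV[R]_n.+1 -> \bar R :=
  pushforward (@lebesgue_measure R \x m)%E (@rV_cons n).

Let lebesgue_cons_measure : {measure set 'rV[R]_n.+1 -> \bar R} :=
  measure_function_pushforward__canonical__measure_function_Measure
    (@lebesgue_measure R \x m)%E (@measurable_rV_cons n).

HB.instance Definition _ := isMeasure.Build _ _ _ lebesgue_cons
  (measure0 lebesgue_cons_measure) (measure_ge0 lebesgue_cons_measure)
  (@measure_semi_sigma_additive _ _ _ lebesgue_cons_measure).

Let lebesgue_cons_sigma_finite : sigma_finite [set: _] lebesgue_cons.
Proof.
have /sigma_finiteP[F [FT ndF Foo]] := sigma_finiteT (@lebesgue_measure R).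
have /sigma_finiteP[G [GT ndG Goo]] := sigma_finiteT m.
exists (fun k => @rV_uncons n @^-1` (F k `*` G k)).
  rewrite -preimage_bigcup -[LHS](preimage_setT (@rV_uncons n)); congr preimage.
  rewrite -setXTT FT GT predeqE => -[x y]; split.
    move=> [/= [k _ Fkx] [l _ Gly]]; exists (maxn k l) => //; split.
      by move: x Fkx; exact/subsetPset/ndF/leq_maxl.
    by move: y Gly; exact/subsetPset/ndG/leq_maxr.
  by move=> [k _ []/= ? ?]; split; exists k.
move=> k; have [mF oF] := Foo k; have [mG oG] := Goo k; split.
  rewrite -[X in measurable X]setTI; apply: measurable_rV_uncons => //.
  exact: measurableX.
rewrite /lebesgue_cons /pushforward -comp_preimage (_ : _ \o _ = id); last first.
  by apply/funext => z; exact: rV_consK.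
rewrite [X in (X < _)%E](product_measure1E _ _ mF mG).
by rewrite lte_mul_pinfty// ge0_fin_numE.
Qed.

HB.instance Definition _ := Measure_isSigmaFinite.Build _ _ _ lebesgue_cons
  lebesgue_cons_sigma_finite.

End lebesgue_cons.

Definition lebesgue_rV0 : set 'rV[R]_0 -> \bar R := dirac (0 : 'rV[R]_0).

HB.instance Definition _ := Measure.on lebesgue_rV0.

Let lebesgue_rV0_sigma_finite : sigma_finite [set: _] lebesgue_rV0.
Proof.
exists (fun=> [set: _]); first by rewrite bigcup_const.
by move=> _; rewrite /lebesgue_rV0 diracT; split; [exact: measurableT|exact: ltry].
Qed.

HB.instance Definition _ := Measure_isSigmaFinite.Build _ _ _ lebesgue_rV0
  lebesgue_rV0_sigma_finite.

(* The [n]-dimensional Lebesgue measure, as the [n]-fold product of the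
   one-dimensional one; [leb_box] is a sanity check. *)
Fixpoint leb (n : nat) : {sigma_finite_measure set 'rV[R]_n -> \bar R} :=
  if n is k.+1 then lebesgue_cons (leb k) else lebesgue_rV0.

Lemma leb_box n (a b : 'rV[R]_n) : (forall i, a ord0 i <= b ord0 i) ->
  leb n [set x | forall i, a ord0 i <= x ord0 i <= b ord0 i] =
  (\prod_(i < n) (b ord0 i - a ord0 i))%:E.
Proof.
elim: n a b => [|n IH] a b ab.
  rewrite big_ord0 /= /lebesgue_rV0 diracE mem_set//.
  by case.
rewrite /= /lebesgue_cons /pushforward big_ord_recl EFinM.
pose a' : 'rV[R]_n := \row_j a ord0 (lift ord0 j).
pose b' : 'rV[R]_n := \row_j b ord0 (lift ord0 j).
have -> : \prod_(i < n) (b ord0 (lift ord0 i) - a ord0 (lift ord0 i)) =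
    \prod_(i < n) (b' ord0 i - a' ord0 i).
  by apply: eq_bigr => i _; rewrite !mxE.
rewrite -IH; last by move=> i; rewrite !mxE.
transitivity ((@lebesgue_measure R \x leb n)%E
   ((`[a ord0 ord0, b ord0 ord0] : set (measurableTypeR R)) `*`
    [set x : 'rV[R]_n | forall i, a' ord0 i <= x ord0 i <= b' ord0 i])).
  congr (product_measure1 _ _ _).
  apply/seteqP; split => [[c y]/= H|[c y] /= [+ H]].
    split; first by have := H ord0; rewrite mxE unlift_none in_itv/=.
    by move=> i; have := H (lift ord0 i); rewrite /a' /b' !mxE liftK.
  rewrite in_itv/= => H0 i; rewrite mxE; case: unliftP => [j|] -> //=.
  by have := H j; rewrite !mxE.
rewrite product_measure1E//.
  congr (_ * _)%E.
  rewrite [LHS](lebesgue_measure_itv `[a ord0 ord0, b ord0 ord0])/= lte_fin.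
  by case: ltgtP (ab ord0) => // ->; rewrite subrr.
rewrite (_ : [set x | _] = \bigcap_(i in [set: 'I_n])
    ((fun x : 'rV[R]_n => x ord0 i) @^-1` `[a' ord0 i, b' ord0 i])).
  apply: fin_bigcap_measurable => // i _.
  by rewrite -[X in measurable X]setTI; exact: measurable_coord.
apply/seteqP; split => x /= H i; first by move=> _ /=; rewrite in_itv/=.
by have := H i I; rewrite /= in_itv.
Qed.

End lebesgue_rV.

Definition sobolev_exponent {R : realType} (N : nat) (s : R) : R :=
  2 * N%:R / (N%:R - 2 * s).

Section fractional_system.
Context {R : realType} {N : nat}.
Local Notation fct := ('rV[R]_N -> R).
Local Notation mu := (leb N : {measure set 'rV[R]_N -> \bar R}).

Definition enorm (x : 'rV[R]_N) : R := Num.sqrt (\sum_i x ord0 i ^+ 2).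

(* [|t|^(r-2) t]; it vanishes at [t = 0] for every [r]. *)
Definition spow (r t : R) : R := `|t| `^ (r - 2) * t.

Definition Lnorm_pow (r : R) (u : fct) : R :=
  fine ('N[mu]_r%:E[EFin \o u])%E `^ r.

(* [fine] and the real-valued [\int] below send an infinite value to 0; this
   never happens on [spaceX] under the hypotheses of the theorem, where all
   these quantities are finite. *)

(* The square of the Gagliardo seminorm, possibly [+oo]. The diagonal, where
   the quotient is 0 by convention, is negligible as soon as [0 < N]. *)
Definition gagliardo2 (s : R) (u : fct) : \bar R :=
  (\int[leb N \x leb N]_z
    ((u z.1 - u z.2) ^+ 2 / enorm (z.1 - z.2) `^ (N%:R + 2 * s))%:E)%E.

Definition gagliardo_form (s : R) (u f : fct) : R :=
  \int[(leb N \x leb N)%E]_z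
    ((u z.1 - u z.2) * (f z.1 - f z.2) / enorm (z.1 - z.2) `^ (N%:R + 2 * s)).

(* Sobolev functions are represented by measurable functions, not by classes
   for equality almost everywhere. *)
Definition Hs (s : R) : set fct :=
  [set u | u \in Lfun mu 2%:E /\ (gagliardo2 s u < +oo)%E].

Definition weightedHs (s : R) (V : fct) : set fct :=
  [set u | Hs s u /\ (\int[mu]_x (V x * u x ^+ 2)%:E < +oo)%E].

Section parameters.
Variables (s : R) (V1 V2 : fct) (alpha beta p q theta : R).
Implicit Types w f : fct * fct.

Definition spaceX : set (fct * fct) := weightedHs s V1 `*` weightedHs s V2.

Definition sqnormX w : R :=
  fine (gagliardo2 s w.1) + fine (gagliardo2 s w.2)
  + \int[mu]_x (V1 x * w.1 x ^+ 2 + V2 x * w.2 x ^+ 2).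

Definition innerX w f : R :=
  gagliardo_form s w.1 f.1 + gagliardo_form s w.2 f.2
  + \int[mu]_x (V1 x * w.1 x * f.1 x + V2 x * w.2 x * f.2 x).

Definition coupling w : R :=
  \int[mu]_x (`|w.1 x| `^ alpha * `|w.2 x| `^ beta).

Definition admissible : set (fct * fct) := [set w | spaceX w /\ 0 < coupling w].

Definition scale (t : R) w : fct * fct :=
  ((fun x => t * w.1 x), (fun x => t * w.2 x)).

Definition Rayleigh_n w : R :=
  (sqnormX w - theta * coupling w) / (Lnorm_pow p w.1 + Lnorm_pow q w.2).

Definition Rayleigh_e w : R :=
  (2^-1 * sqnormX w - theta / (alpha + beta) * coupling w)
  / (p^-1 * Lnorm_pow p w.1 + q^-1 * Lnorm_pow q w.2).

Definition Lambda_n w : \bar R :=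
  ereal_sup [set (Rayleigh_n (scale t w))%:E | t in [set t : R | 0 < t]].

Definition Lambda_e w : \bar R :=
  ereal_sup [set (Rayleigh_e (scale t w))%:E | t in [set t : R | 0 < t]].

Definition lambda_upper : \bar R := ereal_inf [set Lambda_n w | w in admissible].

Definition lambda_lower : \bar R := ereal_inf [set Lambda_e w | w in admissible].

Variable lambda : R.

Definition energy w : R :=
  2^-1 * sqnormX w - lambda / p * Lnorm_pow p w.1 - lambda / q * Lnorm_pow q w.2
  - theta / (alpha + beta) * coupling w.

Definition denergy w f : R :=
  innerX w f
  - lambda * \int[mu]_x (spow p (w.1 x) * f.1 x)
  - lambda * \int[mu]_x (spow q (w.2 x) * f.2 x)
  - theta * alpha / (alpha + beta)
    * \int[mu]_x (spow alpha (w.1 x) * f.1 x * `|w.2 x| `^ beta)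
  - theta * beta / (alpha + beta)
    * \int[mu]_x (`|w.1 x| `^ alpha * spow beta (w.2 x) * f.2 x).

Definition weak_solution w : Prop :=
  spaceX w /\ forall f, spaceX f -> denergy w f = 0.

(* [d2energy w] is the second derivative [E''(w)(w)^2]. *)
Definition d2energy w : R :=
  sqnormX w - lambda * (p - 1) * Lnorm_pow p w.1
  - lambda * (q - 1) * Lnorm_pow q w.2
  - theta * (alpha + beta - 1) * coupling w.

(* [w <> (0, 0)] is meant in [X], i.e. up to equality almost everywhere. *)
Definition Nehari : set (fct * fct) :=
  [set w | [/\ spaceX w,
    ~ (w.1 = cst 0 %[ae mu] /\ w.2 = cst 0 %[ae mu]) &
    lambda * Lnorm_pow p w.1 + lambda * Lnorm_pow q w.2 =
    sqnormX w - theta * coupling w]].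

Definition Nehari_minus : set (fct * fct) :=
  [set w | Nehari w /\ d2energy w < 0].

End parameters.
End fractional_system.

(* Main.v *)
(* On the ray through [w], the function [t^(1-q) d/dt E(t w)] is concave in
   [t^(2-q)]. Hence [lambda < Lambda_n w] makes the ray meet the set N^- exactly
   once, at a point beyond which the energy decreases. On N^- the energy is
   coercive and the coupling is bounded below. A minimizing sequence has a
   cluster point: integrability of [1 / V_i] and a cell-wise Poincare inequality
   give precompactness in L^1, and the subcritical Sobolev inequality upgrades
   this to L^p, L^q and the coupling, while the norm is lower semicontinuous.
   Projecting the limit along its ray back to N^- does not raise the energy, so
   the infimum is attained. The minimizer is a critical point: perturbing one
   component at a time, convexity of [|.|^r] bounds the perturbed terms, and the
   perturbed ray meets N^- near [t = 1]. Comparing the maximum of the energy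
   along rays with R_e gives the sign of the minimum. *)
Require Import Defs.
From HB Require Import structures.
From mathcomp Require Import all_boot all_order all_algebra.
From mathcomp Require Import all_classical all_reals all_analysis.
From mathcomp Require Import measurable_realfun zify ring lra.

Set Implicit Arguments.
Unset Strict Implicit.
Unset Printing Implicit Defensive.

Import Order.TTheory GRing.Theory Num.Theory.
Import numFieldTopology.Exports numFieldNormedType.Exports.

Local Open Scope classical_set_scope.
Local Open Scope ring_scope.

(** * Energy along a ray *)

(** For [p = 1] or [q = 1] the energy need not be differentiable, so the Euler equation is not
    derived from a Lagrange multiplier on N^-. Every term except the quadratic one enters the energy
    with a minus sign and is convex in each component separately. Hence [spow], a subgradient, gives
    an upper bound of the perturbed energy that is quadratic in the size of the perturbation, and
    minimality makes its linear coefficient nonnegative. Testing with f and -f turns this into an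
    equation. The coupling is not jointly convex, which is why the components are perturbed
    separately; the derivative is linear in the test pair, so the two halves add up. The
    minimization sees only four homogeneous quantities: the squared norm, the two powers and the
    coupling. It is therefore carried out on an abstract set with a scaling, and each ray becomes a
    function of one variable with four coefficients. Along a minimizing sequence the squared norms
    converge to some [a] that may exceed the squared norm of the limit [z]. The ray of [z] is
    compared with the fictitious ray having [a] in place of [A z], which inherits the Nehari
    relations. *)

Section fibering.
Context {R : realType}.
Implicit Types a b c d t x e p q g : R.

(** Bernoulli's inequality, from Young's inequality for the product [x * 1] with the exponents [e]
    and [e / (e - 1)]. At [e = 1], where there is no conjugate exponent, it is an identity. *)
Lemma powR_ge_tangent e x : 1 <= e -> 0 <= x -> 1 + e * (x - 1) <= x `^ e.
Proof.
move=> e1 x0; have e0 : 0 < e by lra.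
have [->|ne1] := eqVneq e 1; first by rewrite powRr1//; lra.
have e1' : 0 < e - 1 by rewrite subr_gt0 lt_neqAle eq_sym ne1.
have H := @conjugate_powR _ x 1 e (e / (e - 1)) x0 ler01 e0 (divr_gt0 e0 e1').
have : x * 1 <= x `^ e / e + 1 `^ (e / (e - 1)) / (e / (e - 1)).
  by apply: H; field; rewrite !gt_eqF.
rewrite powR1 mulr1 mul1r invf_div -mulrDl ler_pdivlMr//; lra.
Qed.

(** Bernoulli's inequality with exponent [1 + e] at [x^-1], multiplied by [x]. *)
Lemma powRN_ge_tangent e x : 0 <= e -> 0 < x -> 1 - e * (x - 1) <= x `^ (- e).
Proof.
move=> e0 x0.
have := @powR_ge_tangent (1 + e) x^-1 ltac:(lra).
rewrite invr_ge0 => /(_ (ltW x0)).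
have -> : x^-1 `^ (1 + e) = x^-1 * x `^ (- e).
  rewrite powRD; last by rewrite invr_eq0 (gt_eqF x0) implybT.
  by rewrite powRr1 ?invr_ge0 ?ltW// -powR_inv1 ?ltW// -powRrM mulN1r.
rewrite -(ler_pM2l x0) mulrA divff ?gt_eqF// mul1r; apply: le_trans.
have -> : x * (1 + (1 + e) * (x^-1 - 1)) = x + (1 + e) * (1 - x).
  by field; rewrite gt_eqF.
lra.
Qed.

Lemma powR_lt1 e t : 0 < e -> 0 < t -> (t `^ e < 1) = (t < 1).
Proof.
move=> e0 t0; have e1 : 1 `^ e = 1 :> R by rewrite powR1.
rewrite -[X in _ `^ _ < X]e1.
have [t1|t1] := ltP t 1.
  by apply: gt0_ltr_powR => //; rewrite nnegrE ltW.
by apply/negbTE; rewrite -leNgt; apply: ge0_ler_powR => //;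
  rewrite ?nnegrE ltW.
Qed.

Lemma powR_gt1 e t : 0 < e -> 0 < t -> (1 < t `^ e) = (1 < t).
Proof.
move=> e0 t0; have e1 : 1 `^ e = 1 :> R by rewrite powR1.
rewrite -[X in X < _ `^ _]e1.
have [t1|t1] := ltP 1 t.
  by apply: gt0_ltr_powR => //; rewrite nnegrE ltW.
by apply/negbTE; rewrite -leNgt; apply: ge0_ler_powR => //;
  rewrite ?nnegrE ltW.
Qed.

(* [fibk] is [t] times the derivative of [fibE] at [t]. *)
Definition fibk p q g a b c d t :=
  a * t ^+ 2 - b * t `^ p - c * t `^ q - d * t `^ g.

Definition fibE p q g a b c d t :=
  a / 2 * t ^+ 2 - b / p * t `^ p - c / q * t `^ q - d / g * t `^ g.

(* With [k] the polynomial [fibk], this is [k' 1 - q * k 1]; up to the factor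
   [2 - q] it is the derivative at 1 of [k t / t `^ q] in the variable
   [t `^ (2 - q)], with respect to which that function is concave. *)
Definition fibs p q g a b d := (2 - q) * a + (q - p) * b - (g - q) * d.

Section exponents.
Variables p q g : R.
Hypotheses (hp : 1 <= p) (hpq : p <= q) (hq : q < 2) (hg : 2 < g).
Let p0 : 0 < p. Proof. by move: hp; lra. Qed.
Let q0 : 0 < q. Proof. by move: hp hpq; lra. Qed.
Let g0 : 0 < g. Proof. by move: hg; lra. Qed.
Let q2 : 0 < 2 - q. Proof. by move: hq; lra. Qed.
Local Notation k := (fibk p q g).
Local Notation E := (fibE p q g).
Local Notation s := (fibs p q g).

Lemma fibk1 a b c d : k a b c d 1 = a - b - c - d.
Proof. by rewrite /fibk !powR1 expr1n !mulr1. Qed.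

(** Moving a point of the ray to 1 only rescales the four coefficients. The lemmas below are
    therefore stated at 1 and applied at any point of the ray. *)
Lemma fibkM a b c d t x : 0 <= t -> 0 <= x ->
  k a b c d (t * x) = k (a * t ^+ 2) (b * t `^ p) (c * t `^ q) (d * t `^ g) x.
Proof. by move=> t0 x0; rewrite /fibk exprMn !powRM//; ring. Qed.

Lemma fibEM a b c d t x : 0 <= t -> 0 <= x ->
  E a b c d (t * x) = E (a * t ^+ 2) (b * t `^ p) (c * t `^ q) (d * t `^ g) x.
Proof. by move=> t0 x0; rewrite /fibE exprMn !powRM//; ring. Qed.

(** Dividing by t^q and setting u = t^(2-q) leaves a u - b u^(-(q-p)/(2-q)) - c - d u^((g-q)/(2-q)).
    The first exponent is nonpositive and the second at least 1, so both powers lie above their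
    tangents at u = 1; the bound is the resulting tangent line. *)
Lemma fibk_tangent a b c d t : 0 <= b -> 0 <= c -> 0 <= d -> 0 < t ->
  k a b c d t <=
  t `^ q * (k a b c d 1 + s a b d * (t `^ (2 - q) - 1) / (2 - q)).
Proof.
move=> b0 c0 d0 t0; rewrite fibk1; move: (hp) (hpq) (hq) (hg) => ? ? ? ?.
have tD x y : t `^ (x + y) = t `^ x * t `^ y.
  by rewrite powRD// (gt_eqF t0); exact/implyP.
have t2 : t ^+ 2 = t `^ q * t `^ (2 - q).
  by rewrite -tD subrKC -powR_mulrn ?ltW.
have tp : t `^ p = t `^ q * t `^ (p - q) by rewrite -tD subrKC.
have tg : t `^ g = t `^ q * t `^ (g - q) by rewrite -tD subrKC.
set u := t `^ (2 - q).
have u0 : 0 < u by exact: powR_gt0.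
have hpu : 1 - (q - p) / (2 - q) * (u - 1) <= t `^ (p - q).
  have -> : t `^ (p - q) = u `^ (- ((q - p) / (2 - q))).
    by rewrite /u -powRrM; congr (_ `^ _); field; rewrite gt_eqF.
  by apply: powRN_ge_tangent => //; rewrite divr_ge0//; lra.
have hgu : 1 + (g - q) / (2 - q) * (u - 1) <= t `^ (g - q).
  have -> : t `^ (g - q) = u `^ ((g - q) / (2 - q)).
    by rewrite /u -powRrM; congr (_ `^ _); field; rewrite gt_eqF.
  apply: powR_ge_tangent; last exact: ltW.
  by rewrite ler_pdivlMr//; lra.
have -> : k a b c d t =
    t `^ q * (a * u - b * t `^ (p - q) - c - d * t `^ (g - q)).
  by rewrite /fibk t2 tp tg -/u; ring.
rewrite ler_pM2l ?powR_gt0//.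
have -> : a - b - c - d + s a b d * (u - 1) / (2 - q) =
   a * u - b * (1 - (q - p) / (2 - q) * (u - 1)) - c
   - d * (1 + (g - q) / (2 - q) * (u - 1)).
  by rewrite /fibs; field; rewrite gt_eqF.
have := ler_wpM2l b0 hpu; have := ler_wpM2l d0 hgu; lra.
Qed.

Section nonneg.
Variables a b c d : R.
Hypotheses (b0 : 0 <= b) (c0 : 0 <= c) (d0 : 0 <= d).

Lemma fibk_lt0 t : k a b c d 1 = 0 -> s a b d < 0 -> 1 < t -> k a b c d t < 0.
Proof.
move=> k1 s0 t1; have t0 : 0 < t by lra.
apply: le_lt_trans (fibk_tangent a b0 c0 d0 t0) _.
rewrite k1 add0r pmulr_rlt0 ?powR_gt0// pmulr_llt0 ?invr_gt0//.
by rewrite nmulr_rlt0// subr_gt0 powR_gt1.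
Qed.

(** A concave function that vanishes at 1 after having been positive has a negative slope there. *)
Lemma fibs_lt0 t : k a b c d 1 = 0 -> 0 < t < 1 -> 0 < k a b c d t ->
  s a b d < 0.
Proof.
move=> k1 /andP[t0 t1] kt.
have := lt_le_trans kt (fibk_tangent a b0 c0 d0 t0).
rewrite k1 add0r pmulr_rgt0 ?powR_gt0// pmulr_lgt0 ?invr_gt0//.
by rewrite nmulr_lgt0// subr_lt0 powR_lt1.
Qed.

(** For the limit of a minimizing sequence only the weak inequality survives. A nonpositive slope at
    1 excludes positive values at [t >= 1], so any positive value lies before 1 and makes the slope
    strictly negative. *)
Lemma fibs_lt0_le t : k a b c d 1 = 0 -> s a b d <= 0 -> 0 < t ->
  0 < k a b c d t -> s a b d < 0.
Proof.
move=> k1 s0 t0 kt; apply: (@fibs_lt0 t) => //; rewrite t0/= ltNge.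
apply/negP => t1.
have := lt_le_trans kt (fibk_tangent a b0 c0 d0 t0).
rewrite k1 add0r pmulr_rgt0 ?powR_gt0// pmulr_lgt0 ?invr_gt0//.
apply/negP; rewrite -leNgt mulr_le0_ge0// subr_ge0.
rewrite leNgt powR_lt1// -leNgt//.
Qed.

(** If [k] were negative at [x], the tangent inequality at [x], evaluated once at 1 and once at [t],
    would make the slope at [x] both positive and negative. *)
Lemma fibk_ge0 t x : k a b c d 1 = 0 -> s a b d < 0 -> 0 < t ->
  0 <= k a b c d t -> t <= x <= 1 -> 0 <= k a b c d x.
Proof.
move=> k1 s0 t0 kt /andP[tx x1]; have x0 : 0 < x by lra.
rewrite leNgt; apply/negP => kx.
have [tx'|tx'] := eqVneq t x; first by rewrite tx' in kt; lra.
have [x1'|x1'] := eqVneq x 1; first by rewrite x1' in kx; lra.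
have bx := mulr_ge0 b0 (powR_ge0 x p).
have cx := mulr_ge0 c0 (powR_ge0 x q).
have dx := mulr_ge0 d0 (powR_ge0 x g).
have kM (y : R) : 0 <= y -> k a b c d y = k (a * x ^+ 2) (b * x `^ p) (c * x `^ q) (d * x `^ g) (y / x).
  by move=> y0; rewrite -fibkM ?(ltW x0) ?divr_ge0 ?(ltW x0)// mulrC divfK ?gt_eqF.
have yx y : 0 < y -> 0 < y / x by move=> ?; exact: divr_gt0.
have kx1 : k (a * x ^+ 2) (b * x `^ p) (c * x `^ q) (d * x `^ g) 1 < 0.
  by move: kx; rewrite (kM x) ?ltW// divff ?gt_eqF.
have T y (y0 : 0 < y) := fibk_tangent (a * x ^+ 2) bx cx dx (yx _ y0).
have := le_trans _ (T 1 ltr01); rewrite -kM// k1 => /(_ _ (lexx _)).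
rewrite pmulr_rge0 ?powR_gt0 ?yx// => h1.
have := le_trans _ (T t t0); rewrite -kM ?ltW// => /(_ _ kt).
rewrite pmulr_rge0 ?powR_gt0 ?yx// => h2.
have e1 : 0 < ((1 / x) `^ (2 - q) - 1) / (2 - q).
  by rewrite divr_gt0// subr_gt0 powR_gt1 ?yx// ltr_pdivlMr// mul1r lt_neqAle x1'.
have e2 : ((t / x) `^ (2 - q) - 1) / (2 - q) < 0.
  rewrite pmulr_llt0 ?invr_gt0// subr_lt0 powR_lt1 ?yx// ltr_pdivrMr// mul1r.
  by rewrite lt_neqAle tx'.
move: h1 h2; rewrite -!mulrA.
set w := s _ _ _ => h1 h2.
have w1 : 0 < w by rewrite -(pmulr_lgt0 _ e1); lra.
have : w * (((t / x) `^ (2 - q) - 1) / (2 - q)) < 0 by rewrite pmulr_rlt0.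
lra.
Qed.

Lemma is_derive_fibE t : 0 < t ->
  is_derive t 1 (E a b c d) (k a b c d t / t).
Proof.
move=> t0.
have Hp := is_derive1_powR p t0.
have Hq := is_derive1_powR q t0.
have Hg := is_derive1_powR g t0.
have -> : E a b c d = a / 2 *: (@id R ^+ 2) - b / p *: (@powR R)^~ p
    - c / q *: (@powR R)^~ q - d / g *: (@powR R)^~ g.
  by apply/funext => x; rewrite /fibE !fctE.
apply: is_derive_eq.
have tE x : t `^ (x - 1) = t `^ x / t.
  by rewrite powRD ?(gt_eqF t0) ?implybT// powR_inv1 ?ltW.
rewrite !tE /fibk /GRing.scale/=; field.
by rewrite !gt_eqF.
Qed.

Lemma fibE_cts t x : 0 < t -> {within `[t, x], continuous (E a b c d)}.
Proof.
move=> t0; apply: derivable_within_continuous => z; rewrite in_itv/= => /andP[tz _].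
by have /@ex_derive := is_derive_fibE (lt_le_trans t0 tz).
Qed.

Lemma fibE_ndecr t x : 0 < t -> t <= x ->
  (forall y, t < y < x -> 0 <= k a b c d y) -> E a b c d t <= E a b c d x.
Proof.
move=> t0; rewrite le_eqVlt => /predU1P[->//|tx] ky.
have [y|y] := @MVT R (E a b c d) (fun y => k a b c d y / y) t x tx _ (fibE_cts t0).
  by rewrite in_itv/= => /andP[ty _]; apply: is_derive_fibE; exact: lt_trans ty.
rewrite in_itv/= => ytx Exy; rewrite -subr_ge0 Exy.
rewrite mulr_ge0 ?divr_ge0 ?ky// ?subr_ge0 ?(ltW tx)//.
by case/andP: ytx => ty _; exact: ltW (lt_trans t0 ty).
Qed.

Lemma fibE_nincr t x : 0 < t -> t <= x ->
  (forall y, t < y < x -> k a b c d y <= 0) -> E a b c d x <= E a b c d t.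
Proof.
move=> t0; rewrite le_eqVlt => /predU1P[->//|tx] ky.
have [y|y] := @MVT R (E a b c d) (fun y => k a b c d y / y) t x tx _ (fibE_cts t0).
  by rewrite in_itv/= => /andP[ty _]; apply: is_derive_fibE; exact: lt_trans ty.
rewrite in_itv/= => ytx Exy; rewrite -subr_le0 Exy.
rewrite mulr_le0_ge0 ?subr_ge0 ?(ltW tx)// mulr_le0_ge0 ?ky// invr_ge0.
by case/andP: ytx => ty _; exact: ltW (lt_trans t0 ty).
Qed.

Lemma fibE_le1_of_ge0 t : k a b c d 1 = 0 -> s a b d < 0 -> 0 < t ->
  0 <= k a b c d t -> E a b c d t <= E a b c d 1.
Proof.
move=> k1 s0 t0 kt.
have t1 : t <= 1.
  by rewrite leNgt; apply/negP => /(fibk_lt0 k1 s0); rewrite ltNge kt.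
apply: fibE_ndecr => // y /andP[ty y1].
by apply: fibk_ge0 kt _ => //; rewrite !ltW.
Qed.

Lemma fibE_le1_of_ge1 t : k a b c d 1 = 0 -> s a b d < 0 -> 1 <= t ->
  E a b c d t <= E a b c d 1.
Proof.
move=> k1 s0 t1; apply: fibE_nincr => // y /andP[y1 yt].
by rewrite ltW// fibk_lt0.
Qed.

(** When [t < 1] and [k] is negative at [t], it is negative on all of (0, t) by [fibk_ge0], so the
    energy decreases there from its limit 0 at the origin. In the other cases the value at 1
    dominates. *)
Lemma fibE_le_max t : k a b c d 1 = 0 -> s a b d < 0 -> 0 < t ->
  E a b c d t <= Num.max 0 (E a b c d 1).
Proof.
move=> k1 s0 t0; rewrite le_max.
have [t1|t1] := leP 1 t; first by rewrite fibE_le1_of_ge1// orbT.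
have [kt|kt] := leP 0 (k a b c d t); first by rewrite fibE_le1_of_ge0// orbT.
apply/orP; left; apply/ler_addgt0Pl => /= e e0; rewrite addr0.
have a0 : 0 <= a.
  move: k1 (b0) (c0) (d0); rewrite fibk1; lra.
(* The energy at [x] is at most a x^2 / 2, and [x <= e / (a + 1)] together with [x < 1] brings this
   below [e]. *)
have [x [x0 xt xe]] : exists x, [/\ 0 < x, x <= t & x <= e / (a + 1)].
  exists (Num.min t (e / (a + 1))); split.
  - by rewrite lt_min t0 divr_gt0// ltr_wpDl.
  - by rewrite ge_min lexx.
  - by rewrite ge_min lexx orbT.
have : E a b c d t <= E a b c d x.
  apply: fibE_nincr => // y /andP[xy yt].
  rewrite leNgt; apply/negP => ky.
  have y0 : 0 < y by lra.
  have := fibk_ge0 k1 s0 y0 (ltW ky) (x := t).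
  by rewrite (ltW yt) (ltW t1) => /(_ isT); rewrite leNgt kt.
move/le_trans; apply.
have : E a b c d x <= a / 2 * x ^+ 2.
  rewrite /fibE.
  have : 0 <= b / p * x `^ p by rewrite mulr_ge0 ?powR_ge0// divr_ge0// ltW.
  have : 0 <= c / q * x `^ q by rewrite mulr_ge0 ?powR_ge0// divr_ge0// ltW.
  have : 0 <= d / g * x `^ g by rewrite mulr_ge0 ?powR_ge0// divr_ge0// ltW.
  lra.
move/le_trans; apply.
have xe' : (a + 1) * x <= e by move: xe; rewrite ler_pdivlMr ?ltr_wpDl// mulrC.
have ax0 : 0 <= a * x by rewrite mulr_ge0// ltW.
have : a * x * x <= e * 1.
  by apply: ler_pM => //; [exact: ltW|lra|lra].
rewrite expr2; lra.
Qed.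

End nonneg.

Lemma fibk_cts a b c d t x : 0 < t -> {within `[t, x], continuous (k a b c d)}.
Proof.
move=> t0; apply: derivable_within_continuous => z; rewrite in_itv/= => /andP[tz _].
have z0 := lt_le_trans t0 tz.
have Hp := is_derive1_powR p z0.
have Hq := is_derive1_powR q z0.
have Hg := is_derive1_powR g z0.
have -> : k a b c d = a *: (@id R ^+ 2) - b *: (@powR R)^~ p
    - c *: (@powR R)^~ q - d *: (@powR R)^~ g.
  by apply/funext => y; rewrite /fibk !fctE.
by apply: (@ex_derive _ _ _ _ _ _ _ (is_deriveB _ _)).
Qed.

(** Used below for auxiliary polynomials whose coefficients are first variations, of arbitrary
    sign. *)
Lemma fibk_near a b c d : k a b c d 1 < 0 ->
  exists2 r, 0 < r < 1 & forall t, `|t - 1| <= r -> k a b c d t < 0.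
Proof.
move=> k1.
have ck : {for 1, continuous (k a b c d)}.
  have Hp := is_derive1_powR p (@ltr01 R).
  have Hq := is_derive1_powR q (@ltr01 R).
  have Hg := is_derive1_powR g (@ltr01 R).
  apply: differentiable_continuous; apply/derivable1_diffP.
  have -> : k a b c d = a *: (@id R ^+ 2) - b *: (@powR R)^~ p
      - c *: (@powR R)^~ q - d *: (@powR R)^~ g.
    by apply/funext => y; rewrite /fibk !fctE.
  by apply: (@ex_derive _ _ _ _ _ _ _ (is_deriveB _ _)).
have /nbhs_ballP[e /= e0 He] : \forall t \near (1 : R), k a b c d t < 0.
  exact: (cvgr_lt _ ck).
have [m1 m2 m3] : [/\ 0 < Num.min e 1, Num.min e 1 <= e & Num.min e 1 <= 1].
  by rewrite lt_min e0 ltr01 !ge_min !lexx orbT.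
exists (Num.min e 1 / 2); first by move: m1 m3; set m := Num.min _ _; lra.
move=> t te; apply: He; rewrite /ball/= distrC.
by move: te m1 m2; set m := Num.min _ _; lra.
Qed.

Lemma fibk_zero a b c d t : 0 <= a -> 0 <= b -> 0 <= c -> 0 < d -> 0 < t ->
  0 < k a b c d t -> exists2 x, t < x & k a b c d x = 0.
Proof.
move=> a0 b0 c0 d0 t0 kt.
have g2 : 0 < g - 2 by move: hg; lra.
(* Past (a/d)^(1/(g-2)) the term d y^g dominates a y^2, so [k] is nonpositive at [y] and vanishes
   between [t] and [y]. *)
pose y := t + 1 + (a / d) `^ (g - 2)^-1.
have y0 : 0 < y by rewrite /y; have := powR_ge0 (a / d) (g - 2)^-1; lra.
have ty : t <= y by rewrite /y; have := powR_ge0 (a / d) (g - 2)^-1; lra.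
have ky : k a b c d y <= 0.
  have h : a <= d * y `^ (g - 2).
    rewrite mulrC -ler_pdivrMr//.
    have -> : a / d = ((a / d) `^ (g - 2)^-1) `^ (g - 2).
      rewrite -powRrM mulVf ?gt_eqF// powRr1// divr_ge0// ltW//.
    apply: ge0_ler_powR; rewrite ?nnegrE ?powR_ge0 ?ltW//.
    by rewrite /y; lra.
  rewrite /fibk; have := mulr_ge0 b0 (powR_ge0 y p).
  have := mulr_ge0 c0 (powR_ge0 y q).
  have -> : y `^ g = y ^+ 2 * y `^ (g - 2).
    rewrite -powR_mulrn ?ltW// -powRD; last by rewrite (gt_eqF y0) implybT.
    by rewrite subrKC.
  have := ler_wpM2r (sqr_ge0 y) h; lra.
have [|x xty kx] := @IVT R _ _ _ 0 ty (@fibk_cts a b c d t y t0).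
  by rewrite ge_min le_max ky (ltW kt) orbT.
exists x => //; move: xty; rewrite in_itv/= le_eqVlt => /andP[/predU1P[tx|//] _].
by rewrite tx kx ltxx in kt.
Qed.

(** After rescaling the zero [x] to 1, the point [t] sits at [t / x < 1] with a positive value, so
    [fibs_lt0] applies. *)
Lemma fib_proj a b c d t : 0 <= a -> 0 <= b -> 0 <= c -> 0 < d -> 0 < t ->
  0 < k a b c d t ->
  exists2 x, t < x &
    k (a * x ^+ 2) (b * x `^ p) (c * x `^ q) (d * x `^ g) 1 = 0 /\
    s (a * x ^+ 2) (b * x `^ p) (d * x `^ g) < 0.
Proof.
move=> a0 b0 c0 d0 t0 kt; have [x tx kx] := fibk_zero a0 b0 c0 d0 t0 kt.
have x0 : 0 < x by exact: lt_trans tx.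
have kx1 : k (a * x ^+ 2) (b * x `^ p) (c * x `^ q) (d * x `^ g) 1 = 0.
  by rewrite -fibkM ?ltW// mulr1.
exists x => //; split=> //; apply: (@fibs_lt0 _ _ _ _ _ _ _ (t / x)) kx1 _ _.
- by rewrite mulr_ge0// powR_ge0.
- by rewrite mulr_ge0// powR_ge0.
- by rewrite mulr_ge0 ?powR_ge0// ltW.
- by rewrite divr_gt0// ltr_pdivrMr// mul1r.
- rewrite -fibkM ?(ltW x0)// ?divr_ge0 ?(ltW x0) ?(ltW t0)//.
  by rewrite mulrC divfK// gt_eqF.
Qed.

End exponents.
End fibering.

(** * Minimization on the Nehari set *)

Section nehari_minimization.
Context {R : realType}.
Variables (p q g theta : R).
Hypotheses (hp : 1 <= p) (hpq : p <= q) (hq : q < 2) (hg : 2 < g).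
Hypothesis (htheta : 0 < theta).
Implicit Types lambda e t eps : R.
(** [A], [P], [Q], [C] stand for the squared norm, the powers of the two Lebesgue norms and the
    coupling; [sc] is multiplication by a positive number. Perturbations enter later only as curves
    in [T]. *)
Variables (T : Type) (X : set T) (sc : R -> T -> T) (A P Q C : T -> R).
Hypothesis scX : forall (t : R) w, 0 < t -> X w -> X (sc t w).
Hypothesis scA : forall t w, 0 < t -> X w -> A (sc t w) = A w * t ^+ 2.
Hypothesis scP : forall t w, 0 < t -> X w -> P (sc t w) = P w * t `^ p.
Hypothesis scQ : forall t w, 0 < t -> X w -> Q (sc t w) = Q w * t `^ q.
Hypothesis scC : forall t w, 0 < t -> X w -> C (sc t w) = C w * t `^ g.
Hypothesis A_ge0 : forall w, X w -> 0 <= A w.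
Hypothesis P_ge0 : forall w, X w -> 0 <= P w.
Hypothesis Q_ge0 : forall w, X w -> 0 <= Q w.
Variable B : R.
Hypothesis ball_bound : forall w, X w -> A w <= 1 ->
  [/\ P w <= B, Q w <= B & C w <= B].
(** Compactness in the form available: [P], [Q], [C] pass to the limit along a subsequence, whereas
    the limit [a] of [A] only dominates [A z]. *)
Hypothesis X_cluster : forall (K : R) (w : nat -> T),
  (forall n, X (w n) /\ A (w n) <= K) ->
  exists z a, [/\ X z, A z <= a & forall (e : R) m, 0 < e -> exists2 n, (m <= n)%N &
    [/\ `|A (w n) - a| < e, `|P (w n) - P z| < e, `|Q (w n) - Q z| < e
      & `|C (w n) - C z| < e]].

Definition fibX (lambda : R) (w : T) t :=
  fibk p q g (A w) (lambda * P w) (lambda * Q w) (theta * C w) t.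
Definition fibEX (lambda : R) (w : T) t :=
  fibE p q g (A w) (lambda * P w) (lambda * Q w) (theta * C w) t.
Definition fibsX (lambda : R) (w : T) :=
  fibs p q g (A w) (lambda * P w) (theta * C w).
(** The part of N^- with positive coupling: once [A] is eliminated by the Nehari identity, [fibsX]
    equals the second derivative E''(w)(w)^2. *)
Definition nehariX (lambda : R) : set T :=
  [set w | [/\ X w, 0 < C w, fibX lambda w 1 = 0 & fibsX lambda w < 0]].

Let p0 : 0 < p. Proof. by move: hp; lra. Qed.
Let q0 : 0 < q. Proof. by move: hp hpq; lra. Qed.
Let g0 : 0 < g. Proof. by move: hg; lra. Qed.

Lemma fibX_sc lambda t w : 0 < t -> X w -> fibX lambda (sc t w) 1 = fibX lambda w t.
Proof.
move=> t0 Xw; rewrite -[in RHS](mulr1 t) /fibX fibkM ?(ltW t0)//.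
by rewrite scA// scP// scQ// scC// !mulrA.
Qed.

Lemma fibEX_sc lambda t w : 0 < t -> X w -> fibEX lambda (sc t w) 1 = fibEX lambda w t.
Proof.
move=> t0 Xw; rewrite -[in RHS](mulr1 t) /fibEX fibEM ?(ltW t0)//.
by rewrite scA// scP// scQ// scC// !mulrA.
Qed.

Lemma nehariX_proj lambda w t : 0 <= lambda -> X w -> 0 < C w -> 0 < t ->
  0 < fibX lambda w t ->
  exists2 x, t < x & nehariX lambda (sc x w).
Proof.
move=> l0 Xw Cw t0 kt.
have lP := mulr_ge0 l0 (P_ge0 Xw); have lQ := mulr_ge0 l0 (Q_ge0 Xw).
have [x tx [kx sx]] := fib_proj hp hpq hq hg (A_ge0 Xw) lP lQ (mulr_gt0 htheta Cw) t0 kt.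
have x0 := lt_trans t0 tx; exists x => //; split; first exact: scX.
- by rewrite scC// mulr_gt0// powR_gt0.
- by rewrite /fibX scA// scP// scQ// scC// !(mulrA _ _ (x `^ _)).
- by rewrite /fibsX scA// scP// scC// !(mulrA _ _ (x `^ _)).
Qed.

Lemma ball_bound_ge0 w : X w -> 0 <= B.
Proof.
move=> Xw; pose t := (1 + A w) `^ (- 2^-1).
have A1 : 0 < 1 + A w by have := A_ge0 Xw; lra.
have t0 : 0 < t by rewrite powR_gt0.
have [] := @ball_bound (sc t w) (scX t0 Xw); last first.
  by move=> + _ _; apply: le_trans; exact: P_ge0 (scX _ _).
rewrite scA//.
have -> : t ^+ 2 = (1 + A w)^-1.
  rewrite -powR_mulrn ?ltW// -powRrM mulNr mulVf// powR_inv1// ltW//.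
by rewrite ler_pdivrMr// mul1r; lra.
Qed.

(** Scaling by a^(-1/2) brings [w] into the unit ball. The bound is stated with some positive
    [a >= A w] because [A w] itself may vanish. *)
Lemma homogeneous_bound (F : T -> R) e w : X w -> 0 < e ->
  (forall t w, 0 < t -> X w -> F (sc t w) = F w * t `^ e) ->
  (forall w, X w -> A w <= 1 -> F w <= B) ->
  forall a, 0 < a -> A w <= a -> F w <= B * a `^ (e / 2).
Proof.
move=> Xw e0 Fsc FB a a0 Aa; pose t := a `^ (- 2^-1).
have t0 : 0 < t by rewrite powR_gt0.
have : F (sc t w) <= B.
  apply: FB; first exact: scX.
  rewrite scA//.
  have -> : t ^+ 2 = a^-1.
    by rewrite -powR_mulrn ?ltW// -powRrM mulNr mulVf// powR_inv1// ltW.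
  by rewrite ler_pdivrMr// mul1r.
rewrite Fsc// -ler_pdivlMr ?powR_gt0// -powRN -powRrM.
by have -> : - 2^-1 * - e = e / 2 by rewrite mulrNN mulrC.
Qed.

Lemma powR_sublinear (e eps : R) : 0 <= e < 1 -> 0 < eps ->
  exists2 K, 0 <= K & forall x, 0 <= x -> x `^ e <= eps * x + K.
Proof.
(* [M] is the threshold at which x^(e-1) equals [eps]: beyond it the linear term is enough, below it
   the constant M^e is. *)
move=> /andP[e0 e1] eps0; pose M := eps `^ (- (1 - e)^-1).
have M0 : 0 < M by rewrite powR_gt0.
exists (M `^ e); first exact: powR_ge0.
move=> x x0; have [xM|Mx] := leP x M.
  apply: (@le_trans _ _ (M `^ e)); first by apply: ge0_ler_powR; rewrite ?nnegrE// ltW.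
  by rewrite lerDr mulr_ge0// ltW.
have xg0 : 0 < x by exact: lt_trans Mx.
have -> : x `^ e = x * x `^ (e - 1).
  rewrite -[X in X * _](powRr1 x0) -powRD ?(gt_eqF xg0) ?implybT//.
  by rewrite addrC subrK.
have : x `^ (e - 1) <= eps.
  have -> : eps = M `^ (e - 1).
    rewrite /M -powRrM.
    have -> : - (1 - e)^-1 * (e - 1) = 1 by field; rewrite gt_eqF//; lra.
    by rewrite powRr1// ltW.
  rewrite -(opprB 1 e) !powRN lef_pV2 ?posrE ?powR_gt0//.
  by apply: ge0_ler_powR; rewrite ?nnegrE ?ltW//; lra.
have := powR_ge0 M e; nra.
Qed.

Lemma subquadratic (F : T -> R) e eps : 0 < e < 2 ->
  (forall t w, 0 < t -> X w -> F (sc t w) = F w * t `^ e) ->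
  (forall w, X w -> A w <= 1 -> F w <= B) -> 0 < eps ->
  exists2 K, 0 <= K & forall w, X w -> F w <= eps * A w + K.
Proof.
move=> /andP[e0 e2] Fsc FB eps0.
have [B0|B0] := ltP B 0.
  by exists 0 => // w Xw; have := ball_bound_ge0 Xw; rewrite leNgt B0.
have e12 : 0 <= e / 2 < 1 by lra.
(* Dividing by [B + 1] keeps the denominator positive when [B = 0]; likewise [1 + A w] replaces
   [A w], which may vanish. *)
have eps1 : 0 < eps / (B + 1) by rewrite divr_gt0// ltr_wpDl.
have [K K0 HK] := powR_sublinear e12 eps1.
exists (eps + B * K); first by rewrite addr_ge0 ?mulr_ge0// ltW.
move=> w Xw; have A0 := A_ge0 Xw.
have A1 : 0 < 1 + A w by lra.
apply: le_trans (homogeneous_bound Xw e0 Fsc FB A1 _) _; first by lra.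
have := ler_wpM2l B0 (HK (1 + A w) (ltW A1)).
have : B * (eps / (B + 1)) <= eps.
  by rewrite mulrA ler_pdivrMr ?ltr_wpDl//; nra.
nra.
Qed.

(** * The ground level for a fixed positive parameter *)

Section positive_lambda.
Variable lambda : R.
Hypothesis l0 : 0 < lambda.

(** Eliminating the coupling by the Nehari identity leaves (1/2 - 1/g) A minus multiples of [P] and
    [Q], which are subquadratic. The constant [c] is half of 1/2 - 1/g; the other half absorbs the
    two terms [c / 2 * A w]. *)
Lemma nehariX_coercive : exists2 c, 0 < c & exists2 K, 0 <= K &
  forall w, X w -> fibX lambda w 1 = 0 -> c * A w <= fibEX lambda w 1 + K.
Proof.
pose c := (2^-1 - g^-1) / 2.
have c0 : 0 < c by rewrite divr_gt0// subr_gt0 ltf_pV2 ?posrE.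
have eps0 : 0 < c / (2 * lambda) by rewrite divr_gt0// mulr_gt0.
have p2 : 0 < p < 2 by rewrite p0/=; exact: le_lt_trans hq.
have q2 : 0 < q < 2 by rewrite q0.
have [K1 K10 HP] := subquadratic p2 scP (fun w Xw Aw => let: And3 h _ _ := ball_bound Xw Aw in h) eps0.
have [K2 K20 HQ] := subquadratic q2 scQ (fun w Xw Aw => let: And3 _ h _ := ball_bound Xw Aw in h) eps0.
exists c => //; exists (lambda * (K1 + K2)).
  by rewrite mulr_ge0 ?(ltW l0)// addr_ge0.
move=> w Xw; rewrite /fibX fibk1 => k1.
have -> : fibEX lambda w 1 = 2 * c * A w - lambda * (p^-1 - g^-1) * P w - lambda * (q^-1 - g^-1) * Q w.
  have -> : 2 * c = 2^-1 - g^-1 by rewrite mulrC divfK.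
  have -> : fibEX lambda w 1 = A w / 2 - lambda * P w / p - lambda * Q w / q - theta * C w / g.
    by rewrite /fibEX /fibE expr1n !powR1 !mulr1.
  have -> : theta * C w = A w - lambda * P w - lambda * Q w by lra.
  by field; rewrite !gt_eqF.
have hP := HP _ Xw; have hQ := HQ _ Xw.
have ig : 0 < g^-1 by rewrite invr_gt0.
have ip : p^-1 <= 1 by rewrite invf_le1.
have iq : q^-1 <= 1 by rewrite invf_le1//; exact: le_trans hpq.
have PP : (p^-1 - g^-1) * P w <= P w.
  by rewrite ler_piMl ?P_ge0//; lra.
have QQ : (q^-1 - g^-1) * Q w <= Q w.
  by rewrite ler_piMl ?Q_ge0//; lra.
have := ler_wpM2l (ltW l0) (le_trans PP hP).
have := ler_wpM2l (ltW l0) (le_trans QQ hQ).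
have -> : lambda * (c / (2 * lambda) * A w + K2) = c / 2 * A w + lambda * K2.
  by field; rewrite gt_eqF.
have -> : lambda * (c / (2 * lambda) * A w + K1) = c / 2 * A w + lambda * K1.
  by field; rewrite gt_eqF.
rewrite -!mulrA; set x := p^-1 - _; set y := q^-1 - _; lra.
Qed.

(** [fibsX < 0] gives A <= K C, and homogeneity gives C <= D C^(g/2). Since g/2 > 1, the coupling
    cannot be small, so it does not vanish in the limit of a minimizing sequence. *)
Lemma nehariX_coupling_ge : exists2 del, 0 < del &
  forall w, nehariX lambda w -> del <= C w.
Proof.
pose K := theta * (g - q) / (2 - q).
have K0 : 0 < K.
  by rewrite divr_gt0 ?subr_gt0// mulr_gt0// subr_gt0 (lt_trans hq).
pose D := (`|B| + 1) * K `^ (g / 2).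
have D0 : 0 < D by rewrite mulr_gt0 ?powR_gt0// ltr_wpDl.
have g2 : 0 < g / 2 - 1 by move: hg; lra.
exists ((D^-1) `^ (g / 2 - 1)^-1); first by rewrite powR_gt0 ?invr_gt0.
move=> w [Xw Cw k1 s1].
have AK : A w <= K * C w.
  rewrite /K mulrAC ler_pdivlMr ?subr_gt0//.
  move: s1; rewrite /fibsX /fibs.
  have : 0 <= (q - p) * (lambda * P w).
    by rewrite mulr_ge0 ?subr_ge0// mulr_ge0 ?P_ge0// ltW.
  lra.
have KC0 : 0 < K * C w by rewrite mulr_gt0.
have := homogeneous_bound Xw g0 scC (fun w Xw Aw => let: And3 _ _ h := ball_bound Xw Aw in h) KC0 AK.
rewrite powRM ?(ltW K0) ?(ltW Cw)// => h.
have {}h : C w <= D * C w `^ (g / 2).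
  apply: (le_trans h); rewrite /D -!mulrA ler_wpM2r ?mulr_ge0 ?powR_ge0//.
  by have := ler_norm B; lra.
have Cg : C w `^ (g / 2) = C w * C w `^ (g / 2 - 1).
  by rewrite mulr_powRB1 ?divr_gt0// ltW.
move: h; rewrite Cg mulrCA ler_pMr// => h.
have -> : C w = (C w `^ (g / 2 - 1)) `^ (g / 2 - 1)^-1.
  by rewrite -powRrM divff ?gt_eqF// powRr1// ltW.
apply: ge0_ler_powR; rewrite ?nnegrE ?powR_ge0 ?invr_ge0 ?(ltW D0) ?(ltW g2)//.
by rewrite -(ler_pM2l D0) divff ?gt_eqF.
Qed.

Ltac lra_goal_only := clear -p q g theta hp hpq hq hg htheta T X sc A P Q C scX scA scP scQ scC
  A_ge0 P_ge0 Q_ge0 B ball_bound X_cluster p0 q0 g0 lambda l0; lra.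

Definition ground_level := inf [set fibEX lambda w 1 | w in nehariX lambda].

Lemma ground_level_le w : nehariX lambda w -> ground_level <= fibEX lambda w 1.
Proof.
have [c c0 [K K0 cK]] := nehariX_coercive.
move=> Nw; apply: ge_inf; last by exists w.
exists (- K) => _ [z [Xz _ kz _] <-].
have := cK _ Xz kz; have := mulr_ge0 (ltW c0) (A_ge0 Xz); lra.
Qed.

Section minimizer.
Hypothesis proj : forall w, X w -> 0 < C w -> exists2 t, 0 < t & 0 < fibX lambda w t.

Lemma ground_state_exists : (exists2 w, X w & 0 < C w) ->
  exists2 z, nehariX lambda z & fibEX lambda z 1 = ground_level.
Proof.
move=> [w0 Xw0 Cw0].
have [t0 t00 /(nehariX_proj (ltW l0) Xw0 Cw0 t00)[x0 /(lt_trans t00) x00 N0]] := proj Xw0 Cw0.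
have [c c0 [K K0 cK]] := nehariX_coercive.
have [del del0 delC] := nehariX_coupling_ge.
set J := ground_level.
have Jinf : has_inf [set fibEX lambda w 1 | w in nehariX lambda].
  split; first by exists (fibEX lambda (sc x0 w0) 1), (sc x0 w0).
  exists (- K) => _ [z [Xz _ kz _] <-].
  have := cK _ Xz kz; have := mulr_ge0 (ltW c0) (A_ge0 Xz); lra.
have [ei [ei0 ei1 eim]] : exists ei : nat -> R, [/\ forall n, 0 < ei n,
    forall n, ei n <= 1 &
    forall e, 0 < e -> exists m, forall n, (m <= n)%N -> ei n <= e].
  exists (fun n => n.+1%:R^-1); split=> [n|n|e e0].
  - by rewrite invr_gt0.
  - by rewrite invf_le1// ler1n.
  - have [m] := ltr_add_invr e0; rewrite add0r => /ltW me.
    by exists m => n mn; apply: le_trans me; rewrite lef_pV2 ?posrE// ler_nat.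
have /choice[w wP] : forall n : nat, exists w, nehariX lambda w /\
    fibEX lambda w 1 < J + ei n.
  by move=> n; have [_ [w Nw <-] ?] := inf_adherent (ei0 n) Jinf; exists w.
have [|z [a [Xz Aza lim]]] := @X_cluster ((J + 1 + K) / c) w.
  move=> n; have [[Xw _ kw _] Ew] := wP n; split => //.
  rewrite ler_pdivlMr// mulrC; have := cK _ Xw kw.
  have := lt_le_trans Ew (lerD (lexx J) (ei1 n)); lra.
(* Affine inequalities valid up to [o(1)] along [w] pass to the cluster point. *)
have limle (c1 c2 c3 c4 c5 : R) :
    (forall n : nat, c1 * A (w n) + c2 * P (w n) + c3 * Q (w n) + c4 * C (w n)
      <= c5 + ei n) ->
    c1 * a + c2 * P z + c3 * Q z + c4 * C z <= c5.
  move=> H; apply/ler_addgt0Pl => /= e e0.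
  pose M := `|c1| + `|c2| + `|c3| + `|c4| + 1.
  have M0 : 0 < M.
    by rewrite /M; have := normr_ge0 c1; have := normr_ge0 c2;
      have := normr_ge0 c3; have := normr_ge0 c4; lra.
  have e2 : 0 < e / 2 / M by rewrite !divr_gt0.
  have [m me] := eim _ (divr_gt0 e0 (@ltr0Sn R 1)).
  have [n mn [hA hP hQ hC]] := lim _ m e2.
  have D (u v y : R) : `|u - v| < e / 2 / M -> y * v <= y * u + `|y| * (e / 2 / M).
    move=> uv; rewrite -lerBlDl -mulrBr.
    apply: (le_trans (ler_norm _)); rewrite normrM distrC.
    by rewrite ler_wpM2l// ltW.
  have := D _ _ c1 hA; have := D _ _ c2 hP; have := D _ _ c3 hQ.
  have := D _ _ c4 hC; have := le_trans (H n) (lerD (lexx c5) (me _ mn)).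
  have : (`|c1| + `|c2| + `|c3| + `|c4|) * (e / 2 / M) <= e / 2.
    rewrite mulrCA -[X in _ <= X]mulr1 ler_wpM2l ?(divr_ge0 (ltW e0))//.
    by rewrite ler_pdivrMr// mul1r /M; lra.
  lra.
have kw n : A (w n) - lambda * P (w n) - lambda * Q (w n) - theta * C (w n) = 0.
  by have [[_ _ + _] _] := wP n; rewrite /fibX fibk1.
have Cz : 0 < C z.
  suff : 0 * a + 0 * P z + 0 * Q z + (-1) * C z <= - del by move: del0; lra.
  apply: limle => n; have [/delC] := wP n; have := ei0 n; lra.
(* The fictitious limit ray, with [a] instead of [A z]. It satisfies the Nehari identity at 1 and
   has energy at most [J] there, and [A z <= a] places it above the true ray of [z]. *)
pose ka t := fibk p q g a (lambda * P z) (lambda * Q z) (theta * C z) t.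
pose Ea t := fibE p q g a (lambda * P z) (lambda * Q z) (theta * C z) t.
have ka1 : ka 1 = 0.
  rewrite /ka fibk1; apply/eqP; rewrite eq_le; apply/andP; split.
    suff : 1 * a + (- lambda) * P z + (- lambda) * Q z + (- theta) * C z <= 0 by lra.
    by apply: limle => n; have := kw n; have := ei0 n; lra.
  suff : (- 1) * a + lambda * P z + lambda * Q z + theta * C z <= 0 by lra.
  by apply: limle => n; have := kw n; have := ei0 n; lra.
have sa0 : fibs p q g a (lambda * P z) (theta * C z) <= 0.
  rewrite /fibs.
  rewrite [leLHS](_ : _ = (2 - q) * a + ((q - p) * lambda) * P z + 0 * Q z + (- (g - q) * theta) * C z); last by ring.
  apply: limle => n; have [[_ _ _ +] _] := wP n; rewrite /fibsX /fibs.
  have := ei0 n; lra.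
have EaJ : Ea 1 <= J.
  rewrite /Ea /fibE expr1n !powR1 !mulr1.
  rewrite [leLHS](_ : _ = 2^-1 * a + (- (lambda / p)) * P z + (- (lambda / q)) * Q z + (- (theta / g)) * C z); last by field; rewrite !gt_eqF.
  apply: limle => n; have [_ /ltW] := wP n; apply: le_trans.
  rewrite /fibEX /fibE expr1n !powR1 !mulr1.
  by rewrite le_eqVlt; apply/orP; left; apply/eqP; field; rewrite !gt_eqF.
have lP := mulr_ge0 (ltW l0) (P_ge0 Xz); have lQ := mulr_ge0 (ltW l0) (Q_ge0 Xz).
have tC := ltW (mulr_gt0 htheta Cz).
have kle t : fibX lambda z t <= ka t.
  by rewrite /ka /fibX /fibk; have := ler_wpM2r (sqr_ge0 t) Aza; lra.
have [t tp kt] := proj Xz Cz.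
have kat := lt_le_trans kt (kle t).
(* Strictness comes from [proj] at [z]: its positive value of [fibX] passes to [ka]. *)
have {}sa0 := fibs_lt0_le hp hpq hq hg lP lQ tC ka1 sa0 tp kat.
have [x /(lt_trans tp) xp [Xx Cx kx sx]] := nehariX_proj (ltW l0) Xz Cz tp kt.
exists (sc x z); first by split.
apply/eqP; rewrite eq_le; apply/andP; split; last by apply: ground_level_le; split.
(* The energy of [z] at [x] is at most [Ea x] because [A z <= a]. In turn [Ea x <= Ea 1], because
   [ka x] is at least [fibX lambda z x], which is 0, and a point with nonnegative [ka] lies where
   [Ea] is still rising to its value at 1. *)
rewrite fibEX_sc//; apply: le_trans EaJ.
apply: (@le_trans _ _ (Ea x)).
  by rewrite /Ea /fibEX /fibE; have := ler_wpM2r (sqr_ge0 x) Aza; lra.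
apply: fibE_le1_of_ge0 => //.
by apply: le_trans (kle x); rewrite -fibX_sc// kx.
Qed.

(* Replacing [z] by [W e] moves the Nehari point of its ray only to some [x]
   close to 1. Since [fibEX lambda z x <= ground_level <= fibEX lambda (W e) x],
   the derivative in [e] cannot be negative. *)
Lemma ground_state_variation z (W : R -> T) (I D P1 Q1 C1 L : R) :
  nehariX lambda z -> fibEX lambda z 1 = ground_level ->
  (forall e, 0 < e <= 1 -> [/\ X (W e),
    A (W e) = A z + 2 * e * I + e ^+ 2 * D,
    P z + e * P1 <= P (W e) <= P z + e * L,
    Q z + e * Q1 <= Q (W e) <= Q z + e * L &
    C z + e * C1 <= C (W e) <= C z + e * L]) ->
  0 <= I - lambda * P1 / p - lambda * Q1 / q - theta * C1 / g.
Proof.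
move=> [Xz Cz kz sz] Ez HW.
set S := _ - theta * C1 / g; rewrite leNgt; apply/negP => S0.
pose m t := fibk p q g I (lambda * P1 / p) (lambda * Q1 / q) (theta * C1 / g) t.
(* At 1 this polynomial is S - S/2 = S/2, which is negative; staying negative near 1 means that
   [m x] is at most S/2 times x^2. *)
have /(@fibk_near _ p q g)[r1 /andP[r10 r11] Hr1] :
    fibk p q g (I - S / 2) (lambda * P1 / p) (lambda * Q1 / q) (theta * C1 / g) 1 < 0.
  by rewrite fibk1 -/S; rewrite [ltLHS](_ : _ = S / 2); [lra|rewrite /S; lra].
(* This polynomial is [fibs] of the coefficients rescaled along the ray of [z], so the slope
   condition of N^- persists within distance [r2] of 1. *)
have /(@fibk_near _ p q g)[r2 /andP[r20 r21] Hr2] :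
    fibk p q g ((2 - q) * A z) (- ((q - p) * (lambda * P z))) 0 ((g - q) * (theta * C z)) 1 < 0.
  by rewrite fibk1 subr0 opprK.
have [r [r0 rr1 rr2]] : exists r, [/\ 0 < r, r <= r1 & r <= r2].
  by exists (Num.min r1 r2); rewrite lt_min r10 r20 !ge_min !lexx orbT.
have lP := mulr_ge0 (ltW l0) (P_ge0 Xz); have lQ := mulr_ge0 (ltW l0) (Q_ge0 Xz).
have tC := ltW (mulr_gt0 htheta Cz).
have kp : fibX lambda z (1 + r) < 0 by apply: fibk_lt0 => //; lra.
(* The tangent inequality at 1 - r, evaluated at 1 where [fibX] vanishes, has a negative slope times
   a positive increment; so the value at 1 - r is positive. *)
have km : 0 < fibX lambda z (1 - r).
  have x0 : 0 < 1 - r by lra.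
  have /Hr2 : `|(1 - r) - 1| <= r2 by rewrite addrAC subrr add0r normrN gtr0_norm.
  rewrite /fibX; set x := 1 - r => sx.
  have Px := mulr_ge0 lP (powR_ge0 x p).
  have Qx := mulr_ge0 lQ (powR_ge0 x q).
  have Cx := mulr_ge0 tC (powR_ge0 x g).
  have ix : 0 < 1 / x by rewrite divr_gt0.
  have := fibk_tangent hp hpq hq hg (A z * x ^+ 2) Px Qx Cx ix.
  rewrite -!fibkM ?(ltW ix) ?(ltW x0)// mulr1 (mulrC x) divfK ?gt_eqF//.
  rewrite [in leLHS](_ : fibk _ _ _ _ _ _ _ _ = 0)// => H.
  have {}H : 0 <= fibX lambda z x + fibs p q g (A z * x ^+ 2) (lambda * P z * x `^ p) (theta * C z * x `^ g) * (((1 / x) `^ (2 - q) - 1) / (2 - q)).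
    by rewrite -(pmulr_rge0 _ (powR_gt0 q ix)) mulrA.
  have s0 : fibs p q g (A z * x ^+ 2) (lambda * P z * x `^ p) (theta * C z * x `^ g) < 0.
    by move: sx; rewrite /fibs /fibk; lra.
  have t0 : 0 < ((1 / x) `^ (2 - q) - 1) / (2 - q).
    rewrite divr_gt0 ?subr_gt0// powR_gt1 ?subr_gt0// ltr_pdivlMr// mul1r.
    by rewrite /x; lra.
  move: (t0); rewrite -(nmulr_rlt0 _ s0) => st0.
  by rewrite /fibX -/x in H; rewrite -/x; lra.
(* [M t] bounds the Lipschitz constant in [e] of the coefficients. *)
pose Y := 2 * `|I| + `|D|.
pose L' := Num.max `|L| (Num.max `|P1| (Num.max `|Q1| `|C1|)).
have [L0 PL QL CL] : [/\ L <= L', - L' <= P1, - L' <= Q1 & - L' <= C1].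
  have NL x : `|x| <= L' -> - L' <= x by rewrite ler_norml => /andP[].
  split; [|apply: NL|apply: NL|apply: NL]; rewrite ?le_max ?lexx ?orbT//.
  by rewrite ler_norm.
pose M t := Y * t ^+ 2 + lambda * L' * t `^ p + lambda * L' * t `^ q + theta * L' * t `^ g.
have kM e t : 0 < e <= 1 -> 0 < t ->
    `|fibX lambda (W e) t - fibX lambda z t| <= e * M t.
  move=> e01; have [_ AW /andP[hP1 hP2] /andP[hQ1 hQ2] /andP[hC1 hC2]] := HW _ e01.
  case/andP: e01 => e0 e1 t0.
  have dev (x y u v : R) : u + e * x <= v <= u + e * L -> - L' <= x -> 0 <= y -> - (e * (L' * y)) <= (v - u) * y <= e * (L' * y).
    move=> /andP[h1 h2] h3 y0; rewrite !mulrA -mulNr; apply/andP; split.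
      by rewrite ler_wpM2r//; move: (ler_wpM2l (ltW e0) h3) h1; lra_goal_only.
    by rewrite ler_wpM2r//; move: (ler_wpM2l (ltW e0) L0) h2; lra_goal_only.
  have lp y : 0 <= lambda * t `^ y by rewrite mulr_ge0 ?powR_ge0// ltW.
  have tp y : 0 <= theta * t `^ y by rewrite mulr_ge0 ?powR_ge0// ltW.
  have /andP[p1 p2] := @dev P1 _ (P z) (P (W e)) ltac:(by rewrite hP1 hP2) PL (lp p).
  have /andP[q1 q2] := @dev Q1 _ (Q z) (Q (W e)) ltac:(by rewrite hQ1 hQ2) QL (lp q).
  have /andP[c1 c2] := @dev C1 _ (C z) (C (W e)) ltac:(by rewrite hC1 hC2) CL (tp g).
  have a1 : `|2 * e * I + e ^+ 2 * D| <= e * Y.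
    rewrite (_ : _ + _ = e * (2 * I + e * D)); last by ring.
    rewrite normrM gtr0_norm// ler_wpM2l ?(ltW e0)//.
    apply: (le_trans (ler_normD _ _)); rewrite !normrM (gtr0_norm e0) ger0_norm//.
    by rewrite lerD2l ler_piMl.
  have t2 : 0 <= t ^+ 2 by exact: sqr_ge0.
  move: a1; rewrite ler_norml => /andP[a1 a2].
  have {}a1 := ler_wpM2r t2 a1; have {}a2 := ler_wpM2r t2 a2.
  move: a1 a2 p1 p2 q1 q2 c1 c2; rewrite ler_norml /fibX /fibk /M AW; lra_goal_only.
have small (a b : R) : 0 < b -> \forall e \near 0^'+, e * a < b.
  move=> b0; have ab : 0 < b / (`|a| + 1) by rewrite divr_gt0// ltr_wpDl.
  near=> e; have e0 : 0 < e by near: e; exact: nbhs_right_gt.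
  apply: (@le_lt_trans _ _ (e * `|a|)); first by rewrite ler_wpM2l ?ler_norm// ltW.
  apply: (@le_lt_trans _ _ (e * (`|a| + 1))); first by rewrite ler_wpM2l ?(ltW e0)// lerDl.
  rewrite -ltr_pdivlMr; last by rewrite ltr_wpDl.
  by near: e; exact: nbhs_right_lt.
(* The perturbation must keep the signs of [fibX] at 1 - r and 1 + r, keep the coupling positive,
   and leave the quadratic remainder dominated by the slope [S]. *)
have [e [e0 e1 [eM1 eM2 eC eD]]] : exists e : R, [/\ 0 < e, e <= 1 &
    [/\ e * M (1 - r) < fibX lambda z (1 - r), e * M (1 + r) < - fibX lambda z (1 + r),
     e * `|C1| < C z & e * (4 * `|D|) < - S]].
  near (0 : R)^'+ => e; exists e; split.
  - by near: e; exact: nbhs_right_gt.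
  - by near: e; apply: nbhs_right_le.
  - split; near: e; apply: small => //; by rewrite oppr_gt0.
have e01 : 0 < e <= 1 by rewrite e0.
have rp : 0 < 1 - r by rewrite subr_gt0 (le_lt_trans rr1).
have rq : 0 < 1 + r by rewrite addr_gt0.
have [XW AW /andP[PW _] /andP[QW _] /andP[CW _]] := HW _ e01.
have CW0 : 0 < C (W e).
  apply: lt_le_trans CW; have : e * - C1 <= e * `|C1|.
    by rewrite ler_wpM2l ?(ltW e0)// -normrN ler_norm.
  by move: eC; lra_goal_only.
have kWm : 0 < fibX lambda (W e) (1 - r).
  by have := kM _ _ e01 rp; rewrite ler_norml; move: eM1; lra_goal_only.
have kWp : fibX lambda (W e) (1 + r) < 0.
  by have := kM _ _ e01 rq; rewrite ler_norml; move: eM2; lra_goal_only.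
have [x rx NW] := nehariX_proj (ltW l0) XW CW0 rp kWm.
have x0 : 0 < x := lt_trans rp rx.
(* Otherwise 1 + r would lie between 1 - r, where [fibX] is positive, and the Nehari point [x], and
   [fibk_ge0] would contradict the negative sign at 1 + r. *)
have xr : x < 1 + r.
  rewrite ltNge; apply/negP => xr; case: NW => _ _ kx sx.
  have lPx := mulr_ge0 (ltW l0) (P_ge0 (scX x0 XW)).
  have lQx := mulr_ge0 (ltW l0) (Q_ge0 (scX x0 XW)).
  have tCx : 0 <= theta * C (sc x (W e)).
    by rewrite scC// mulrA mulr_ge0 ?powR_ge0// ltW// mulr_gt0.
  have kxE y : 0 < y -> fibX lambda (sc x (W e)) (y / x) = fibX lambda (W e) y.
    move=> y0; have yx : 0 < y / x by rewrite divr_gt0.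
    rewrite -[y in RHS](divfK (lt0r_neq0 x0)) (mulrC _ x) [RHS]/fibX fibkM ?ltW//.
    by rewrite /fibX scA// scP// scQ// scC// !(mulrA _ _ (x `^ _)).
  have : 0 <= fibX lambda (sc x (W e)) ((1 + r) / x).
    apply: (@fibk_ge0 _ p q g hp hpq hq hg _ _ _ _ lPx lQx tCx ((1 - r) / x)) => //.
    - by rewrite divr_gt0.
    - by rewrite -/(fibX _ _ _) kxE// ltW.
    - by rewrite ler_pM2r ?invr_gt0// ler_pdivrMr// mul1r xr andbT; move: r0; lra_goal_only.
  by rewrite kxE// leNgt kWp.
have xr1 : `|x - 1| <= r by rewrite ler_norml; move: rx xr; lra_goal_only.
have := ground_level_le NW; rewrite fibEX_sc//.
(* The terms bounded below through [P1], [Q1], [C1] enter the energy with a minus sign, so the lower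
   bounds suffice; [m x] collects the slopes in [e]. *)
have : fibEX lambda (W e) x <= fibEX lambda z x + e * m x + e ^+ 2 * D / 2 * x ^+ 2.
  rewrite /fibEX /fibE AW /m /fibk.
  have lp y a : 0 < a -> 0 <= lambda / a * x `^ y.
    by move=> a0; rewrite mulr_ge0 ?powR_ge0// divr_ge0// ltW.
  have tp : 0 <= theta / g * x `^ g.
    by rewrite mulr_ge0 ?powR_ge0// divr_ge0// ltW.
  have := ler_wpM2r (lp p _ p0) PW; have := ler_wpM2r (lp q _ q0) QW.
  by have := ler_wpM2r tp CW; lra_goal_only.
have : fibEX lambda z x <= ground_level.
  rewrite -Ez; have [x1|x1] := leP 1 x; first exact: fibE_le1_of_ge1.
  apply: fibE_le1_of_ge0 => //.
  apply: (@fibk_ge0 _ p q g hp hpq hq hg _ _ _ _ lP lQ tC (1 - r)) => //; first exact: ltW.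
  by rewrite (ltW rx) ltW.
have mS : m x <= S / 2 * x ^+ 2.
  by have := Hr1 _ (le_trans xr1 rr1); rewrite /m /fibk; lra_goal_only.
have De : e ^+ 2 * D / 2 * x ^+ 2 <= e * (e * `|D| / 2) * x ^+ 2.
  rewrite ler_wpM2r ?sqr_ge0// expr2.
  have : e * e * D <= e * e * `|D| by rewrite ler_wpM2l ?ler_norm// mulr_ge0 ?ltW.
  by lra_goal_only.
have := ler_wpM2l (ltW e0) mS.
have x2 : 0 < e * x ^+ 2 by rewrite mulr_gt0// exprn_gt0.
have : e * `|D| / 2 + S / 2 < 0.
  by have := mulr_ge0 (ltW e0) (normr_ge0 D); move: eD S0; lra_goal_only.
by rewrite -(pmulr_rlt0 _ x2); move: De; lra_goal_only.
Unshelve. all: by end_near.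
Qed.

End minimizer.

Lemma nehariX_energy_gt0 z t : nehariX lambda z -> 0 < t ->
  0 < fibEX lambda z t -> 0 < fibEX lambda z 1.
Proof.
move=> [Xz Cz kz sz] t0 Et.
have lP := mulr_ge0 (ltW l0) (P_ge0 Xz); have lQ := mulr_ge0 (ltW l0) (Q_ge0 Xz).
have tC := ltW (mulr_gt0 htheta Cz).
have := lt_le_trans Et (fibE_le_max hp hpq hq hg lP lQ tC kz sz t0).
by rewrite lt_max ltxx.
Qed.

(** The second hypothesis describes rays with [Lambda_e] at most [lambda + eta]. Their points on N^-
    have energy at most [eta] times P + Q, and coercivity bounds P + Q there independently of
    [eta]. *)
Lemma ground_level_le0 :
  (forall w, X w -> 0 < C w -> exists2 t, 0 < t & 0 < fibX lambda w t) ->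
  (forall eta : R, 0 < eta -> exists w, [/\ X w, 0 < C w &
    forall t, 0 < t -> fibEX lambda w t <= eta * (P w * t `^ p / p + Q w * t `^ q / q)]) ->
  ground_level <= 0.
Proof.
move=> proj H.
have [c c0 [K K0 cK]] := nehariX_coercive.
have p2 : 0 < p < 2 by rewrite p0/=; exact: le_lt_trans hq.
have q2 : 0 < q < 2 by rewrite q0.
have h2 : (0 : R) < 2^-1 by [].
have [K1 K10 HP] := subquadratic p2 scP (fun w Xw Aw => let: And3 h _ _ := ball_bound Xw Aw in h) h2.
have [K2 K20 HQ] := subquadratic q2 scQ (fun w Xw Aw => let: And3 _ h _ := ball_bound Xw Aw in h) h2.
pose K3 := K1 + K2.
(* From c A <= E + K and E <= eta (A + K3) with [eta <= c / 2], the squared norm at the projected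
   point is at most [M]. *)
pose M := (K + c / 2 * K3) / (c / 2).
have M0 : 0 <= M.
  by rewrite /M divr_ge0 ?addr_ge0 ?mulr_ge0 ?(ltW c0) ?addr_ge0// ?divr_ge0// ltW.
apply/ler_addgt0Pl => /= eps eps0; rewrite addr0.
have N0 : 0 < M + K3 + 1 by rewrite ltr_wpDl// !addr_ge0.
have [eta [eta0 etac etaN]] : exists eta, [/\ 0 < eta, eta <= c / 2 & eta * (M + K3 + 1) <= eps].
  exists (Num.min (c / 2) (eps / (M + K3 + 1))); split.
  - by rewrite lt_min !divr_gt0.
  - by rewrite ge_min lexx.
  - by rewrite -ler_pdivlMr// ge_min lexx orbT.
have [w [Xw Cw Ew]] := H _ eta0.
have [t0 t00 kt0] := proj _ Xw Cw.
have [x /(lt_trans t00) x0 NW] := nehariX_proj (ltW l0) Xw Cw t00 kt0.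
have Xx := scX x0 Xw.
apply: (le_trans (ground_level_le NW)).
have EPQ : fibEX lambda (sc x w) 1 <= eta * (P (sc x w) + Q (sc x w)).
  rewrite fibEX_sc//; apply: (le_trans (Ew _ x0)); rewrite ler_wpM2l ?(ltW eta0)//.
  have ip : p^-1 <= 1 by rewrite invf_le1.
  have iq : q^-1 <= 1 by rewrite invf_le1//; exact: le_trans hpq.
  by rewrite -scP// -scQ//; apply: lerD; rewrite ler_piMr ?P_ge0 ?Q_ge0.
have PQA : P (sc x w) + Q (sc x w) <= A (sc x w) + K3.
  by have := HP _ Xx; have := HQ _ Xx; rewrite /K3; lra.
have A0 := A_ge0 Xx.
have K30 : 0 <= K3 by rewrite addr_ge0.
have EA := le_trans EPQ (ler_wpM2l (ltW eta0) PQA).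
have cA := cK _ Xx (let: And4 _ _ h _ := NW in h).
have AM : A (sc x w) <= M.
  rewrite ler_pdivlMr ?divr_gt0//.
  have : eta * (A (sc x w) + K3) <= c / 2 * (A (sc x w) + K3).
    by rewrite ler_wpM2r// addr_ge0.
  lra.
apply: (le_trans EA); apply: le_trans etaN.
by rewrite ler_wpM2l ?(ltW eta0)//; lra.
Qed.

(** For [l] slightly below [lambda] the ray meets N^- at some x > 1. There the energy at level
    [lambda] is at most its negative value at 1, and passing to [l] adds at most (lambda - l) M. By
    [fibE_le_max] the whole ray is then nonpositive at level [l], that is, the supremum of R_e along
    it is below [lambda]. *)
Lemma nehariX_energy_lt0 z : nehariX lambda z -> fibEX lambda z 1 < 0 ->
  exists l : R, [/\ 0 < l, l < lambda & forall t, 0 < t -> fibEX l z t <= 0].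
Proof.
move=> [Xz Cz kz sz] Ez.
have tC := mulr_gt0 htheta Cz.
have g2 : 0 < g - 2 by move: hg; lra.
(* A Nehari point x of this ray satisfies theta C x^(g-2) <= A at level [l], so [Y] bounds it
   whatever [l] is. *)
pose Y := (A z / (theta * C z)) `^ (g - 2)^-1.
pose M := P z * Y `^ p + Q z * Y `^ q.
have M0 : 0 <= M by rewrite addr_ge0// mulr_ge0 ?powR_ge0 ?P_ge0 ?Q_ge0.
have [del [del0 dl dM]] : exists del, [/\ 0 < del, del < lambda & del * (M + 1) <= - fibEX lambda z 1].
  exists (Num.min (lambda / 2) (- fibEX lambda z 1 / (M + 1))); split.
  - by rewrite lt_min !divr_gt0 ?oppr_gt0// ltr_wpDl.
  - by rewrite gt_min ltr_pdivrMr// ltr_pMr// (_ : 1 < 2)// ltr1n.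
  - by rewrite -ler_pdivlMr ?ltr_wpDl// ge_min lexx orbT.
exists (lambda - del); split; [lra|lra|].
set l := lambda - del; have l0' : 0 < l by rewrite /l; lra.
(* If [P] and [Q] both vanished, the Nehari identity would give A = theta C and a positive energy
   (1/2 - 1/g) A. *)
have PQ0 : 0 < P z + Q z.
  have lP := mulr_ge0 (ltW l0) (P_ge0 Xz); have lQ := mulr_ge0 (ltW l0) (Q_ge0 Xz).
  rewrite lt_neqAle addr_ge0 ?P_ge0 ?Q_ge0// andbT; apply/eqP => PQ.
  have := Ez; have := kz; rewrite /fibX /fibEX fibk1 /fibE expr1n !powR1.
  have [-> ->] : P z = 0 /\ Q z = 0 by have := P_ge0 Xz; have := Q_ge0 Xz; lra.
  have : theta * C z / g <= theta * C z / 2.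
    by rewrite ler_pM2l// lef_pV2 ?posrE// ltW.
  lra.
have kl : 0 < fibX l z 1.
  move: kz; rewrite /fibX !fibk1 /l; have := mulr_gt0 del0 PQ0; lra.
have [x x1 [Xx Cx kx sx]] := nehariX_proj (ltW l0') Xz Cz ltr01 kl.
have x0 : 0 < x by lra.
have xY : x <= Y.
  have : x `^ (g - 2) <= A z / (theta * C z).
    rewrite ler_pdivlMr// mulrC.
    have x2 : 0 < x ^+ 2 by rewrite exprn_gt0.
    rewrite -(ler_pM2r x2).
    have -> : theta * C z * x `^ (g - 2) * x ^+ 2 = theta * C z * x `^ g.
      rewrite -mulrA -powR_mulrn ?(ltW x0)// -powRD ?(gt_eqF x0) ?implybT//.
      by rewrite subrK.
    move: kx; rewrite fibX_sc// /fibX /fibk.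
    have := mulr_ge0 (mulr_ge0 (ltW l0') (P_ge0 Xz)) (powR_ge0 x p).
    have := mulr_ge0 (mulr_ge0 (ltW l0') (Q_ge0 Xz)) (powR_ge0 x q).
    lra.
  move=> h; rewrite -(powRr1 (ltW x0)) -(divff (lt0r_neq0 g2)) powRrM.
  apply: ge0_ler_powR; rewrite ?nnegrE ?powR_ge0 ?invr_ge0 ?(ltW g2)//.
  by rewrite divr_ge0 ?A_ge0// ltW.
have lP := mulr_ge0 (ltW l0) (P_ge0 Xz); have lQ := mulr_ge0 (ltW l0) (Q_ge0 Xz).
have Exl : fibEX l z x <= 0.
  have : fibEX lambda z x <= fibEX lambda z 1.
    by apply: fibE_le1_of_ge1; rewrite ?(ltW tC)// ltW.
  have : fibEX l z x = fibEX lambda z x + del * (P z * x `^ p / p + Q z * x `^ q / q).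
    by rewrite /fibEX /fibE /l; field; rewrite !gt_eqF.
  have : P z * x `^ p / p + Q z * x `^ q / q <= M.
    have ip : p^-1 <= 1 by rewrite invf_le1.
    have iq : q^-1 <= 1 by rewrite invf_le1//; exact: le_trans hpq.
    have xYe e : 0 < e -> x `^ e <= Y `^ e.
      by move=> e0; apply: ge0_ler_powR; rewrite ?nnegrE ?(ltW e0) ?(ltW x0) ?powR_ge0.
    apply: lerD.
      apply: (@le_trans _ _ (P z * x `^ p)); first by rewrite ler_piMr// mulr_ge0 ?powR_ge0 ?P_ge0.
      by rewrite ler_wpM2l ?P_ge0// xYe.
    apply: (@le_trans _ _ (Q z * x `^ q)); first by rewrite ler_piMr// mulr_ge0 ?powR_ge0 ?Q_ge0.
    by rewrite ler_wpM2l ?Q_ge0// xYe.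
  move/(ler_wpM2l (ltW del0)); lra.
move=> t t0.
have tx : 0 < t / x by rewrite divr_gt0.
have lPx := mulr_ge0 (ltW l0') (P_ge0 Xx); have lQx := mulr_ge0 (ltW l0') (Q_ge0 Xx).
have := fibE_le_max hp hpq hq hg lPx lQx (ltW (mulr_gt0 htheta Cx)) kx sx tx.
rewrite -!/(fibEX _ _ _) fibEX_sc// max_l//.
suff -> : fibEX l (sc x z) (t / x) = fibEX l z t by [].
rewrite -[t in RHS](divfK (lt0r_neq0 x0)) (mulrC _ x) [RHS]/fibEX fibEM ?(ltW tx) ?(ltW x0)//.
by rewrite /fibEX scA// scP// scQ// scC// !(mulrA _ _ (x `^ _)).
Qed.

End positive_lambda.
End nehari_minimization.

(** * Averages over the cells of a grid *)

Section real_integrals.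
Context d (T : measurableType d) (R : realType) (mu : {measure set T -> \bar R}).
Implicit Types f g k u : T -> R.

Lemma ge0_integrable_lty f : measurable_fun setT f -> (forall x, 0 <= f x) ->
  (\int[mu]_x (f x)%:E < +oo)%E -> mu.-integrable setT (EFin \o f).
Proof.
move=> mf f0 fy; apply/integrableP; split; first exact/measurable_EFinP.
by under eq_integral do rewrite /= ger0_norm//.
Qed.

Lemma integrable_lty_ge0 f : (forall x, 0 <= f x) ->
  mu.-integrable setT (EFin \o f) -> (\int[mu]_x (f x)%:E < +oo)%E.
Proof.
move=> f0 /integrableP[_]; apply: le_lt_trans.
by under [leRHS]eq_integral do rewrite /= ger0_norm//.
Qed.

Lemma integrable_le f g : measurable_fun setT f -> (forall x, `|f x| <= g x) ->
  mu.-integrable setT (EFin \o g) -> mu.-integrable setT (EFin \o f).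
Proof.
move=> mf fg; apply: le_integrable => //; first exact/measurable_EFinP.
by move=> x _ /=; rewrite lee_fin (le_trans (fg x))// ler_norm.
Qed.

Lemma EFin_Rintegral f : mu.-integrable setT (EFin \o f) ->
  (\int[mu]_x f x)%:E = (\int[mu]_x (f x)%:E)%E.
Proof. by move=> fi; rewrite fineK//; exact: integrable_fin_num. Qed.

Lemma ge0_le_integralE f g : measurable_fun setT f -> measurable_fun setT g ->
  (forall x, 0 <= f x <= g x) -> (\int[mu]_x (f x)%:E <= \int[mu]_x (g x)%:E)%E.
Proof.
move=> mf mg fg; apply: ge0_le_integral => //.
- by move=> x _; rewrite lee_fin; case/andP: (fg x).
- exact/measurable_EFinP.
- exact/measurable_EFinP.
- by move=> x _; rewrite lee_fin; case/andP: (fg x).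
Qed.

(** Jensen's inequality for the probability density [k]: integrate 0 <= k (c - u - dd)^2, where [dd]
    is the mean of c - u, after splitting it between two integrable sides. *)
Lemma sqr_mean_le k u (c : R) : measurable_fun setT k -> measurable_fun setT u ->
  (forall x, 0 <= k x) -> (\int[mu]_x (k x)%:E = 1)%E ->
  mu.-integrable setT (EFin \o (fun x => k x * u x)) ->
  (((c - \int[mu]_x (k x * u x)) ^+ 2)%:E <=
    \int[mu]_x (k x * (c - u x) ^+ 2)%:E)%E.
Proof.
move=> mk mU k0 k1 iku; have [->|] := eqVneq (\int[mu]_x (k x * (c - u x) ^+ 2)%:E)%E +oo%E.
  by rewrite leey.
rewrite -ltey => fy; set m := \int[mu]_x (k x * u x); set dd := c - m.
have mcu : measurable_fun setT (fun x => c - u x) by apply: measurable_funB.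
have ik : mu.-integrable setT (EFin \o k).
  by apply: ge0_integrable_lty => //; rewrite k1 ltry.
have isq : mu.-integrable setT (EFin \o (fun x => k x * (c - u x) ^+ 2)).
  apply: ge0_integrable_lty => //; last by move=> x; rewrite mulr_ge0 ?sqr_ge0.
  by apply: measurable_funM => //; apply: measurable_funX.
have ikc : mu.-integrable setT (EFin \o (fun x => (2 * dd * c) * k x)).
  exact: (integrableZl measurableT (2 * dd * c) ik).
have ikd : mu.-integrable setT (EFin \o (fun x => dd ^+ 2 * k x)).
  exact: (integrableZl measurableT (dd ^+ 2) ik).
have iku' : mu.-integrable setT (EFin \o (fun x => (2 * dd) * (k x * u x))).
  exact: (integrableZl measurableT (2 * dd) iku).
have Rk : \int[mu]_x k x = 1 by rewrite /Rintegral k1.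
have : \int[mu]_x ((2 * dd * c) * k x - (2 * dd) * (k x * u x)) <=
    \int[mu]_x (k x * (c - u x) ^+ 2 + dd ^+ 2 * k x).
  apply: le_Rintegral => //.
  - exact: (integrableB measurableT ikc iku').
  - exact: (integrableD measurableT isq ikd).
  - move=> x _; rewrite -subr_ge0.
    rewrite (_ : _ - _ = k x * (c - u x - dd) ^+ 2); last by ring.
    by rewrite mulr_ge0// sqr_ge0.
rewrite RintegralB// RintegralD// !RintegralZl// Rk -/m => H.
rewrite -EFin_Rintegral// lee_fin.
have e1 : 2 * dd * c * 1 - 2 * dd * m = 2 * dd ^+ 2 by rewrite /dd; ring.
by move: H; rewrite e1; set X := \int[mu]_x _; lra.
Qed.

End real_integrals.

(** * The cells of a cubic grid *)

Section cells.
Context {R : realType} {N : nat}.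
Local Notation T := 'rV[R]_N.
Implicit Types (x y : T) (h : R).

(** Half-open counterpart of [leb_box]: the cells of the grid are half-open so that they partition
    the space. *)
Lemma leb_box_co n (a b : 'rV[R]_n) : (forall i, a ord0 i <= b ord0 i) ->
  leb n [set x | forall i, a ord0 i <= x ord0 i < b ord0 i] =
  (\prod_(i < n) (b ord0 i - a ord0 i))%:E.
Proof.
elim: n a b => [|n IH] a b ab.
  rewrite big_ord0 /= /lebesgue_rV0 diracE mem_set//.
  by case.
rewrite /= /lebesgue_cons /pushforward big_ord_recl EFinM.
pose a' : 'rV[R]_n := \row_j a ord0 (lift ord0 j).
pose b' : 'rV[R]_n := \row_j b ord0 (lift ord0 j).
have -> : \prod_(i < n) (b ord0 (lift ord0 i) - a ord0 (lift ord0 i)) =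
    \prod_(i < n) (b' ord0 i - a' ord0 i).
  by apply: eq_bigr => i _; rewrite !mxE.
rewrite -IH; last by move=> i; rewrite !mxE.
transitivity ((@lebesgue_measure R \x leb n)%E
   ((`[a ord0 ord0, b ord0 ord0[ : set (measurableTypeR R)) `*`
    [set x : 'rV[R]_n | forall i, a' ord0 i <= x ord0 i < b' ord0 i])).
  congr (product_measure1 _ _ _).
  apply/seteqP; split => [[c y]/= H|[c y] /= [+ H]].
    split; first by have := H ord0; rewrite mxE unlift_none in_itv/=.
    by move=> i; have := H (lift ord0 i); rewrite /a' /b' !mxE liftK.
  rewrite in_itv/= => H0 i; rewrite mxE; case: unliftP => [j|] -> //=.
  by have := H j; rewrite !mxE.
rewrite product_measure1E//.
  congr (_ * _)%E.
  rewrite [LHS](lebesgue_measure_itv `[a ord0 ord0, b ord0 ord0[)/= lte_fin.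
  by case: ltgtP (ab ord0) => // ->; rewrite subrr.
rewrite (_ : [set x | _] = \bigcap_(i in [set: 'I_n])
    ((fun x : 'rV[R]_n => x ord0 i) @^-1` `[a' ord0 i, b' ord0 i[)).
  apply: fin_bigcap_measurable => // i _.
  by rewrite -[X in measurable X]setTI; exact: measurable_coord.
apply/seteqP; split => x /= H i; first by move=> _ /=; rewrite in_itv/=.
by have := H i I; rewrite /= in_itv.
Qed.

(* [x] and [y] lie in the same cube of the grid of mesh [h]. Averaging over these
   cubes replaces mollification, so that no translation of the Lebesgue measure
   is needed. *)
Definition cell h x y : bool :=
  [forall i, Num.floor (x ord0 i / h) == Num.floor (y ord0 i / h)].

Lemma cellxx h x : cell h x x.
Proof. by apply/forallP. Qed.

Lemma cellP h x y : reflect (forall i, Num.floor (x ord0 i / h) = Num.floor (y ord0 i / h))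
  (cell h x y).
Proof. by apply: (iffP forallP) => H i; apply/eqP. Qed.

Lemma cell_sym h x y : cell h x y = cell h y x.
Proof. by apply/cellP/cellP => H i. Qed.

Lemma cell_trans h x y z : cell h x y -> cell h y z -> cell h x z.
Proof. by move=> /cellP H1 /cellP H2; apply/cellP => i; rewrite H1. Qed.

Lemma measurable_floor : measurable_fun [set: R] (fun t : R => (Num.floor t)%:~R : R).
Proof.
by apply: nondecreasing_measurable => // x y xy; rewrite ler_int; exact: le_floor.
Qed.

Lemma measurable_cell h : measurable [set z : T * T | cell h z.1 z.2].
Proof.
rewrite (_ : mkset _ = \bigcap_(i in [set: 'I_N])
  [set z : T * T | (Num.floor (z.1 ord0 i / h))%:~R == (Num.floor (z.2 ord0 i / h))%:~R :> R]).
  apply: fin_bigcap_measurable => // i _.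
  have m (f : T * T -> T) : measurable_fun setT f ->
      measurable_fun setT (fun z => (Num.floor (f z ord0 i / h))%:~R : R).
    move=> mf; apply: (measurableT_comp measurable_floor).
    apply: measurable_funM => //.
    exact: (measurableT_comp (measurable_coord i) mf).
  have := measurable_fun_eqr (m _ measurable_fst) (m _ measurable_snd).
  by move=> /(_ measurableT [set true] I); rewrite setTI.
apply/seteqP; split => z /=.
  by move=> /cellP H i _ /=; rewrite H.
by move=> H; apply/cellP => i; have /eqP := H i I => /intr_inj.
Qed.

Lemma cellE h x : 0 < h -> [set y | cell h x y] =
  [set y | forall i, (\row_i ((Num.floor (x ord0 i / h))%:~R * h)) ord0 i <= y ord0 i
   < (\row_i ((Num.floor (x ord0 i / h))%:~R * h + h)) ord0 i].
Proof.
move=> h0; apply/seteqP; split => y /=.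
  move=> /cellP H i; rewrite !mxE H.
  rewrite -ler_pdivlMr// floor_le/=.
  have -> : (Num.floor (y ord0 i / h))%:~R * h + h = (Num.floor (y ord0 i / h) + 1)%:~R * h.
    by rewrite intrD mulrDl mul1r.
  by rewrite -ltr_pdivrMr// floorD1_gt.
move=> H; apply/cellP => i; have := H i; rewrite !mxE => /andP[h1 h2].
apply/esym/floor_def.
rewrite ler_pdivlMr// h1/= ltr_pdivrMr// intrD mulrDl mul1r//.
Qed.

Lemma leb_cell h x : 0 < h -> leb N [set y | cell h x y] = (h ^+ N)%:E.
Proof.
move=> h0; rewrite cellE// leb_box_co; last by move=> i; rewrite !mxE lerDl ltW.
congr EFin; under eq_bigr do rewrite !mxE addrAC subrr add0r.
by rewrite prodr_const card_ord.
Qed.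

Lemma cell_dist h x y i : 0 < h -> cell h x y -> `|x ord0 i - y ord0 i| <= h.
Proof.
move=> h0; have := cellE x h0; rewrite predeqE => cE cxy.
have := (cE x).1 (cellxx h x) i; have := (cE y).1 cxy i; rewrite !mxE.
by move=> /andP[h1 h2] /andP[h3 h4]; rewrite ler_norml; apply/andP; split; lra.
Qed.

End cells.

(** * Cell averages and fractional Poincare inequalities *)

Section averages.
Context {R : realType} {N : nat}.
Local Notation T := 'rV[R]_N.
Local Notation mu := (leb N : {measure set 'rV[R]_N -> \bar R}).
Implicit Types (x y : T) (h : R) (u : T -> R).

Lemma measurable_enorm_sub :
  measurable_fun [set: T * T] (fun z => enorm (z.1 - z.2)).
Proof.
have E (z : T * T) : enorm (z.1 - z.2) =
    (\sum_(i < N) (z.1 ord0 i - z.2 ord0 i) ^+ 2) `^ 2^-1.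
  rewrite /enorm powR12_sqrt; last by apply: sumr_ge0 => i _; exact: sqr_ge0.
  by congr Num.sqrt; apply: eq_bigr => i _; rewrite !mxE.
under eq_fun do rewrite E.
apply: (measurableT_comp (measurable_powR _)).
apply: measurable_sum => i; apply: measurable_funX; apply: measurable_funB.
  exact: (measurableT_comp (measurable_coord i) measurable_fst).
exact: (measurableT_comp (measurable_coord i) measurable_snd).
Qed.

Lemma enorm_ge0 x : 0 <= enorm x.
Proof. exact: sqrtr_ge0. Qed.

Lemma enorm_eq0 x : enorm x = 0 -> x = 0.
Proof.
move/eqP; rewrite sqrtr_eq0 => x0; apply/rowP => i; rewrite mxE.
have s0 : 0 <= \sum_(j < N) x ord0 j ^+ 2 by apply: sumr_ge0 => j _; exact: sqr_ge0.
have /eqP : \sum_(j < N) x ord0 j ^+ 2 == 0 by rewrite eq_le x0.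
move=> /psumr_eq0P H; have /eqP := H (fun j _ => sqr_ge0 (x ord0 j)) i isT.
by rewrite sqrf_eq0 => /eqP.
Qed.

Lemma enormC x y : enorm (x - y) = enorm (y - x).
Proof.
by rewrite /enorm; congr Num.sqrt; apply: eq_bigr => i _; rewrite !mxE -sqrrN opprB.
Qed.

Lemma coord_le_enorm x i : `|x ord0 i| <= enorm x.
Proof.
rewrite -sqrtr_sqr; apply: ler_wsqrtr; rewrite (bigD1 i)//= lerDl.
by apply: sumr_ge0 => j _; exact: sqr_ge0.
Qed.

Lemma enorm_le x (r : R) : 0 <= r -> (forall i, `|x ord0 i| <= r) ->
  enorm x <= N%:R * r.
Proof.
move=> r0 H; have Nr : 0 <= N%:R * r by rewrite mulr_ge0.
rewrite /enorm -(ger0_norm Nr) -sqrtr_sqr; apply: ler_wsqrtr.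
apply: (@le_trans _ _ (\sum_(i < N) r ^+ 2)).
  apply: ler_sum => i _; rewrite -(real_normK (num_real _)).
  by rewrite lerXn2r ?nnegrE.
rewrite sumr_const card_ord -[leLHS]mulr_natl [leRHS]exprMn ler_wpM2r ?sqr_ge0//.
by rewrite -natrX ler_nat; case: (N) => // n; rewrite expnS leq_pmulr.
Qed.

Variable s : R.
Hypothesis s0 : 0 < s.
Local Notation e := (N%:R + 2 * s).
Let e0 : 0 < e. Proof. by rewrite ltr_wpDl// mulr_gt0. Qed.

Definition gquot u (z : T * T) : R :=
  (u z.1 - u z.2) ^+ 2 / enorm (z.1 - z.2) `^ e.

Lemma gquot_ge0 u z : 0 <= gquot u z.
Proof. by rewrite /gquot mulr_ge0 ?sqr_ge0// invr_ge0 powR_ge0. Qed.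

Lemma measurable_sub2 u : measurable_fun setT u ->
  measurable_fun [set: T * T] (fun z => u z.1 - u z.2).
Proof.
move=> mU; apply: measurable_funB.
  exact: (measurableT_comp mU measurable_fst).
exact: (measurableT_comp mU measurable_snd).
Qed.

Lemma measurable_enorm_powN :
  measurable_fun [set: T * T] (fun z => (enorm (z.1 - z.2) `^ e)^-1).
Proof.
have E (z : T * T) : (enorm (z.1 - z.2) `^ e)^-1 = enorm (z.1 - z.2) `^ (- e).
  by rewrite powRN.
under eq_fun do rewrite E.
exact: (measurableT_comp (measurable_powR _) measurable_enorm_sub).
Qed.

Lemma measurable_gquot u : measurable_fun setT u ->
  measurable_fun [set: T * T] (gquot u).
Proof.
move=> mU; apply: measurable_funM; last exact: measurable_enorm_powN.
by apply: measurable_funX; exact: measurable_sub2.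
Qed.

(** Within distance [r] the singular weight is at least r^(-e); on the diagonal both sides
    vanish. *)
Lemma sqr_le_gquot u x y (r : R) : enorm (x - y) <= r ->
  (u x - u y) ^+ 2 <= r `^ e * gquot u (x, y).
Proof.
move=> xyr; have [->|nxy] := eqVneq x y.
  by rewrite subrr expr0n mulr_ge0 ?powR_ge0 ?gquot_ge0.
have n0 : 0 < enorm (x - y).
  rewrite lt_neqAle enorm_ge0 andbT eq_sym; apply: contra_neq nxy => /enorm_eq0 H.
  exact: subr0_eq.
rewrite /gquot/= mulrCA ler_peMr ?sqr_ge0// ler_pdivlMr ?powR_gt0// mul1r.
by apply: ge0_ler_powR; rewrite ?nnegrE ?(ltW e0) ?enorm_ge0// (le_trans _ xyr)// enorm_ge0.
Qed.

Definition kern h x y : R := h ^- N * (cell h x y)%:R.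

Lemma kern_ge0 h x y : 0 < h -> 0 <= kern h x y.
Proof. by move=> h0; rewrite mulr_ge0// invr_ge0 exprn_ge0// ltW. Qed.

Lemma kern_le h x y : 0 < h -> kern h x y <= h ^- N.
Proof.
by move=> h0; rewrite ler_piMr ?lern1 ?leq_b1// invr_ge0 exprn_ge0// ltW.
Qed.

Lemma measurable_kern2 h :
  measurable_fun [set: T * T] (fun z => kern h z.1 z.2).
Proof.
apply: measurable_funM => //.
have -> : (fun z : T * T => (cell h z.1 z.2)%:R) = \1_[set z | cell h z.1 z.2] :> (_ -> R).
  apply/funext => z; rewrite indicE; congr ((nat_of_bool _)%:R).
  by apply/idP/idP; rewrite inE.
apply: measurable_indic; exact: measurable_cell.
Qed.

Lemma measurable_kern h x : measurable_fun [set: T] (kern h x).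
Proof. exact: (measurableT_comp (measurable_kern2 h) (pair1_measurable x)). Qed.

Lemma integral_kern h x : 0 < h -> (\int[mu]_y (kern h x y)%:E = 1)%E.
Proof.
move=> h0; have mc : measurable [set y | cell h x y].
  have := measurable_xsection x (@measurable_cell R N h).
  congr measurable; apply/seteqP; split => y; rewrite /xsection/= inE//.
have -> : (fun y => (kern h x y)%:E) = (fun y => (h ^- N)%:E * (\1_[set y | cell h x y] y)%:E)%E.
  apply/funext => y; rewrite /kern EFinM indicE; congr (_ * (nat_of_bool _)%:R%:E)%E.
  by apply/idP/idP; rewrite inE.
have hN : 0 < h ^+ N by rewrite exprn_gt0.
rewrite ge0_integralZl_EFin//; last 2 first.
- by apply/measurable_EFinP; exact: measurable_indic.
- by rewrite invr_ge0 ltW.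
rewrite integral_indic// setIT [X in (_ * X)%E](leb_cell x h0) -EFinM mulVf//.
by rewrite gt_eqF.
Qed.

Definition avg h u x : R := \int[mu]_y (kern h x y * u y).

Definition osc h u x : \bar R := (\int[mu]_y (kern h x y * (u x - u y) ^+ 2)%:E)%E.

Lemma integrable_kernM h u x : 0 < h -> measurable_fun setT u ->
  (\int[mu]_x (u x ^+ 2)%:E < +oo)%E ->
  mu.-integrable setT (EFin \o (fun y => kern h x y * u y)).
Proof.
move=> h0 mU uy.
have iu2 : mu.-integrable setT (EFin \o (fun x => u x ^+ 2)).
  apply: ge0_integrable_lty => //; first exact: measurable_funX.
  by move=> ?; exact: sqr_ge0.
have ik : mu.-integrable setT (EFin \o kern h x).
  apply: ge0_integrable_lty => //; first exact: measurable_kern.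
    by move=> ?; exact: kern_ge0.
  by rewrite integral_kern// ltry.
apply: (@integrable_le _ _ _ _ _ (fun y => kern h x y + h ^- N * u y ^+ 2)).
- by apply: measurable_funM => //; exact: measurable_kern.
- move=> y; have k0 := kern_ge0 x y h0; have k1 := kern_le x y h0.
  rewrite normrM (ger0_norm k0).
  have : `|u y| <= 1 + u y ^+ 2.
    rewrite -(real_normK (num_real (u y))).
    by have := normr_ge0 (u y); have := sqr_ge0 (`|u y| - 1); set v := `|u y|; nra.
  move=> /(ler_wpM2l k0) /le_trans; apply.
  by rewrite mulrDr mulr1 lerD2l ler_wpM2r ?sqr_ge0.
- exact: (integrableD measurableT ik (integrableZl measurableT (h ^- N) iu2)).
Qed.

(** Jensen's inequality with density [kern h x]. The constant is left free: it is taken to be 0, a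
    value of [u], or the average at another mesh. *)
Lemma sqr_sub_avg_le h u x (c : R) : 0 < h -> measurable_fun setT u ->
  (\int[mu]_x (u x ^+ 2)%:E < +oo)%E ->
  (((c - avg h u x) ^+ 2)%:E <= \int[mu]_y (kern h x y * (c - u y) ^+ 2)%:E)%E.
Proof.
move=> h0 mU uy; apply: sqr_mean_le => //.
- exact: measurable_kern.
- by move=> y; exact: kern_ge0.
- exact: integral_kern.
- exact: integrable_kernM.
Qed.

Let osc2 h u (z : T * T) : \bar R := (kern h z.1 z.2 * (u z.1 - u z.2) ^+ 2)%:E.

Let osc2_ge0 h u z : 0 < h -> (0 <= osc2 h u z)%E.
Proof. by move=> h0; rewrite lee_fin mulr_ge0 ?kern_ge0 ?sqr_ge0. Qed.

Let measurable_osc2 h u : measurable_fun setT u -> measurable_fun setT (osc2 h u).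
Proof.
move=> mU; apply/measurable_EFinP; apply: measurable_funM; first exact: measurable_kern2.
by apply: measurable_funX; exact: measurable_sub2.
Qed.

Lemma measurable_osc h u : 0 < h -> measurable_fun setT u ->
  measurable_fun setT (osc h u).
Proof.
move=> h0 mU.
by apply: (@measurable_fun_fubini_tonelli_F _ _ _ _ _ (leb N) (osc2 h u)) => [|z];
  [exact: measurable_osc2|exact: osc2_ge0].
Qed.

Lemma osc_ge0 h u x : 0 < h -> (0 <= osc h u x)%E.
Proof. by move=> h0; apply: integral_ge0 => y _; exact: (osc2_ge0 u (x, y)). Qed.

(** A fractional Poincare inequality summed over the cells: two points of a cell are at distance at
    most N h, which yields a constant of order h^(2s). *)
Lemma integral_osc_le h u : 0 < h -> measurable_fun setT u ->
  (\int[mu]_x osc h u x <= (h ^- N * (N%:R * h) `^ e)%:E * gagliardo2 s u)%E.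
Proof.
move=> h0 mU.
have <- : (\int[leb N \x leb N]_z osc2 h u z = \int[mu]_x osc h u x)%E.
  by apply: fubini_tonelli1 => [|z]; [exact: measurable_osc2|exact: osc2_ge0].
have c0 : 0 <= h ^- N * (N%:R * h) `^ e.
  by rewrite mulr_ge0 ?powR_ge0// invr_ge0 exprn_ge0// ltW.
rewrite /gagliardo2 -ge0_integralZl_EFin//; last 2 first.
- by move=> z _; rewrite lee_fin; exact: gquot_ge0.
- by apply/measurable_EFinP; exact: measurable_gquot.
apply: ge0_le_integral => //.
- by move=> z _; exact: osc2_ge0.
- exact: measurable_osc2.
- by apply/measurable_EFinP; apply: measurable_funM => //; exact: measurable_gquot.
- move=> [x y] _; rewrite /osc2 -EFinM lee_fin/= -mulrA.
  rewrite /kern -mulrA ler_wpM2l ?invr_ge0 ?exprn_ge0 ?(ltW h0)//.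
  have [cxy|_] := boolP (cell h x y); last first.
    by rewrite mul0r mulr_ge0 ?powR_ge0//; exact: (gquot_ge0 u (x, y)).
  rewrite mul1r; apply: sqr_le_gquot; apply: enorm_le; first exact: ltW.
  by move=> i; rewrite !mxE; exact: cell_dist.
Qed.

(** Jensen's inequality, applied first over y in the h'-cell of [x] and then over z in the h-cell,
    reduces the difference of averages to (u y - u z)^2, and y and z are at distance at most N (h +
    h'). *)
Lemma sqr_avg_sub_le h h' u x : 0 < h -> 0 < h' -> measurable_fun setT u ->
  (\int[mu]_x (u x ^+ 2)%:E < +oo)%E ->
  (((avg h u x - avg h' u x) ^+ 2)%:E <=
   (h ^- N * h' ^- N * (N%:R * (h + h')) `^ e)%:E * gagliardo2 s u)%E.
Proof.
move=> h0 h'0 mU uy; set a := avg h u x; set c := h ^- N * _ * _.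
have c0 : 0 <= c.
  by rewrite !mulr_ge0 ?powR_ge0// invr_ge0 exprn_ge0// ltW.
apply: (le_trans (sqr_sub_avg_le x a h'0 mU uy)).
have mgE : measurable_fun setT (fun z => (gquot u z)%:E).
  by apply/measurable_EFinP; exact: measurable_gquot.
have g0 z : (0 <= (gquot u z)%:E)%E by rewrite lee_fin gquot_ge0.
rewrite /gagliardo2 [X in (_ * X)%E](fubini_tonelli1 _ mgE g0).
rewrite -ge0_integralZl_EFin//; last 2 first.
- by move=> y _; apply: integral_ge0 => z _.
- exact: (measurable_fun_fubini_tonelli_F _ mgE g0).
apply: ge0_le_integral => //.
- by move=> y _; rewrite lee_fin mulr_ge0 ?kern_ge0 ?sqr_ge0.
- apply/measurable_EFinP; apply: measurable_funM; first exact: measurable_kern.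
  by apply: measurable_funX; exact: measurable_funB.
- apply: measurable_funeM; exact: (measurable_fun_fubini_tonelli_F _ mgE g0).
move=> y _; rewrite /fubini_F /kern.
have [cxy|_] := boolP (cell h' x y); last first.
  by rewrite mulr0 mul0r mule_ge0//; apply: integral_ge0 => z _.
rewrite mulr1 EFinM.
have h'N : 0 <= h' ^- N by rewrite invr_ge0 exprn_ge0// ltW.
have := sqr_sub_avg_le x (u y) h0 mU uy; rewrite -/a -sqrrN opprB.
have h'NE : (0 <= (h' ^- N)%:E)%E by rewrite lee_fin.
move=> /(lee_wpmul2l h'NE)/le_trans; apply.
have mg1 : measurable_fun setT (fun z => gquot u (y, z)).
  exact: (measurableT_comp (measurable_gquot mU) (pair1_measurable y)).
rewrite -!ge0_integralZl_EFin//; last 3 first.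
- by move=> z _; rewrite lee_fin mulr_ge0 ?kern_ge0 ?sqr_ge0.
- apply/measurable_EFinP; apply: measurable_funM; first exact: measurable_kern.
  by apply: measurable_funX; exact: measurable_funB.
- exact/measurable_EFinP.
apply: ge0_le_integral => //.
- by move=> z _; rewrite -EFinM lee_fin mulr_ge0// mulr_ge0 ?kern_ge0 ?sqr_ge0.
- apply/measurable_EFinP; do 2 apply: measurable_funM => //; first exact: measurable_kern.
  by apply: measurable_funX; exact: measurable_funB.
- by apply/measurable_EFinP; apply: measurable_funM.
move=> z _; rewrite -!EFinM lee_fin /kern.
have [cxz|_] := boolP (cell h x z); last first.
  by rewrite mulr0 mul0r mulr0 mulr_ge0// gquot_ge0.
rewrite mulr1 mulrA (mulrC (h' ^- N)) /c -!mulrA.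
do 2 (rewrite ler_wpM2l ?invr_ge0 ?exprn_ge0 ?(ltW h0) ?(ltW h'0)//).
apply: sqr_le_gquot; apply: enorm_le => [|i]; first by rewrite addr_ge0// ltW.
rewrite !mxE; have := cell_dist i h0 cxz; have := cell_dist i h'0 cxy.
by rewrite !ler_norml => /andP[? ?] /andP[? ?]; apply/andP; split; lra.
Qed.

End averages.

(** * A subcritical fractional Sobolev inequality *)

Section sobolev.
Context {R : realType} {N : nat}.
Local Notation T := 'rV[R]_N.
Local Notation mu := (leb N : {measure set 'rV[R]_N -> \bar R}).

Lemma geometric_sum_le (c x : R) n : 0 <= c -> 0 <= x < 1 ->
  \sum_(0 <= j < n) c * x ^+ j <= c / (1 - x).
Proof.
move=> c0 /andP[x0 x1]; have x1' : 0 < 1 - x by lra.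
have -> : \sum_(0 <= j < n) c * x ^+ j = c * (1 - x ^+ n) / (1 - x).
  elim: n => [|n IH]; first by rewrite big_geq// expr0 subrr mulr0 mul0r.
  by rewrite big_nat_recr//= IH exprS; field; rewrite gt_eqF.
rewrite ler_pM2r ?invr_gt0// ler_piMr//.
by have := exprn_ge0 n x0; lra.
Qed.

Lemma nneseries_le_bound (f : nat -> \bar R) (B : \bar R) :
  (forall j, (0 <= f j)%E) -> (forall n, (\sum_(0 <= j < n) f j <= B)%E) ->
  (\sum_(0 <= j <oo) f j <= B)%E.
Proof.
move=> f0 fB; apply: lime_le; first exact: is_cvg_nneseries.
by apply: nearW => n; exact: fB.
Qed.

Lemma nneseries_ge_term (f : nat -> \bar R) j :
  (forall j, (0 <= f j)%E) -> (f j <= \sum_(0 <= j <oo) f j)%E.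
Proof.
move=> f0; apply: (@le_trans _ _ (\sum_(0 <= i < j.+1) f i)%E).
  by rewrite big_nat_recr//= leeDr// sume_ge0.
exact: nneseries_lim_ge.
Qed.

Variables (s t K : R).
Hypotheses (s0 : 0 < s) (hN : 2 * s < N%:R).
Hypotheses (t2 : 2 < t) (ht : t < sobolev_exponent N s) (K0 : 0 <= K).
Local Notation e := (N%:R + 2 * s).
Let e0 : 0 < e. Proof. by move: s0; have := ler0n R N; lra. Qed.
(** Averages at the consecutive meshes h = 2^-j and h/2 differ by at most a constant times h^(s -
    N/2) = r^j. This growth rate [r] fixes the levels at which a function is cut. *)
Let a := N%:R / 2 - s.
Let a0 : 0 < a. Proof. by rewrite /a; move: hN; lra. Qed.
Let r := 2 `^ a.
Let r1 : 1 < r. Proof. by rewrite /r powR_gt1// ltr1n. Qed.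
Let r0 : 0 < r. Proof. exact: lt_trans r1. Qed.
Let H (j : nat) : R := 2 ^- j.
Let H0 j : 0 < H j. Proof. by rewrite invr_gt0 exprn_gt0. Qed.
Let HS j : H j.+1 = H j / 2. Proof. by rewrite /H exprS invfM mulrC. Qed.

Let HE j : H j = 2 `^ (- j%:R).
Proof. by rewrite powRN powR_mulrn. Qed.

Let invX (h : R) : 0 < h -> h ^- N = h `^ (- N%:R).
Proof. by move=> h0; rewrite powRN powR_mulrn// ltW. Qed.

Let pD (h x y : R) : 0 < h -> h `^ (x + y) = h `^ x * h `^ y.
Proof. by move=> h0; rewrite powRD// (gt_eqF h0) implybT. Qed.

Let scale_avg j : H j.+1 ^- N * H j ^- N * (N%:R * (H j.+1 + H j)) `^ e <=
  (2 ^+ N * (N%:R * 2) `^ e) * (r ^+ j) ^+ 2.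
Proof.
have h0 := H0 j.
have -> : (r ^+ j) ^+ 2 = H j `^ (- N%:R) * H j `^ (- N%:R) * H j `^ e.
  rewrite -!pD// HE -!powRrM -exprM -powR_mulrn ?(ltW r0)// /r -powRrM.
  by congr (_ `^ _); rewrite natrM /a; field.
have E1 (x : R) : (x / 2) ^- N = x ^- N * 2 ^+ N by rewrite exprMn invfM exprVn invrK.
rewrite HS E1 !(invX (H0 j)).
rewrite (_ : _ * _ * (H j `^ (- N%:R)) * _ = 2 ^+ N * (H j `^ (- N%:R) * H j `^ (- N%:R)) * (N%:R * (H j / 2 + H j)) `^ e); last by ring.
rewrite [leRHS](_ : _ = 2 ^+ N * (H j `^ (- N%:R) * H j `^ (- N%:R)) * ((N%:R * 2) `^ e * H j `^ e)); last by ring.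
rewrite ler_wpM2l ?mulr_ge0 ?powR_ge0 ?exprn_ge0//.
rewrite -powRM ?mulr_ge0 ?(ltW h0)//; apply: ge0_ler_powR; rewrite ?nnegrE ?(ltW e0)//.
- by rewrite mulr_ge0// addr_ge0// ?divr_ge0// ltW.
- by rewrite !mulr_ge0// ltW.
- by rewrite -mulrA ler_wpM2l//; lra.
Qed.

Let rho := 2 `^ (- (2 * s)) : R.

Let scale_osc j : H j ^- N * (N%:R * H j) `^ e = N%:R `^ e * rho ^+ j.
Proof.
have h0 := H0 j.
rewrite invX// powRM ?(ltW h0)// mulrCA -pD//; congr (_ * _).
rewrite -powR_mulrn ?powR_ge0// /rho -powRrM HE -powRrM; congr (_ `^ _).
by ring.
Qed.

Let C1 := Num.sqrt (2 ^+ N * (N%:R * 2) `^ e * K) : R.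
(** [Num.sqrt K] bounds the averages at mesh 1, whose cells have measure 1; [C1 / (r - 1)] sums the
    increments [C1 * r ^+ j]; the last term makes [C0] positive. *)
Let C0 := Num.sqrt K + C1 / (r - 1) + 1 : R.
Let C00 : 0 < C0.
Proof.
rewrite /C0 ltr_wpDl// addr_ge0 ?sqrtr_ge0// divr_ge0 ?sqrtr_ge0//.
by rewrite subr_ge0 ltW.
Qed.

Section function.
Variable u : T -> R.
Hypotheses (mU : measurable_fun setT u) (u2 : (\int[mu]_x (u x ^+ 2)%:E <= K%:E)%E)
  (ug : (gagliardo2 s u <= K%:E)%E).
Let uy : (\int[mu]_x (u x ^+ 2)%:E < +oo)%E.
Proof. by rewrite (le_lt_trans u2)// ltry. Qed.

Let g0 : (0 <= gagliardo2 s u)%E.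
Proof. by apply: integral_ge0 => z _; rewrite lee_fin; exact: gquot_ge0. Qed.

Lemma avg_dyadic_le j x : `|avg (H j) u x| <= C0 * r ^+ j.
Proof.
elim: j => [|j IH].
  have := sqr_sub_avg_le x 0 (H0 0) mU uy.
  rewrite sub0r sqrrN => H1.
  have {}H1 : ((avg (H 0) u x ^+ 2)%:E <= K%:E)%E.
    apply: (le_trans H1); apply: le_trans u2; apply: ge0_le_integralE.
    - apply: measurable_funM; first exact: measurable_kern.
      by apply: measurable_funX; exact: measurable_funB.
    - exact: measurable_funX.
    - move=> y; rewrite mulr_ge0 ?kern_ge0 ?sqr_ge0//= sub0r sqrrN.
      by rewrite ler_piMl ?sqr_ge0// (le_trans (kern_le _ _ (H0 0)))// /H expr0 invr1 expr1n invr1.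
  rewrite expr0 mulr1 -sqrtr_sqr.
  apply: (@le_trans _ _ (Num.sqrt K)); first exact: ler_wsqrtr.
  rewrite /C0 -addrA lerDl addr_ge0// divr_ge0 ?sqrtr_ge0// subr_ge0 ltW//.
have d1 : `|avg (H j.+1) u x - avg (H j) u x| <= C1 * r ^+ j.
  have := sqr_avg_sub_le s0 x (H0 j.+1) (H0 j) mU uy => H1.
  have {}H1 : (avg (H j.+1) u x - avg (H j) u x) ^+ 2 <= C1 ^+ 2 * (r ^+ j) ^+ 2.
    rewrite -lee_fin; apply: (le_trans H1).
    have c0 : 0 <= 2 ^+ N * (N%:R * 2) `^ e * (r ^+ j) ^+ 2 :> R.
      by rewrite !mulr_ge0 ?powR_ge0 ?exprn_ge0// ltW.
    apply: (@le_trans _ _ ((2 ^+ N * (N%:R * 2) `^ e * (r ^+ j) ^+ 2)%:E * K%:E)%E).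
      by apply: lee_pmul => //; rewrite lee_fin ?scale_avg// !mulr_ge0 ?powR_ge0// invr_ge0 exprn_ge0// ltW.
    rewrite -EFinM lee_fin /C1 sqr_sqrtr; last by rewrite !mulr_ge0 ?powR_ge0 ?exprn_ge0.
    by rewrite le_eqVlt; apply/orP; left; apply/eqP; ring.
  rewrite -(ger0_norm (_ : 0 <= C1 * r ^+ j)); last by rewrite mulr_ge0 ?sqrtr_ge0 ?exprn_ge0// ltW.
  by rewrite -ler_sqr ?nnegrE// !real_normK ?num_real// exprMn.
have : `|avg (H j.+1) u x| <= C1 * r ^+ j + C0 * r ^+ j.
  rewrite -[avg (H j.+1) u x](subrK (avg (H j) u x)).
  exact: (le_trans (ler_normD _ _) (lerD d1 IH)).
move/le_trans; apply; rewrite exprS mulrA -mulrDl ler_wpM2r ?exprn_ge0 ?(ltW r0)//.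
have : C1 <= C0 * (r - 1).
  have r10 : 0 < r - 1 by rewrite subr_gt0.
  rewrite -ler_pdivrMr// /C0; have := sqrtr_ge0 K; lra.
lra.
Qed.

(* Where [u] exceeds twice the bound on its average at mesh [2^-j], [u] is
   controlled by its oscillation at that scale, whose integral decays like
   [2^(-2 s j)]. *)
Lemma sqr_le_osc_dyadic j x : 2 * C0 * r ^+ j < `|u x| ->
  ((u x ^+ 2)%:E <= 4%:E * osc (H j) u x)%E.
Proof.
move=> ux; apply: (@le_trans _ _ (4%:E * ((u x - avg (H j) u x) ^+ 2)%:E)%E); last first.
  by apply: lee_wpmul2l => //; exact: sqr_sub_avg_le.
rewrite -EFinM lee_fin.
have := avg_dyadic_le j x; set v := avg _ _ _ => va.
have : `|u x| <= 2 * `|u x - v|.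
  have := ler_normD (u x - v) v; rewrite subrK; lra.
rewrite -(real_normK (num_real (u x))) -(real_normK (num_real (u x - v))).
have := normr_ge0 (u x); set p := `|u x|; set q := `|u x - v|; nra.
Qed.

Let w := 4 * (2 * C0 * r) `^ (t - 2) : R.
Let c j : R := w * (r `^ (t - 2)) ^+ j.

(** A value |u x| above 2 C0 lies between 2 C0 r^j and 2 C0 r^(j+1) for some j. There |u|^t is at
    most (2 C0 r^(j+1))^(t-2) u^2, and u^2 is at most 4 times the oscillation at mesh 2^-j; [c j]
    collects the factors. Summing over all j avoids splitting the space into level sets. *)
Lemma powR_le_osc_series x : ((`|u x| `^ t)%:E <=
  ((2 * C0) `^ (t - 2))%:E * (u x ^+ 2)%:E +
  \sum_(0 <= j <oo) ((c j)%:E * osc (H j) u x))%E.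
Proof.
have c0 j : 0 <= c j by rewrite !mulr_ge0 ?powR_ge0// exprn_ge0// powR_ge0.
have co j : (0 <= (c j)%:E * osc (H j) u x)%E.
  by rewrite mule_ge0 ?lee_fin ?c0//; exact: osc_ge0.
have t20 : 0 < t - 2 by rewrite subr_gt0.
have utE : `|u x| `^ t = `|u x| `^ (t - 2) * u x ^+ 2.
  have [->|u0] := eqVneq (u x) 0.
    by rewrite normr0 !powR0 ?mul0r// gt_eqF// (lt_trans _ t2).
  rewrite -(real_normK (num_real (u x))) -powR_mulrn// -pD ?normr_gt0//.
  by rewrite subrK.
have [ul|ul] := leP `|u x| (2 * C0).
  rewrite -[leLHS]adde0; apply: leeD; last exact: nneseries_ge0.
  rewrite utE EFinM; apply: lee_wpmul2r; first by rewrite lee_fin sqr_ge0.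
  by rewrite lee_fin; apply: ge0_ler_powR; rewrite ?nnegrE ?(ltW t20)// mulr_ge0// ltW.
have [j [uj uj1]] : exists j, 2 * C0 * r ^+ j < `|u x| /\ `|u x| <= 2 * C0 * r ^+ j.+1.
  have [n un] : exists n, `|u x| <= 2 * C0 * r ^+ n.
    have [n Hn] : exists n, `|u x| / (2 * C0) <= r ^+ n.
      have r10 : 0 < r - 1 by rewrite subr_gt0.
      pose X := `|u x| / (2 * C0) / (r - 1).
      have X0 : 0 <= X by rewrite !divr_ge0// ?mulr_ge0// ltW.
      exists (Num.bound X); apply: (@le_trans _ _ (1 + (Num.bound X)%:R * (r - 1))).
        have := ltW (archi_boundP X0); rewrite {1}/X ler_pdivrMr//; lra.
      elim: (Num.bound X) => [|n IH]; first by rewrite mul0r addr0 expr0.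
      rewrite exprS -natr1; have := ler_wpM2l (ltW r0) IH.
      by have := mulr_ge0 (ler0n R n) (sqr_ge0 (r - 1)); lra.
    exists n; by rewrite mulrC -ler_pdivrMr// mulr_gt0.
  have ex : exists n, `|u x| <= 2 * C0 * r ^+ n by exists n.
  have := ex_minnP ex; case: ex_minnP => -[|m] um mmin _.
    by move: um; rewrite expr0 mulr1 leNgt ul.
  exists m; split => //; rewrite ltNge; apply/negP => /mmin; by rewrite ltnn.
apply: (@le_trans _ _ ((c j)%:E * osc (H j) u x)%E).
  apply: (@le_trans _ _ ((`|u x| `^ (t - 2))%:E * (4%:E * osc (H j) u x))%E).
    by rewrite utE EFinM; apply: lee_wpmul2l; [rewrite lee_fin powR_ge0|exact: sqr_le_osc_dyadic].
  rewrite muleA -EFinM; apply: lee_wpmul2r; first exact: osc_ge0.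
  rewrite lee_fin /c /w mulrC -mulrA ler_wpM2l//.
  have -> : (2 * C0 * r) `^ (t - 2) * (r `^ (t - 2)) ^+ j = (2 * C0 * r ^+ j.+1) `^ (t - 2).
    rewrite -powR_mulrn ?powR_ge0// -powRrM (mulrC (t - 2)) powRrM powR_mulrn ?(ltW r0)//.
    by rewrite -powRM ?mulr_ge0 ?exprn_ge0 ?(ltW r0) ?(ltW C00)// -!mulrA exprS.
  apply: ge0_ler_powR; rewrite ?nnegrE ?(ltW t20)//.
  by rewrite !mulr_ge0 ?exprn_ge0 ?(ltW r0) ?(ltW C00).
rewrite -[leLHS]add0e; apply: leeD; first by rewrite -EFinM lee_fin mulr_ge0 ?powR_ge0 ?sqr_ge0.
exact: (@nneseries_ge_term (fun j => (c j)%:E * osc (H j) u x)%E).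
Qed.

Let y := r `^ (t - 2) * rho.

(** The condition is (N/2 - s)(t - 2) < 2s, which rearranges to t < 2N/(N - 2s). Here subcriticality
    is used. *)
Lemma ratio_lt1 : 0 <= y < 1.
Proof.
rewrite /y mulr_ge0 ?powR_ge0//= /r -powRrM -pD//.
rewrite -[ltRHS](powRr0 2) /powR pnatr_eq0/= ltr_expR ltr_pM2r; last by rewrite ln_gt0// ltr1n.
move: ht; rewrite /sobolev_exponent ltr_pdivlMr; last by move: hN; lra.
by rewrite /a; lra.
Qed.

Lemma integral_powR_le : (\int[mu]_x (`|u x| `^ t)%:E <=
  ((2 * C0) `^ (t - 2) * K + w * (N%:R `^ e * K) / (1 - y))%:E)%E.
Proof.
have c0 j : 0 <= c j by rewrite !mulr_ge0 ?powR_ge0// exprn_ge0// powR_ge0.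
have co j x : (0 <= (c j)%:E * osc (H j) u x)%E.
  by rewrite mule_ge0 ?lee_fin ?c0//; exact: osc_ge0.
have mco j : measurable_fun setT (fun x => (c j)%:E * osc (H j) u x)%E.
  by apply: measurable_funeM; exact: measurable_osc.
have mu2 : measurable_fun setT (fun x => ((2 * C0) `^ (t - 2))%:E * (u x ^+ 2)%:E)%E.
  by apply: measurable_funeM; apply/measurable_EFinP; exact: measurable_funX.
have ms : measurable_fun setT (fun x => \sum_(0 <= j <oo) ((c j)%:E * osc (H j) u x))%E.
  by apply: ge0_emeasurable_sum.
apply: (@le_trans _ _ (\int[mu]_x (((2 * C0) `^ (t - 2))%:E * (u x ^+ 2)%:E +
  \sum_(0 <= j <oo) ((c j)%:E * osc (H j) u x)))%E).
  apply: ge0_le_integral => //.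
  - apply/measurable_EFinP; apply: (measurableT_comp (measurable_powR _)).
    exact: (measurableT_comp (@normr_measurable R setT)).
  - exact: emeasurable_funD.
  - by move=> x _; exact: powR_le_osc_series.
rewrite ge0_integralD//; last 2 first.
- by move=> x _; rewrite -EFinM lee_fin mulr_ge0 ?powR_ge0 ?sqr_ge0.
- by move=> x _; exact: nneseries_ge0.
rewrite EFinD; apply: leeD.
  rewrite ge0_integralZl_EFin ?powR_ge0//; last 2 first.
  - by move=> x _; rewrite lee_fin sqr_ge0.
  - by apply/measurable_EFinP; exact: measurable_funX.
  by rewrite EFinM; apply: lee_wpmul2l; rewrite ?lee_fin ?powR_ge0.
rewrite integral_nneseries//.
apply: nneseries_le_bound; first by move=> j; apply: integral_ge0.
move=> n; apply: (@le_trans _ _ (\sum_(0 <= j < n) (w * (N%:R `^ e * K) * y ^+ j))%:E); last first.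
  rewrite lee_fin geometric_sum_le ?ratio_lt1//.
  by rewrite !mulr_ge0 ?powR_ge0.
rewrite -sumEFin; apply: lee_sum => j _.
rewrite ge0_integralZl_EFin ?c0//; last 2 first.
- by move=> x _; exact: osc_ge0.
- exact: measurable_osc.
apply: (@le_trans _ _ ((c j)%:E * ((N%:R `^ e * rho ^+ j)%:E * K%:E))%E).
  apply: lee_wpmul2l; first by rewrite lee_fin c0.
  apply: (le_trans (integral_osc_le s0 (H0 j) mU)); rewrite scale_osc.
  by apply: lee_wpmul2l => //; rewrite lee_fin mulr_ge0 ?powR_ge0// exprn_ge0// powR_ge0.
rewrite -!EFinM lee_fin /c /y exprMn le_eqVlt; apply/orP; left; apply/eqP; ring.
Qed.

End function.

Lemma sobolev_bound : exists B : R, forall u : T -> R, measurable_fun setT u ->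
  (\int[mu]_x (u x ^+ 2)%:E <= K%:E)%E -> (gagliardo2 s u <= K%:E)%E ->
  (\int[mu]_x (`|u x| `^ t)%:E <= B%:E)%E.
Proof. by eexists => u mU u2 ug; exact: integral_powR_le. Qed.

End sobolev.

(** * Compactness *)

Section extraction.

(** The limit is the supremum of the [x] such that [x <= b n] on a set of the ultrafilter, which
    decides every such comparison. *)
Lemma ultra_bounded_cvg (R : realType) (U : set_system nat) (b : nat -> R) (B : R) :
  UltraFilter U -> (forall n, `|b n| <= B) ->
  exists c, forall e, 0 < e -> U [set n | `|b n - c| < e].
Proof.
move=> UU bB; pose A := [set x | U [set n | x <= b n]].
have b1 n : - B <= b n <= B by have := bB n; rewrite ler_norml.
have sA : has_sup A.
  split.
    by exists (- B); rewrite /A/=; apply: filterS filterT => n _ /=; case/andP: (b1 n).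
  exists B => x Ux; have [n /=] := filter_ex Ux.
  by move=> /le_trans; apply; case/andP: (b1 n).
exists (sup A) => e e0.
have [x Ax xe] := sup_adherent e0 sA.
have [Ay|Ay] := in_ultra_setVsetC [set n | sup A + e <= b n] UU.
  have /(ub_le_sup (proj2 sA)) : A (sup A + e) by [].
  by rewrite gerDl leNgt e0.
apply: filterS2 Ax Ay => n /= xb /negP; rewrite -ltNge => be.
by rewrite ltr_norml; apply/andP; split; lra.
Qed.

(** A diagonal subsequence: finitely many sets of the ultrafilter and a tail of the integers always
    have a common index. *)
Lemma ultra_extraction (U : set_system nat) (S : nat -> set nat) :
  UltraFilter U -> (\oo : set_system nat) `<=` U -> (forall j, U (S j)) ->
  exists sigma : nat -> nat, forall j,
    [/\ (j <= sigma j)%N & forall i, (i <= j)%N -> S i (sigma j)].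
Proof.
move=> UU ooU US.
suff /choice[sigma Hs] : forall j, exists n, (j <= n)%N /\ forall i, (i <= j)%N -> S i n.
  by exists sigma => j; have [] := Hs j; split.
move=> j.
have UF : U [set n | forall i : 'I_j.+1, S i n].
  by apply: filter_forall => i; exact: US.
have Uj : U [set n | (j <= n)%N] by apply: ooU; exact: nbhs_infty_ge.
have [n [/= jn Sn]] := filter_ex (filterI Uj UF).
by exists n; split => // i ij; exact: (Sn (Ordinal (_ : i < j.+1)%N)).
Qed.

End extraction.

(** * Passage to the limit in integrals *)

Section limit_integrals.
Context d (T : measurableType d) (R : realType) (mu : {measure set T -> \bar R}).
Implicit Types f : nat -> T -> R.

Lemma measurable_limn_einf (f : nat -> T -> \bar R) :
  (forall n, measurable_fun setT (f n)) ->
  measurable_fun setT (fun x => limn_einf (f ^~ x)).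
Proof.
move=> mf; rewrite /limn_einf.
apply: (measurableT_comp (@oppe_measurable R setT)).
apply: (@measurable_fun_limn_esup _ _ _ _ (fun n x => - f n x)%E) => n.
exact: (measurableT_comp (@oppe_measurable R setT)).
Qed.

(** Fatou's lemma as an eventual lower bound. A free level [c] also covers an infinite limit
    integral, which is how finiteness of the norm of a limit is proved later. *)
Lemma fatou_near f (u : T -> R) (c : R) : (forall n, measurable_fun setT (f n)) ->
  measurable_fun setT u -> (forall n x, 0 <= f n x) -> (forall x, 0 <= u x) ->
  {ae mu, forall x, f n x @[n --> \oo] --> u x} ->
  (c%:E < \int[mu]_x (u x)%:E)%E ->
  \forall n \near \oo, (c%:E < \int[mu]_x (f n x)%:E)%E.
Proof.
move=> mf mU f0 u0 fu cu.
have mfE n : measurable_fun setT (fun x => (f n x)%:E) by exact/measurable_EFinP.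
have f0E n x : setT x -> (0 <= (f n x)%:E)%E by move=> _; rewrite lee_fin.
have := fatou mu measurableT mfE f0E.
have -> : (\int[mu]_x limn_einf (fun n => (f n x)%:E) = \int[mu]_x (u x)%:E)%E.
  apply: ge0_ae_eq_integral => //.
  - exact: measurable_limn_einf.
  - exact/measurable_EFinP.
  - move=> x _; rewrite limn_einf_lim; apply: lime_ge; first exact: is_cvg_einfs.
    by apply: nearW => n; apply: le_ereal_inf_tmp => _ [k _ <-]; rewrite lee_fin.
  - by move=> x _; rewrite lee_fin.
  - apply: filterS fu => x fux _.
    have fuE : (fun n => (f n x)%:E) @ \oo --> (u x)%:E.
      by apply/fine_cvgP; split => //; exact: nearW.
    by have [-> _] := cvg_limn_einf_sup fuE.
move=> /(lt_le_trans cu); rewrite limn_einf_lim.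
set a := fun n => _; have -> : limn (einfs a) = ereal_sup (range (einfs a)).
  by apply/cvg_lim => //; exact: cvg_einfs_sup.
move=> /ereal_sup_gt[_ [m _ <-]] cm.
exists m => // n /= mn; apply: (lt_le_trans cm).
by apply: ereal_inf_lbound; exists n.
Qed.

(** The Riesz-Fischer argument: [S], the sum of the first absolute value and of all increments, has
    a finite integral, so it is finite almost everywhere. There the telescoping series converges and
    [S] majorizes every term. *)
Lemma fast_cauchy_cvg f : (forall n, measurable_fun setT (f n)) ->
  (\int[mu]_x (`|f 0%N x|)%:E < +oo)%E ->
  (forall n, (\int[mu]_x (`|f n.+1 x - f n x|)%:E <= (2^-1 ^+ n)%:E)%E) ->
  exists u g : T -> R, [/\ measurable_fun setT u, measurable_fun setT g,
    forall x, 0 <= g x, (\int[mu]_x (g x)%:E < +oo)%E &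
    {ae mu, forall x, f n x @[n --> \oo] --> u x /\ forall n, `|f n x| <= g x}].
Proof.
move=> mf f0 fn.
have mabs (h : T -> R) : measurable_fun setT h -> measurable_fun setT (fun x => (`|h x|)%:E).
  move=> mh; apply/measurable_EFinP.
  exact: (measurableT_comp (@normr_measurable R setT)).
pose S x := ((`|f 0%N x|)%:E + \sum_(0 <= n <oo) (`|f n.+1 x - f n x|)%:E)%E.
have md n : measurable_fun setT (fun x => (`|f n.+1 x - f n x|)%:E).
  by apply: mabs; exact: measurable_funB.
have mser : measurable_fun setT (fun x => \sum_(0 <= n <oo) (`|f n.+1 x - f n x|)%:E)%E.
  by apply: ge0_emeasurable_sum.
have ser0 x : (0 <= \sum_(0 <= n <oo) (`|f n.+1 x - f n x|)%:E)%E.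
  by apply: nneseries_ge0 => n _ _; rewrite lee_fin.
have mS : measurable_fun setT S by apply: emeasurable_funD => //; exact: mabs.
have S0 x : (0 <= S x)%E by rewrite /S adde_ge0.
have Sy : (\int[mu]_x S x < +oo)%E.
  rewrite ge0_integralD//; last exact: mabs.
  rewrite lte_add_pinfty// integral_nneseries//.
  apply: (@le_lt_trans _ _ 2%:E); last exact: ltry.
  apply: nneseries_le_bound => [n|n]; first exact: integral_ge0.
  apply: (@le_trans _ _ (\sum_(0 <= j < n) 1 * 2^-1 ^+ j)%:E).
    by rewrite -sumEFin; apply: lee_sum => j _; rewrite mul1r.
  rewrite lee_fin; apply: le_trans (geometric_sum_le _ _ _) _ => //.
    by apply/andP; split => //; lra.
  by rewrite ler_pdivrMr; lra.
have iS : mu.-integrable setT S.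
  apply/integrableP; split => //; apply: le_lt_trans Sy.
  by under eq_integral do rewrite gee0_abs//.
pose D := [set x | S x \is a fin_num].
have mD : measurable D by rewrite -[D]setTI; exact: emeasurable_fin_num.
have fE n x : f n x = f 0%N x + \sum_(0 <= k < n) (f k.+1 x - f k x).
  by rewrite (telescope_sumr (fun k => f k x))// subrKC.
have bnd x : D x -> forall n, `|f n x| <= fine (S x).
  move=> Dx n; rewrite -lee_fin fineK//.
  apply: (@le_trans _ _ ((`|f 0%N x|)%:E + \sum_(0 <= k < n) (`|f k.+1 x - f k x|)%:E)%E).
    rewrite sumEFin -EFinD lee_fin fE; apply: (le_trans (ler_normD _ _)).
    by rewrite lerD2l; exact: ler_norm_sum.
  by apply: leeD => //; apply: nneseries_lim_ge => k _ _; rewrite lee_fin.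
have cvf x : D x -> cvgn (fun n => f n x).
  move=> Dx; pose dd k := f k.+1 x - f k x.
  have : cvgn (series dd).
    apply: normed_cvg; apply: nnseries_is_cvg => [i|]; first exact: normr_ge0.
    apply: (@le_lt_trans _ _ (S x)); first by rewrite /S leeDr.
    by rewrite ltey_eq Dx.
  move=> cd; have -> : (fun n => f n x) = (fun n => f 0%N x + series dd n).
    by apply/funext => n; rewrite fE.
  by apply: is_cvgD => //; exact: is_cvg_cst.
(* Cutting off the null set where [S] is infinite makes the sequence converge everywhere, so that
   its limit is measurable. *)
pose u x := lim ((f n x * \1_D x) @[n --> \oo]).
have fu x : (f n x * \1_D x) @[n --> \oo] --> u x.
  have [Dx|nDx] := pselect (D x).
    suff : cvgn (fun n => f n x * \1_D x) by [].
    rewrite indicE mem_set//; under eq_fun do rewrite mulr1; exact: cvf.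
  suff : cvgn (fun n => f n x * \1_D x) by [].
  rewrite indicE memNset//; under eq_fun do rewrite mulr0; exact: is_cvg_cst.
exists u, (fun x => fine (S x)); split.
- apply: (@measurable_fun_cvg _ _ _ _ (fun n x => f n x * \1_D x)) => // n.
  by apply: measurable_funM => //; exact: measurable_indic.
- exact: (measurableT_comp (@fine_measurable R setT measurableT)).
- by move=> x; rewrite fine_ge0.
- apply: le_lt_trans Sy; apply: ge0_le_integral => //.
  + by move=> x _; rewrite lee_fin fine_ge0.
  + apply/measurable_EFinP; exact: (measurableT_comp (@fine_measurable R setT measurableT)).
  + move=> x _; have := S0 x; case: (S x) => [r||]//=.
- have /= := integrable_ae measurableT iS; apply: filterS => x /(_ I) Dx.
  split; last exact: bnd.
  by have := fu x; rewrite indicE mem_set//; under eq_fun do rewrite mulr1.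
Qed.

(* [H] is bounded in [L^1] and [eps] is arbitrary, so the majorant makes [F]
   uniformly integrable. *)
Lemma uniform_integrable_cvg (F H : nat -> T -> R) (F' H' g : T -> R) (B : R) :
  (forall n, measurable_fun setT (F n)) -> (forall n, measurable_fun setT (H n)) ->
  measurable_fun setT F' -> measurable_fun setT H' -> measurable_fun setT g ->
  (forall n x, 0 <= F n x) -> (forall n x, 0 <= H n x) ->
  (forall x, 0 <= F' x) -> (forall x, 0 <= H' x) -> (forall x, 0 <= g x) ->
  (\int[mu]_x (g x)%:E < +oo)%E ->
  (forall n, (\int[mu]_x (H n x)%:E <= B%:E)%E) ->
  {ae mu, forall x, F n x @[n --> \oo] --> F' x /\ H n x @[n --> \oo] --> H' x} ->
  (forall eps, 0 < eps -> exists2 C, 0 <= C &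
    {ae mu, forall x, forall n, F n x <= C * g x + eps * H n x}) ->
  mu.-integrable setT (EFin \o F') /\
  forall e, 0 < e -> \forall n \near \oo,
    `|\int[mu]_x F n x - \int[mu]_x F' x| < e.
Proof.
move=> mF mH mF' mH' mg F0 H0 F'0 H'0 g0 gy HB cv dom.
have ig : mu.-integrable setT (EFin \o g) by exact: ge0_integrable_lty.
have iH n : mu.-integrable setT (EFin \o H n).
  by apply: ge0_integrable_lty => //; rewrite (le_lt_trans (HB n))// ltry.
have cvF : {ae mu, forall x, F n x @[n --> \oo] --> F' x} by apply: filterS cv => x [].
have cvH : {ae mu, forall x, H n x @[n --> \oo] --> H' x} by apply: filterS cv => x [].
have H'B : (\int[mu]_x (H' x)%:E <= B%:E)%E.
  rewrite leNgt; apply/negP => /(fatou_near mH mH' H0 H'0 cvH)[m _ /(_ m (leqnn _))/=].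
  by rewrite ltNge HB.
have iH' : mu.-integrable setT (EFin \o H').
  by apply: ge0_integrable_lty => //; rewrite (le_lt_trans H'B)// ltry.
have iCg C eps (h : T -> R) : mu.-integrable setT (EFin \o h) ->
    mu.-integrable setT (EFin \o (fun x => C * g x + eps * h x)).
  move=> ih; exact: (integrableD measurableT (integrableZl measurableT C ig) (integrableZl measurableT eps ih)).
have lea (h k : T -> R) : measurable_fun setT h -> (forall x, 0 <= h x) ->
    mu.-integrable setT (EFin \o k) -> {ae mu, forall x, h x <= k x} ->
    mu.-integrable setT (EFin \o h).
  move=> mh h0 ik hk; apply: ge0_integrable_lty => //.
  have mk : measurable_fun setT k by apply/measurable_EFinP; exact: measurable_int ik.
  have := integrable_norm ik => /(integrable_lty_ge0 (fun x => normr_ge0 _)).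
  apply: le_lt_trans; apply: ae_ge0_le_integral => //.
  - by move=> x _; rewrite lee_fin.
  - exact/measurable_EFinP.
  - by apply/measurable_EFinP; exact: (measurableT_comp (@normr_measurable R setT)).
  - by apply: filterS hk => x hk _; rewrite lee_fin (le_trans hk)// ler_norm.
have iF n : mu.-integrable setT (EFin \o F n).
  have [C C0 HC] := dom 1 ltr01; apply: lea (iCg C 1 _ (iH n)) _ => //.
  by apply: filterS HC => x; apply.
have dom' eps : 0 < eps -> exists2 C, 0 <= C &
    {ae mu, forall x, (forall n, F n x <= C * g x + eps * H n x) /\ F' x <= C * g x + eps * H' x}.
  move=> /dom[C C0 HC]; exists C => //; apply: filterS2 HC cv => x FC [c1 c2].
  split=> //; apply: (ler_cvg_to c1 _ (nearW _ FC)).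
  by apply: cvgD; [exact: cvg_cst|apply: cvgM; [exact: cvg_cst|]].
have iF' : mu.-integrable setT (EFin \o F').
  have [C C0 HC] := dom' 1 ltr01; apply: lea (iCg C 1 _ iH') _ => //.
  by apply: filterS HC => x; case.
split=> // e e0.
have low : \forall n \near \oo, \int[mu]_x F' x - e < \int[mu]_x F n x.
  have := @fatou_near F F' (\int[mu]_x F' x - e) mF mF' F0 F'0 cvF.
  rewrite -EFin_Rintegral// lte_fin ltrBlDr ltrDl => /(_ e0); apply: filterS => n.
  by rewrite -EFin_Rintegral.
have B0 : 0 <= B.
  by rewrite -lee_fin (le_trans _ (HB 0%N))//; apply: integral_ge0 => x _; rewrite lee_fin.
have eps0 : 0 < e / 2 / (B + 1) by rewrite !divr_gt0// ltr_wpDl.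
have [C C0 HC] := dom' _ eps0; set eps := e / 2 / (B + 1) in HC.
(* Fatou's lemma for C g + eps H_n - F_n bounds the integrals of F_n from above, and [H n] costs at
   most e/2 by the choice of [eps]. The absolute values change these functions only on a null set
   and make them nonnegative everywhere. *)
pose W n x := `|C * g x + eps * H n x - F n x|.
pose W' x := `|C * g x + eps * H' x - F' x|.
have mW n : measurable_fun setT (W n).
  apply: (measurableT_comp (@normr_measurable R setT)); apply: measurable_funB => //.
  by apply: measurable_funD; apply: measurable_funM.
have mW' : measurable_fun setT W'.
  apply: (measurableT_comp (@normr_measurable R setT)); apply: measurable_funB => //.
  by apply: measurable_funD; apply: measurable_funM.
have cW : {ae mu, forall x, W n x @[n --> \oo] --> W' x}.
  apply: filterS cv => x [c1 c2]; apply: cvg_norm; apply: cvgB => //.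
  by apply: cvgD; [exact: cvg_cst|apply: cvgM; [exact: cvg_cst|]].
have Weq (h k : T -> R) : mu.-integrable setT (EFin \o h) -> mu.-integrable setT (EFin \o k) ->
    {ae mu, forall x, k x <= C * g x + eps * h x} ->
    measurable_fun setT (fun x => `|C * g x + eps * h x - k x|) ->
    (\int[mu]_x (`|C * g x + eps * h x - k x|)%:E)%E =
    (C * \int[mu]_x g x + eps * \int[mu]_x h x - \int[mu]_x k x)%:E.
  move=> ih ik hk mm.
  have iZ c (l : T -> R) : mu.-integrable setT (EFin \o l) ->
      mu.-integrable setT (EFin \o (fun x => c * l x)).
    by move=> il; exact: (integrableZl measurableT c il).
  rewrite -RintegralZl// -[eps * _]RintegralZl// -RintegralD//; [|exact: iZ|exact: iZ].
  rewrite -RintegralB//; last exact: iCg.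
  rewrite EFin_Rintegral; last exact: (integrableB measurableT (iCg C eps _ ih) ik).
  apply: ae_eq_integral => //.
  - exact/measurable_EFinP.
  - exact: measurable_int (integrableB measurableT (iCg C eps _ ih) ik).
  - by apply: filterS hk => x hk _; rewrite ger0_norm// subr_ge0.
have hi : \forall n \near \oo, \int[mu]_x F n x < \int[mu]_x F' x + e.
  have := @fatou_near W W' (C * \int[mu]_x g x - \int[mu]_x F' x - e / 2) mW mW' (fun _ _ => normr_ge0 _) (fun _ => normr_ge0 _) cW.
  rewrite Weq//; last by apply: filterS HC => x [].
  rewrite lte_fin => h.
  have {}h : \forall n \near \oo, ((C * \int[mu]_x g x - \int[mu]_x F' x - e / 2)%:E <
      \int[mu]_x (W n x)%:E)%E.
    apply: h; have : 0 <= eps * \int[mu]_x H' x.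
      by rewrite mulr_ge0 ?(ltW eps0)//; apply: Rintegral_ge0.
    lra.
  apply: filterS h => n; rewrite Weq//; [|by apply: filterS HC => x [Hx _]; exact: Hx|exact: mW].
  rewrite lte_fin.
  have : eps * \int[mu]_x H n x <= e / 2.
    have HnB : \int[mu]_x H n x <= B + 1.
      by have := HB n; rewrite -EFin_Rintegral// lee_fin; lra.
    have := ler_wpM2l (ltW eps0) HnB; rewrite /eps divfK ?gt_eqF ?ltr_wpDl//.
  lra.
near=> n; rewrite ltr_norml; apply/andP; split.
  by rewrite ltrBrDl; near: n.
by rewrite ltrBlDl; near: n.
Unshelve. all: by end_near.
Qed.

End limit_integrals.

(** * Precompactness in L^1 *)

Section compactness.
Context {R : realType} {N : nat}.
Local Notation T := 'rV[R]_N.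
Local Notation mu := (leb N : {measure set 'rV[R]_N -> \bar R}).

Definition box (M : nat) : set T := [set x | forall i, - M%:R <= x ord0 i < M%:R].

Lemma measurable_box M : measurable (box M).
Proof.
rewrite (_ : box M = \bigcap_(i in [set: 'I_N])
    ((fun x : 'rV[R]_N => x ord0 i) @^-1` `[- M%:R, M%:R[)).
  apply: fin_bigcap_measurable => // i _.
  by rewrite -[X in measurable X]setTI; exact: measurable_coord.
apply/seteqP; split => x /= H i; first by move=> _ /=; rewrite in_itv/=.
by have := H i I; rewrite /= in_itv.
Qed.

Lemma leb_box_sym M : leb N (box M) = ((M%:R + M%:R) ^+ N)%:E.
Proof.
have -> : box M = [set x : T | forall i, (\row_(i < N) - M%:R) ord0 i <= x ord0 i <
    (\row_(i < N) M%:R) ord0 i].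
  by apply/seteqP; split => x /= H i; have := H i; rewrite !mxE.
rewrite leb_box_co; last by move=> i; rewrite !mxE; have := ler0n R M; lra.
congr EFin; under eq_bigr do rewrite !mxE opprK.
by rewrite prodr_const card_ord.
Qed.

Lemma box_exhaust (x : T) : \forall M \near \oo, box M x.
Proof.
suff : \forall M \near \oo, forall i : 'I_N, - M%:R <= x ord0 i < M%:R by [].
apply: filter_forall => i; near=> M.
have : `|x ord0 i| < M%:R by near: M; exact: nbhs_infty_gtr.
by rewrite ltr_norml => /andP[? ->]; rewrite ltW.
Unshelve. all: by end_near.
Qed.

Lemma integrable_tail (f : T -> R) (eps : R) : measurable_fun setT f ->
  (forall x, 0 <= f x) -> mu.-integrable setT (EFin \o f) -> 0 < eps ->
  exists M, (\int[mu]_x (f x * \1_(~` box M) x)%:E <= eps%:E)%E.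
Proof.
move=> mf f0 fi eps0.
have mM M : measurable_fun setT (fun x => (f x * \1_(~` box M) x)%:E).
  apply/measurable_EFinP; apply: measurable_funM => //.
  by apply: measurable_indic; apply: measurableC; exact: measurable_box.
have cM : {ae mu, forall x, setT x -> (f x * \1_(~` box M) x)%:E @[M --> \oo] --> (cst 0%E : T -> \bar R) x}.
  apply: aeW => x _; apply: cvg_near_cst.
  near=> M; rewrite indicE memNset ?mulr0// => /=; apply; near: M; exact: box_exhaust.
have dM : {ae mu, forall x, forall M, setT x -> (`|(f x * \1_(~` box M) x)%:E| <= (EFin \o f) x)%E}.
  apply: aeW => x M _; rewrite /= lee_fin ger0_norm ?mulr_ge0//.
  by rewrite ler_piMr// indicE lern1 leq_b1.
have [_ _] := dominated_convergence measurableT mM (measurable_cst 0%E) cM fi dM.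
rewrite integral0 => /fine_cvgP[fn /cvgr_lt/(_ _ eps0) H].
have [M [/= Mf Me]] := filter_ex (filterI fn H).
by exists M; rewrite -[leLHS]fineK// lee_fin ltW.
Unshelve. all: by end_near.
Qed.

Variables (s V0 : R) (V : T -> R).
Hypotheses (s0 : 0 < s) (V00 : 0 < V0) (hV : forall x, V0 <= V x).
Hypothesis (iV : mu.-integrable setT (fun x => ((V x)^-1)%:E)).
Local Notation e := (N%:R + 2 * s).

Lemma V_gt0 x : 0 < V x. Proof. exact: lt_le_trans (hV x). Qed.

Lemma measurable_Vinv : measurable_fun setT (fun x => (V x)^-1).
Proof. by apply/measurable_EFinP; exact: measurable_int iV. Qed.

Lemma measurable_V : measurable_fun setT V.
Proof.
have -> : V = (fun x => ((V x)^-1) `^ (-1)).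
  by apply/funext => x; rewrite powR_inv1 ?invrK// invr_ge0 ltW// V_gt0.
exact: (measurableT_comp (measurable_powR _) measurable_Vinv).
Qed.

(** Complete the square. Integrated outside a box, this bounds the mass at infinity by a tail of 1/V
    plus a small multiple of the weighted norm. *)
Lemma norm_le_weight (eps x v : R) : 0 < eps -> 0 < v ->
  `|x| <= eps^-1 / v / 2 + eps / 2 * (v * x ^+ 2).
Proof.
move=> eps0 v0; rewrite -(real_normK (num_real x)); set y := `|x|.
have -> : eps^-1 / v / 2 + eps / 2 * (v * y ^+ 2) = y + (eps * v * y - 1) ^+ 2 / (2 * eps * v).
  by field; rewrite !gt_eqF.
by rewrite lerDl divr_ge0 ?sqr_ge0// !mulr_ge0 ?ltW.
Qed.

Lemma norm_le_sqr (eta x : R) : 0 < eta -> `|x| <= eta / 2 + x ^+ 2 / (2 * eta).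
Proof.
move=> eta0; rewrite -(real_normK (num_real x)); set y := `|x|.
have -> : eta / 2 + y ^+ 2 / (2 * eta) = y + (y - eta) ^+ 2 / (2 * eta).
  by field; rewrite !gt_eqF.
by rewrite lerDl divr_ge0 ?sqr_ge0// !mulr_ge0 ?ltW.
Qed.

Definition bounded_Hs (K : R) (u : T -> R) := [/\ measurable_fun setT u,
  (\int[mu]_x (u x ^+ 2)%:E <= K%:E)%E, (gagliardo2 s u <= K%:E)%E &
  (\int[mu]_x (V x * u x ^+ 2)%:E <= K%:E)%E].

Section estimate.
Variables (K h eta del eps : R) (M : nat) (u v : T -> R).
Hypotheses (h0 : 0 < h) (eta0 : 0 < eta) (del0 : 0 < del) (eps0 : 0 < eps).
Hypotheses (K0 : 0 <= K) (bu : bounded_Hs K u) (bv : bounded_Hs K v).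
Hypothesis (huv : forall x, box M x -> `|avg h u x - avg h v x| <= del).

Let F1 x : \bar R := ((eta + del) * \1_(box M) x)%:E.
Let F2 x : \bar R := ((2 * eta)^-1%:E * (osc h u x + osc h v x))%E.
Let F3 x : \bar R := (eps^-1 * ((V x)^-1 * \1_(~` box M) x))%:E.
Let F4 x : \bar R := ((eps / 2) * (V x * u x ^+ 2 + V x * v x ^+ 2))%:E.

Let uy : (\int[mu]_x (u x ^+ 2)%:E < +oo)%E.
Proof. by case: bu => _ + _ _; move/le_lt_trans; apply; exact: ltry. Qed.
Let vy : (\int[mu]_x (v x ^+ 2)%:E < +oo)%E.
Proof. by case: bv => _ + _ _; move/le_lt_trans; apply; exact: ltry. Qed.
Let mU : measurable_fun setT u. Proof. by case: bu. Qed.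
Let mV' : measurable_fun setT v. Proof. by case: bv. Qed.

Let F1_ge0 x : (0 <= F1 x)%E.
Proof. by rewrite lee_fin mulr_ge0// addr_ge0// ltW. Qed.
Let F2_ge0 x : (0 <= F2 x)%E.
Proof.
apply: mule_ge0; first by rewrite lee_fin invr_ge0 mulr_ge0// ltW.
by apply: adde_ge0; exact: osc_ge0.
Qed.
Let F3_ge0 x : (0 <= F3 x)%E.
Proof. by rewrite lee_fin !mulr_ge0// ?invr_ge0 ltW// V_gt0. Qed.
Let F4_ge0 x : (0 <= F4 x)%E.
Proof.
have VV := V_gt0 x.
rewrite lee_fin; apply: mulr_ge0; first by rewrite divr_ge0// ltW.
by apply: addr_ge0; apply: mulr_ge0; rewrite ?sqr_ge0// ltW.
Qed.

(* In the box each function is close to its averages, and the averages are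
   [del]-close to each other; outside, AM-GM with the weight [V]. *)
Lemma diff_pointwise x : ((`|u x - v x|)%:E <= F1 x + F2 x + (F3 x + F4 x))%E.
Proof.
have [Mx|nMx] := pselect (box M x).
  rewrite -[leLHS]adde0; apply: leeD; last by rewrite adde_ge0.
  rewrite /F1 indicE mem_set// mulr1.
  have eta2 : 0 <= (2 * eta)^-1 by rewrite invr_ge0 mulr_ge0// ltW.
  apply: (@le_trans _ _ ((eta + del)%:E + (2 * eta)^-1%:E * (((u x - avg h u x) ^+ 2)%:E + ((v x - avg h v x) ^+ 2)%:E))%E).
    set A := (u x - _) ^+ 2; set B := (v x - _) ^+ 2.
    rewrite [leRHS](_ : _ = (eta + del + (2 * eta)^-1 * (A + B))%:E)// lee_fin /A /B.
    have := norm_le_sqr (u x - avg h u x) eta0.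
    have := norm_le_sqr (v x - avg h v x) eta0; have := huv Mx.
    have := ler_normD (u x - avg h u x) (avg h u x - v x).
    have := ler_normD (avg h u x - avg h v x) (avg h v x - v x).
    rewrite !addrA !subrK (distrC (avg h v x)); lra.
  apply: leeD => //; apply: lee_wpmul2l; first by rewrite lee_fin.
  by apply: leeD; exact: sqr_sub_avg_le.
rewrite -[leLHS]add0e; apply: leeD; first by rewrite adde_ge0.
rewrite /F3 /F4 -EFinD lee_fin indicE mem_set// mulr1.
have := norm_le_weight (u x) eps0 (V_gt0 x).
have := norm_le_weight (v x) eps0 (V_gt0 x).
have := ler_normB (u x) (v x); lra.
Qed.

(** The fourth term is small with [eps]; the third, for that [eps], on a large box; the first, for
    that box, with [eta] and [del]; the second is of order h^(2s) / eta and is made small last. *)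
Lemma integral_diff_le : (\int[mu]_x (`|u x - v x|)%:E <=
  ((eta + del) * (M%:R + M%:R) ^+ N)%:E +
  (eta^-1 * (h ^- N * (N%:R * h) `^ e * K))%:E +
  (eps^-1%:E * \int[mu]_x ((V x)^-1 * \1_(~` box M) x)%:E + (eps * K)%:E))%E.
Proof.
have mb := measurable_box M.
have mF1 : measurable_fun setT F1.
  by apply/measurable_EFinP; apply: measurable_funM => //; exact: measurable_indic.
have mF2 : measurable_fun setT F2.
  by apply: measurable_funeM; apply: emeasurable_funD; exact: measurable_osc.
have mVt : measurable_fun setT (fun x => (V x)^-1 * \1_(~` box M) x).
  apply: measurable_funM; first exact: measurable_Vinv.
  by apply: measurable_indic; exact: measurableC.
have mF3 : measurable_fun setT F3.
  by apply/measurable_EFinP; apply: measurable_funM.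
have mVu (w : T -> R) : measurable_fun setT w -> measurable_fun setT (fun x => V x * w x ^+ 2).
  by move=> mw; apply: measurable_funM; [exact: measurable_V|exact: measurable_funX].
have mF4 : measurable_fun setT F4.
  by apply/measurable_EFinP; apply: measurable_funM => //; apply: measurable_funD; exact: mVu.
apply: (@le_trans _ _ (\int[mu]_x (F1 x + F2 x + (F3 x + F4 x)))%E).
  apply: ge0_le_integral => //.
  - apply/measurable_EFinP; apply: (measurableT_comp (@normr_measurable R setT)).
    exact: measurable_funB.
  - by apply: emeasurable_funD; exact: emeasurable_funD.
  - by move=> x _; exact: diff_pointwise.
rewrite ge0_integralD//; [|by move=> x _; rewrite adde_ge0|exact: emeasurable_funD|by move=> x _; rewrite adde_ge0|exact: emeasurable_funD].
rewrite ge0_integralD// ge0_integralD//.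
have VV x : 0 <= V x by exact: ltW (V_gt0 x).
apply: leeD; apply: leeD.
- rewrite /F1; under eq_integral do rewrite EFinM.
  rewrite ge0_integralZl_EFin; [|by []|by move=> x _; rewrite lee_fin|by apply/measurable_EFinP; exact: measurable_indic|by rewrite addr_ge0// ltW].
  by rewrite integral_indic// setIT [X in (_ * X)%E]leb_box_sym EFinM.
- have eta2 : 0 <= (2 * eta)^-1 by rewrite invr_ge0 mulr_ge0// ltW.
  have ou x := osc_ge0 u x h0; have ov x := osc_ge0 v x h0.
  rewrite /F2 ge0_integralZl_EFin//; [|by move=> x _; rewrite adde_ge0|by apply: emeasurable_funD; exact: measurable_osc].
  rewrite ge0_integralD//; [|exact: measurable_osc|exact: measurable_osc].
  have c0 : 0 <= h ^- N * (N%:R * h) `^ e.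
    by rewrite mulr_ge0 ?powR_ge0// invr_ge0 exprn_ge0// ltW.
  have I2 (w : T -> R) : bounded_Hs K w -> (\int[mu]_x osc h w x <= (h ^- N * (N%:R * h) `^ e * K)%:E)%E.
    move=> [mw _ gw _]; apply: (le_trans (integral_osc_le s0 h0 mw)).
    by rewrite [leRHS]EFinM; apply: lee_wpmul2l.
  apply: (@le_trans _ _ ((2 * eta)^-1%:E * ((h ^- N * (N%:R * h) `^ e * K)%:E + (h ^- N * (N%:R * h) `^ e * K)%:E))%E).
    by apply: lee_wpmul2l; [rewrite lee_fin|apply: leeD; exact: I2].
  rewrite -EFinD -EFinM lee_fin le_eqVlt; apply/orP; left; apply/eqP.
  by set X := _ * K; field; rewrite gt_eqF.
- rewrite /F3; under eq_integral do rewrite EFinM.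
  rewrite ge0_integralZl_EFin; [|by []|by move=> x _; rewrite lee_fin mulr_ge0// invr_ge0|exact/measurable_EFinP|by rewrite invr_ge0 ltW].
  exact: lexx.
- rewrite /F4; under eq_integral do rewrite EFinM EFinD.
  have p0 (w : T -> R) x : (0 <= (V x * w x ^+ 2)%:E)%E by rewrite lee_fin mulr_ge0 ?sqr_ge0.
  rewrite ge0_integralZl_EFin; [|by []|by move=> x _; rewrite adde_ge0|by apply: emeasurable_funD; apply/measurable_EFinP; exact: mVu|by rewrite divr_ge0// ltW].
  rewrite ge0_integralD//; [|by apply/measurable_EFinP; exact: mVu|by apply/measurable_EFinP; exact: mVu].
  apply: (@le_trans _ _ ((eps / 2)%:E * (K%:E + K%:E))%E).
    apply: lee_wpmul2l; first by rewrite lee_fin divr_ge0// ltW.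
    by apply: leeD; [case: bu|case: bv].
  by rewrite -EFinD -EFinM lee_fin; lra.
Qed.

End estimate.

Lemma avg_bound K h (u : T -> R) x : 0 < h -> 0 <= K -> bounded_Hs K u ->
  `|avg h u x| <= 1 + h ^- N * K.
Proof.
move=> h0 K0 [mU u2 _ _].
have uy : (\int[mu]_x (u x ^+ 2)%:E < +oo)%E by rewrite (le_lt_trans u2)// ltry.
have h1 : 0 <= h ^- N by rewrite invr_ge0 exprn_ge0// ltW.
have : avg h u x ^+ 2 <= h ^- N * K.
  rewrite -lee_fin -sqrrN -sub0r.
  apply: (le_trans (sqr_sub_avg_le x 0 h0 mU uy)).
  apply: (@le_trans _ _ (\int[mu]_y ((h ^- N)%:E * (u y ^+ 2)%:E))%E).
    apply: ge0_le_integralE.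
    - apply: measurable_funM; first exact: measurable_kern.
      by apply: measurable_funX; exact: measurable_funB.
    - by apply: measurable_funM => //; exact: measurable_funX.
    - move=> y; rewrite mulr_ge0 ?kern_ge0 ?sqr_ge0//= sub0r sqrrN.
      by rewrite ler_wpM2r ?sqr_ge0// kern_le.
  rewrite ge0_integralZl_EFin; [|by []|by move=> y _; rewrite lee_fin sqr_ge0|by apply/measurable_EFinP; exact: measurable_funX|exact: h1].
  by rewrite [leRHS]EFinM; apply: lee_wpmul2l.
rewrite -(real_normK (num_real (avg h u x))); have := normr_ge0 (avg h u x).
set a := `|_|; nra.
Qed.

Lemma avg_cell h (u : T -> R) x y : cell h x y -> avg h u x = avg h u y.
Proof.
move=> cxy; apply: eq_Rintegral => z _; congr (_ * _); rewrite /kern.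
congr (_ * (nat_of_bool _)%:R); apply/idP/idP; apply: cell_trans => //.
by rewrite cell_sym.
Qed.

(** The representatives are the grid points whose coordinates are integers between -L and L times
    [h], with [L > M / h]; shifting by [L] indexes them by ordinals. *)
Lemma box_representatives h M : 0 < h -> exists (I : finType) (rep : I -> T),
  forall x, box M x -> exists i, cell h x (rep i).
Proof.
move=> h0; pose L := Num.bound (M%:R / h).
have LM : M%:R / h < L%:R by apply: archi_boundP; rewrite divr_ge0// ltW.
pose rep (f : {ffun 'I_N -> 'I_(2 * L).+1}) : T := \row_i (((f i)%:R - L%:R) * h).
exists {ffun 'I_N -> 'I_(2 * L).+1}, rep => x Mx.
exists [ffun i => inord (absz (Num.floor (x ord0 i / h) + L%:Z))].
apply/cellP => i; rewrite !mxE ffunE mulfK ?gt_eqF//.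
have /andP[x1 x2] := Mx i.
have f1 : - L%:Z <= Num.floor (x ord0 i / h).
  rewrite floor_ge_int mulrNz; apply: ltW; apply: lt_le_trans (_ : - (M%:R / h) <= _).
    by rewrite ltrN2.
  by rewrite -mulNr ler_pM2r// invr_gt0.
have f2 : Num.floor (x ord0 i / h) <= L%:Z.
  rewrite -(ler_int R); apply: (le_trans (floor_le _)); apply: ltW.
  by apply: le_lt_trans LM; rewrite ler_pM2r ?invr_gt0// ltW.
have f3 : 0 <= Num.floor (x ord0 i / h) + L%:Z by lia.
rewrite inordK; last by lia.
have -> : (absz (Num.floor (x ord0 i / h) + L%:Z))%:R - L%:R = (Num.floor (x ord0 i / h))%:~R :> R.
  by rewrite natr_absz ger0_norm// intrD addrK.
by rewrite intrKfloor.
Qed.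

(** Once the box and the mesh are fixed, the averages take finitely many values on the box. Each of
    them converges along [U], so on a set of [U] they are mutually close, and the four terms of
    [integral_diff_le] are each at most eps/4. *)
Lemma L1_precompact (K : R) (w : nat -> T -> R) (U : set_system nat) :
  UltraFilter U -> 0 <= K -> (forall n, bounded_Hs K (w n)) ->
  forall eps, 0 < eps -> exists2 S, U S &
    forall k l, S k -> S l -> (\int[mu]_x (`|w k x - w l x|)%:E <= eps%:E)%E.
Proof.
move=> UU K0 bw eps eps0.
have K1 : 0 < K + 1 by lra.
pose e1 := eps / 4 / (K + 1).
have e10 : 0 < e1 by rewrite !divr_gt0.
have [M HM] := integrable_tail measurable_Vinv (fun x => ltW (eq_ind_r is_true (V_gt0 x) (invr_gt0 (V x)))) iV (mulr_gt0 e10 (divr_gt0 eps0 (@ltr0Sn R 3))).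
pose D := (M%:R + M%:R) ^+ N : R.
have D0 : 0 <= D by rewrite exprn_ge0// addr_ge0.
pose eta := eps / 8 / (D + 1).
have eta0 : 0 < eta by rewrite !divr_gt0// ltr_wpDl.
(* [z] is the value prescribed for h^(2s), chosen to bring the oscillation term below eps/4. *)
pose z := eta * eps / 4 / (N%:R `^ e * K + 1).
have z0 : 0 < z.
  have zz : 0 < N%:R `^ e * K + 1 by rewrite ltr_wpDl// mulr_ge0 ?powR_ge0.
  by apply: divr_gt0 => //; apply: divr_gt0 => //; exact: mulr_gt0.
pose h := z `^ (2 * s)^-1.
have h0 : 0 < h by rewrite powR_gt0.
have [I [rep Hrep]] := box_representatives M h0.
have /choice[c Hc] : forall i : I, exists c, forall e, 0 < e ->
    U [set n | `|avg h (w n) (rep i) - c| < e].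
  by move=> i; apply: (@ultra_bounded_cvg _ _ _ (1 + h ^- N * K)) => n; exact: (avg_bound _ h0 K0 (bw n)).
exists [set n | forall i, `|avg h (w n) (rep i) - c i| < eta / 2].
  by apply: filter_forall => i; apply: Hc; rewrite divr_gt0.
move=> k l /= Sk Sl.
have close x : box M x -> `|avg h (w k) x - avg h (w l) x| <= eta.
  move=> /Hrep[i ci]; rewrite !(avg_cell _ ci).
  have := Sk i; have := Sl i; have := ler_normB (avg h (w k) (rep i) - c i) (avg h (w l) (rep i) - c i).
  have -> : avg h (w k) (rep i) - c i - (avg h (w l) (rep i) - c i) = avg h (w k) (rep i) - avg h (w l) (rep i) by ring.
  lra.
apply: (le_trans (integral_diff_le h0 eta0 eta0 e10 (bw k) (bw l) close)).
have t1 : (eta + eta) * D <= eps / 4.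
  have : eta * (D + 1) = eps / 8 by rewrite /eta divfK// gt_eqF// ltr_wpDl.
  lra.
have t2 : eta^-1 * (h ^- N * (N%:R * h) `^ e * K) <= eps / 4.
  have -> : h ^- N * (N%:R * h) `^ e = N%:R `^ e * z.
    rewrite powRM ?(ltW h0)// mulrCA; congr (_ * _).
    rewrite -(powR_mulrn N (ltW h0)) -powRN -powRD ?(gt_eqF h0) ?implybT// addKr.
    by rewrite /h -powRrM mulVf ?powRr1 ?(ltW z0)// gt_eqF// mulr_gt0.
  rewrite mulrC ler_pdivrMr// mulrAC.
  have : z * (N%:R `^ e * K + 1) = eta * eps / 4.
    by rewrite /z divfK// gt_eqF// ltr_wpDl// mulr_ge0 ?powR_ge0.
  lra.
have t3 : (e1^-1%:E * \int[mu]_x ((V x)^-1 * \1_(~` box M) x)%:E <= (eps / 4)%:E)%E.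
  apply: (@le_trans _ _ (e1^-1%:E * (e1 * (eps / 4))%:E)%E).
    by apply: lee_wpmul2l; rewrite // lee_fin invr_ge0 ltW.
  by rewrite -EFinM lee_fin mulKf// gt_eqF.
have t4 : e1 * K <= eps / 4.
  have : e1 * (K + 1) = eps / 4 by rewrite /e1 divfK// gt_eqF.
  lra.
apply: (@le_trans _ _ ((eps / 4)%:E + (eps / 4)%:E + ((eps / 4)%:E + (eps / 4)%:E))%E).
  by apply: leeD; apply: leeD; rewrite ?lee_fin.
by rewrite -!EFinD lee_fin; lra.
Qed.

End compactness.

(** * The space [spaceX] *)

Section power_functions.
Context {R : realType}.
Implicit Types a b x t e p r : R.

Lemma spow0 p : spow p 0 = 0 :> R.
Proof. by rewrite /spow mulr0. Qed.

(** The left side is |a|^(r-1) |b|, at most the r-th power of the larger of the two absolute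
    values. *)
Lemma norm_spow_mul_le r a b : 1 <= r ->
  `|spow r a * b| <= `|a| `^ r + `|b| `^ r.
Proof.
move=> r1; have r0 : 0 < r by lra.
have [->|an0] := eqVneq a 0; first by rewrite spow0 mul0r normr0 addr_ge0 ?powR_ge0.
have na : 0 < `|a| by rewrite normr_gt0.
have -> : `|spow r a * b| = `|a| `^ (r - 1) * `|b|.
  rewrite /spow !normrM (ger0_norm (powR_ge0 _ _)); congr (_ * _).
  rewrite -[X in _ * X](powRr1 (ltW na)) -powRD ?(gt_eqF na) ?implybT//.
  by congr (_ `^ _); ring.
have r10 : 0 <= r - 1 by lra.
have [ab|ab] := leP `|b| `|a|.
  apply: (@le_trans _ _ (`|a| `^ (r - 1) * `|a|)); first by rewrite ler_wpM2l ?powR_ge0.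
  by rewrite mulrC mulr_powRB1// lerDl powR_ge0.
apply: (@le_trans _ _ (`|b| `^ (r - 1) * `|b|)).
  by rewrite ler_wpM2r//; apply: ge0_ler_powR; rewrite ?nnegrE// ltW.
by rewrite mulrC mulr_powRB1// lerDr powR_ge0.
Qed.

Lemma powR_le_sum p t x : 1 <= p <= t -> 0 <= x -> x `^ p <= x + x `^ t.
Proof.
move=> /andP[p1 pt] x0.
have [x1|x1] := leP x 1.
  have [->|xn0] := eqVneq x 0; first by rewrite powR0 ?add0r ?powR_ge0// gt_eqF//; lra.
  apply: (@le_trans _ _ x); last by rewrite lerDl powR_ge0.
  by apply: ge1r_powR => //; rewrite lt_neqAle eq_sym xn0 x0.
apply: (@le_trans _ _ (x `^ t)); last by rewrite lerDr.
by apply: ler_powR => //; exact: ltW.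
Qed.

(** The threshold [M] satisfies M^(p-t) = eps: below it the linear term suffices, above it the power
    [t]. This is the domination required by [uniform_integrable_cvg]. *)
Lemma powR_le_weighted p t (eps : R) : 1 <= p < t -> 0 < eps ->
  exists2 C, 0 <= C & forall x, 0 <= x -> x `^ p <= C * x + eps * x `^ t.
Proof.
move=> /andP[p1 pt] eps0; have tp : 0 < t - p by lra.
pose M := eps `^ (- (t - p)^-1).
have M0 : 0 < M by rewrite powR_gt0.
exists (M `^ (p - 1)); first exact: powR_ge0.
move=> x x0; have [->|xn0] := eqVneq x 0.
  by rewrite mulr0 add0r !powR0 ?mulr0// gt_eqF//; lra.
have xg : 0 < x by rewrite lt_neqAle eq_sym xn0.
have [xM|Mx] := leP x M.
  apply: (@le_trans _ _ (M `^ (p - 1) * x)); last by rewrite lerDl mulr_ge0 ?powR_ge0// ltW.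
  rewrite -(mulr_powRB1 x0); last by lra.
  by rewrite mulrC ler_wpM2r//; apply: ge0_ler_powR; rewrite ?nnegrE ?(ltW M0)//; lra.
apply: (@le_trans _ _ (eps * x `^ t)); last by rewrite lerDr mulr_ge0 ?powR_ge0.
have -> : x `^ t = x `^ p * x `^ (t - p).
  by rewrite -powRD ?(gt_eqF xg) ?implybT// subrKC.
rewrite mulrCA ler_peMr ?powR_ge0// -ler_pdivrMl// mulr1.
have -> : eps^-1 = M `^ (t - p).
  by rewrite /M -powRrM mulNr mulVf ?gt_eqF// powR_inv1// ltW.
by apply: ge0_ler_powR; rewrite ?nnegrE ?(ltW M0)//; exact: ltW.
Qed.

(** Homogeneity reduces this to Bernoulli's inequality at |1 + b/a|. At [a = 0] the slope is 0,
    which is a subgradient even for [p = 1]. *)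
Lemma powR_norm_tangent p a b : 1 <= p ->
  `|a| `^ p + p * (spow p a * b) <= `|a + b| `^ p.
Proof.
move=> p1; have [->|a0] := eqVneq a 0.
  rewrite spow0 mul0r mulr0 addr0 add0r normr0 powR0 ?powR_ge0// gt_eqF//.
  exact: lt_le_trans p1.
have na : 0 < `|a| by rewrite normr_gt0.
have -> : `|a + b| `^ p = `|a| `^ p * `|1 + b / a| `^ p.
  by rewrite -powRM// -normrM mulrDr mulr1 mulrC divfK.
have -> : spow p a * b = `|a| `^ p * (b / a).
  rewrite /spow.
  have -> : `|a| `^ p = `|a| `^ (p - 2) * a ^+ 2.
    rewrite -(real_normK (num_real a)) -powR_mulrn// -powRD ?(gt_eqF na) ?implybT//.
    by rewrite subrK.
  by field.
rewrite mulrCA -[X in X + _]mulr1 -mulrDr ler_wpM2l ?powR_ge0//.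
have := powR_ge_tangent p1 (normr_ge0 (1 + b / a)).
apply: le_trans; rewrite lerD2l ler_wpM2l//; first by lra.
by have := ler_norm (1 + b / a); lra.
Qed.

(** The tangents at [a + e * b], taken with weights [1 - e] and [e], cancel their slopes. Keeping
    the weight 1 on |a|^p gives a base value plus a term linear in [e]. *)
Lemma powR_norm_convex p a b e : 1 <= p -> 0 <= e <= 1 ->
  `|a + e * b| `^ p <= `|a| `^ p + e * `|a + b| `^ p.
Proof.
move=> p1 /andP[e0 e1].
have h1 := powR_norm_tangent (a + e * b) (- (e * b)) p1.
have h2 := powR_norm_tangent (a + e * b) ((1 - e) * b) p1.
rewrite addrK in h1.
rewrite (_ : a + e * b + (1 - e) * b = a + b) in h2; last by ring.
have e1' : 0 <= 1 - e by lra.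
have := ler_wpM2l e1' h1; have := ler_wpM2l e0 h2.
have := powR_ge0 `|a| p; have := mulr_ge0 e0 (powR_ge0 `|a| p).
set S := spow _ _; set m := `|a + e * b| `^ p; set A := `|a| `^ p; lra.
Qed.

Lemma cvg_powR_norm (f : nat -> R) (l p : R) : 0 < p ->
  f n @[n --> \oo] --> l -> `|f n| `^ p @[n --> \oo] --> `|l| `^ p.
Proof.
move=> p0 /cvg_norm fl.
have [l0|l0] := eqVneq `|l| 0.
  rewrite l0 powR0 ?gt_eqF//; apply/cvgr0Pnorm_lt => e e0.
  have e1 : 0 < e `^ p^-1 by rewrite powR_gt0.
  near=> n; rewrite ger0_norm ?powR_ge0//.
  have -> : e = (e `^ p^-1) `^ p by rewrite -powRrM mulVf ?gt_eqF// powRr1// ltW.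
  apply: gt0_ltr_powR => //; rewrite ?nnegrE ?powR_ge0//.
  near: n; have := cvgr_lt _ fl; rewrite l0; exact.
have lg : 0 < `|l| by rewrite lt_neqAle eq_sym l0 normr_ge0.
have ck : {for `|l|, continuous ((@powR R)^~ p)}.
  have Hp := is_derive1_powR p lg.
  apply: differentiable_continuous; apply/derivable1_diffP.
  by apply: (@ex_derive _ _ _ _ _ _ _ Hp).
exact: (continuous_cvg _ ck fl).
Unshelve. all: by end_near.
Qed.

End power_functions.

(** * One component: the weighted space and its embeddings *)

Section weighted_space.
Context {R : realType} {N : nat}.
Local Notation T := 'rV[R]_N.
Local Notation mu := (leb N : {measure set 'rV[R]_N -> \bar R}).
Local Notation mu2 := (leb N \x leb N)%E.
Variables (s V0 : R) (V : T -> R).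
Hypotheses (s0 : 0 < s) (V00 : 0 < V0) (hV : forall x, V0 <= V x).
Hypothesis (iV : mu.-integrable setT (fun x => ((V x)^-1)%:E)).
Local Notation e := (N%:R + 2 * s).
Local Notation W := (weightedHs s V).
Implicit Types u f : T -> R.

Let mV : measurable_fun setT V. Proof. exact: measurable_V hV iV. Qed.
Let V_gt0 x : 0 < V x. Proof. exact: lt_le_trans (hV x). Qed.

Lemma measurable_Vsqr u : measurable_fun setT u ->
  measurable_fun setT (fun x => V x * u x ^+ 2).
Proof. by move=> mU; apply: measurable_funM => //; exact: measurable_funX. Qed.

(** Square integrability is absorbed by the weighted integral, since u^2 <= V u^2 / V0. *)
Lemma weightedHsP u : W u <-> [/\ measurable_fun setT u,
  (gagliardo2 s u < +oo)%E & (\int[mu]_x (V x * u x ^+ 2)%:E < +oo)%E].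
Proof.
split=> [[[+ gu] Vu]|[mU gu Vu]].
  by rewrite inE => /andP[/[!inE]/= mU _].
split=> //; split=> //; rewrite inE; apply/andP; split; rewrite inE//=.
rewrite /finite_norm unlock; apply: poweR_lty.
apply: (@le_lt_trans _ _ (V0^-1%:E * \int[mu]_x (V x * u x ^+ 2)%:E)%E); last first.
  by rewrite lte_mul_pinfty// lee_fin invr_ge0 ltW.
rewrite -ge0_integralZl_EFin; [|by []|by move=> x _; rewrite lee_fin mulr_ge0 ?sqr_ge0// ltW|by apply/measurable_EFinP; exact: measurable_Vsqr|by rewrite invr_ge0 ltW].
have -> : (\int[mu]_x `|(EFin \o u) x| `^ 2 = \int[mu]_x (u x ^+ 2)%:E)%E.
  by apply: eq_integral => x _; rewrite /= powR_mulrn// real_normK ?num_real.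
apply: ge0_le_integralE; first exact: measurable_funX.
  by apply: measurable_funM => //; exact: measurable_Vsqr.
move=> x; rewrite sqr_ge0/= mulrA ler_peMl ?sqr_ge0//.
by rewrite mulrC ler_pdivlMr// mul1r.
Qed.

Lemma weightedHs_measurable u : W u -> measurable_fun setT u.
Proof. by move=> /weightedHsP[]. Qed.

Lemma integrable_Vsqr u : W u -> mu.-integrable setT (EFin \o (fun x => V x * u x ^+ 2)).
Proof.
move=> /weightedHsP[mU _ Vu]; apply: ge0_integrable_lty => //; first exact: measurable_Vsqr.
by move=> x; rewrite mulr_ge0 ?sqr_ge0// ltW.
Qed.

Lemma integrable_gquot u : W u -> mu2.-integrable setT (EFin \o gquot s u).
Proof.
move=> /weightedHsP[mU gu _]; apply: ge0_integrable_lty => //; first exact: measurable_gquot.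
by move=> z; exact: gquot_ge0.
Qed.

Lemma integrable_Vmul u f : W u -> W f ->
  mu.-integrable setT (EFin \o (fun x => V x * u x * f x)).
Proof.
move=> Wu Wf; apply: (@integrable_le _ _ _ _ _ (fun x => V x * u x ^+ 2 + V x * f x ^+ 2)).
- have mU := weightedHs_measurable Wu; have mf := weightedHs_measurable Wf.
  by apply: measurable_funM => //; exact: measurable_funM.
- move=> x; rewrite !normrM (gtr0_norm (V_gt0 x)) -mulrA -mulrDr ler_wpM2l ?(ltW (V_gt0 x))//.
  rewrite -[u x ^+ 2](real_normK (num_real _)) -[f x ^+ 2](real_normK (num_real _)).
  have := sqr_ge0 (`|u x| - `|f x|); have := mulr_ge0 (normr_ge0 (u x)) (normr_ge0 (f x)); lra.
- exact: (integrableD measurableT (integrable_Vsqr Wu) (integrable_Vsqr Wf)).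
Qed.

Definition gcross u f (z : T * T) : R :=
  (u z.1 - u z.2) * (f z.1 - f z.2) / enorm (z.1 - z.2) `^ e.

Lemma integrable_gcross u f : W u -> W f ->
  mu2.-integrable setT (EFin \o gcross u f).
Proof.
move=> Wu Wf; apply: (@integrable_le _ _ _ _ _ (fun z => gquot s u z + gquot s f z)).
- have mU := weightedHs_measurable Wu; have mf := weightedHs_measurable Wf.
  apply: measurable_funM; last exact: measurable_enorm_powN.
  by apply: measurable_funM; exact: measurable_sub2.
- move=> z; have i0 : 0 <= (enorm (z.1 - z.2) `^ e)^-1 by rewrite invr_ge0 powR_ge0.
  rewrite /gcross /gquot !normrM (ger0_norm i0) -mulrDl ler_wpM2r//.
  set a := u z.1 - _; set b := f z.1 - _.
  rewrite -[a ^+ 2](real_normK (num_real _)) -[b ^+ 2](real_normK (num_real _)).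
  have := sqr_ge0 (`|a| - `|b|); have := mulr_ge0 (normr_ge0 a) (normr_ge0 b); lra.
- exact: (integrableD measurableT (integrable_gquot Wu) (integrable_gquot Wf)).
Qed.

Lemma fine_gagliardo2 u : fine (gagliardo2 s u) = \int[mu2]_z gquot s u z.
Proof. by []. Qed.

Lemma gagliardo2_comb (a b : R) u f : W u -> W f ->
  mu2.-integrable setT (EFin \o gquot s (fun x => a * u x + b * f x)) /\
  fine (gagliardo2 s (fun x => a * u x + b * f x)) =
  a ^+ 2 * fine (gagliardo2 s u) + 2 * a * b * gagliardo_form s u f
  + b ^+ 2 * fine (gagliardo2 s f).
Proof.
move=> Wu Wf; have i1 := integrable_gquot Wu; have i2 := integrable_gquot Wf.
have i12 := integrable_gcross Wu Wf.
have gE : gquot s (fun x => a * u x + b * f x) = fun z =>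
    (a ^+ 2 * gquot s u z + 2 * a * b * gcross u f z) + b ^+ 2 * gquot s f z.
  by apply/funext => z; rewrite /gquot /gcross; ring.
have j1 := integrableZl measurableT (a ^+ 2) i1.
have j2 := integrableZl measurableT (b ^+ 2) i2.
have j12 := integrableZl measurableT (2 * a * b) i12.
have j := integrableD measurableT j1 j12.
split; first by rewrite gE; exact: (integrableD measurableT j j2).
rewrite !fine_gagliardo2 gE RintegralD// RintegralD// !RintegralZl//.
Qed.

Lemma Vsqr_comb (a b : R) u f : W u -> W f ->
  mu.-integrable setT (EFin \o (fun x => V x * (a * u x + b * f x) ^+ 2)) /\
  \int[mu]_x (V x * (a * u x + b * f x) ^+ 2) =
  a ^+ 2 * \int[mu]_x (V x * u x ^+ 2) + 2 * a * b * \int[mu]_x (V x * u x * f x)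
  + b ^+ 2 * \int[mu]_x (V x * f x ^+ 2).
Proof.
move=> Wu Wf; have i1 := integrable_Vsqr Wu; have i2 := integrable_Vsqr Wf.
have i12 := integrable_Vmul Wu Wf.
have gE : (fun x => V x * (a * u x + b * f x) ^+ 2) = fun x =>
    (a ^+ 2 * (V x * u x ^+ 2) + 2 * a * b * (V x * u x * f x)) + b ^+ 2 * (V x * f x ^+ 2).
  by apply/funext => x; ring.
have j1 := integrableZl measurableT (a ^+ 2) i1.
have j2 := integrableZl measurableT (b ^+ 2) i2.
have j12 := integrableZl measurableT (2 * a * b) i12.
have j := integrableD measurableT j1 j12.
split; first by rewrite gE; exact: (integrableD measurableT j j2).
by rewrite gE RintegralD// RintegralD// !RintegralZl.
Qed.

Lemma weightedHs_comb (a b : R) u f : W u -> W f -> W (fun x => a * u x + b * f x).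
Proof.
move=> Wu Wf; apply/weightedHsP; split.
- have mU := weightedHs_measurable Wu; have mf := weightedHs_measurable Wf.
  by apply: measurable_funD; exact: measurable_funM.
- have [ig _] := gagliardo2_comb a b Wu Wf.
  by apply: (@integrable_lty_ge0 _ _ _ mu2 _ _ ig) => z; exact: gquot_ge0.
- have [iv _] := Vsqr_comb a b Wu Wf.
  by apply: (integrable_lty_ge0 _ iv) => x; rewrite mulr_ge0 ?sqr_ge0// ltW.
Qed.

Lemma weightedHs0 : W (fun _ => 0).
Proof.
apply/weightedHsP; split => //.
- rewrite /gagliardo2 (_ : (fun z => _) = cst 0%E) ?integral0 ?ltry//.
  by apply/funext => z; rewrite subrr expr0n mul0r.
- rewrite (_ : (fun z => _) = cst 0%E) ?integral0 ?ltry//.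
  by apply/funext => z; rewrite expr0n mulr0.
Qed.

Definition wnorm2 u : R := fine (gagliardo2 s u) + \int[mu]_x (V x * u x ^+ 2).

Lemma gagliardo2_ge0 u : (0 <= gagliardo2 s u)%E.
Proof. by apply: integral_ge0 => z _; rewrite lee_fin; exact: gquot_ge0. Qed.

Lemma wnorm2_ge0 u : 0 <= wnorm2 u.
Proof.
apply: addr_ge0; first by rewrite fine_ge0// gagliardo2_ge0.
by apply: Rintegral_ge0 => x _; rewrite mulr_ge0 ?sqr_ge0// ltW.
Qed.

(** The factor [1 + V0^-1] covers at once the L^2 bound K / V0 and the two bounds by [K]. *)
Lemma wnorm2_bounded (K : R) u : W u -> wnorm2 u <= K ->
  bounded_Hs s V (K * (1 + V0^-1)) u.
Proof.
move=> Wu uK; have /weightedHsP[mU gu Vu] := Wu.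
have g0 : 0 <= fine (gagliardo2 s u) by rewrite fine_ge0// gagliardo2_ge0.
have v0 : 0 <= \int[mu]_x (V x * u x ^+ 2).
  by apply: Rintegral_ge0 => x _; rewrite mulr_ge0 ?sqr_ge0// ltW.
have K0 : 0 <= K by apply: le_trans uK; exact: wnorm2_ge0.
have iV0 : 0 <= V0^-1 by rewrite invr_ge0 ltW.
have KV : 0 <= K * V0^-1 by rewrite mulr_ge0.
have VK : (\int[mu]_x (V x * u x ^+ 2)%:E <= K%:E)%E.
  rewrite -EFin_Rintegral; last exact: integrable_Vsqr.
  by rewrite lee_fin; move: uK; rewrite /wnorm2; lra.
split=> //.
- apply: (@le_trans _ _ (V0^-1%:E * \int[mu]_x (V x * u x ^+ 2)%:E)%E).
    rewrite -ge0_integralZl_EFin; [|by []|by move=> x _; rewrite lee_fin mulr_ge0 ?sqr_ge0// ltW|by apply/measurable_EFinP; exact: measurable_Vsqr|exact: iV0].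
    apply: ge0_le_integralE; first exact: measurable_funX.
      by apply: measurable_funM => //; exact: measurable_Vsqr.
    move=> x; rewrite sqr_ge0/= mulrA ler_peMl ?sqr_ge0//.
    by rewrite mulrC ler_pdivlMr// mul1r.
  apply: (@le_trans _ _ (V0^-1%:E * K%:E)%E); first by apply: lee_wpmul2l; rewrite ?lee_fin.
  by rewrite -EFinM lee_fin; lra.
- rewrite -[leLHS]fineK ?ge0_fin_numE ?gagliardo2_ge0// lee_fin.
  by move: uK; rewrite /wnorm2; lra.
- by apply: (le_trans VK); rewrite lee_fin; lra.
Qed.

Lemma L1_bound (K : R) u : bounded_Hs s V K u ->
  (\int[mu]_x (`|u x|)%:E <= (\int[mu]_x (V x)^-1 + K)%:E)%E.
Proof.
move=> [mU _ _ VK].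
have iVR : mu.-integrable setT (EFin \o (fun x => (V x)^-1)) by [].
have mVi : measurable_fun setT (fun x => (V x)^-1) by exact: measurable_Vinv iV.
have Vi0 x : 0 <= (V x)^-1 by rewrite invr_ge0 ltW.
rewrite EFinD (EFin_Rintegral iVR).
apply: (@le_trans _ _ (\int[mu]_x ((V x)^-1)%:E + \int[mu]_x (V x * u x ^+ 2)%:E)%E).
  rewrite -ge0_integralD//; last 4 first.
  - by move=> x _; rewrite lee_fin.
  - exact/measurable_EFinP.
  - by move=> x _; rewrite lee_fin mulr_ge0 ?sqr_ge0// ltW.
  - by apply/measurable_EFinP; exact: measurable_Vsqr.
  apply: ge0_le_integral => //.
  - apply/measurable_EFinP; exact: (measurableT_comp (@normr_measurable R setT)).
  - by apply: emeasurable_funD; apply/measurable_EFinP => //; exact: measurable_Vsqr.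
  - move=> x _; rewrite -EFinD lee_fin.
    have := norm_le_weight (u x) (@ltr01 R) (V_gt0 x).
    have : 0 <= V x * u x ^+ 2 by rewrite mulr_ge0 ?sqr_ge0// ltW.
    by have := Vi0 x; rewrite invr1 mul1r; lra.
by apply: leeD.
Qed.

Variable t : R.
Hypotheses (hN : 2 * s < N%:R) (t2 : 2 < t) (ht : t < sobolev_exponent N s).

(** A common majorant of all powers with exponent between 1 and [t]: the first term is integrable
    thanks to 1/V, the second by the Sobolev inequality. *)
Definition powt u x : R := `|u x| + `|u x| `^ t.

Lemma measurable_normpow (p : R) u : measurable_fun setT u ->
  measurable_fun setT (fun x => `|u x| `^ p).
Proof.
move=> mU; apply: (measurableT_comp (measurable_powR _)).
exact: (measurableT_comp (@normr_measurable R setT)).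
Qed.

Lemma measurable_norm_fun u : measurable_fun setT u ->
  measurable_fun setT (fun x => `|u x|).
Proof. by move=> mU; exact: (measurableT_comp (@normr_measurable R setT)). Qed.

Lemma powt_bound (K : R) : 0 <= K -> exists B : R, forall u, bounded_Hs s V K u ->
  (\int[mu]_x (powt u x)%:E <= B%:E)%E.
Proof.
move=> K0; have [B HB] := sobolev_bound s0 hN t2 ht K0.
exists (\int[mu]_x (V x)^-1 + K + B) => u bu; have [mU u2 gu _] := bu.
rewrite /powt; under eq_integral do rewrite EFinD.
rewrite ge0_integralD//; [|by apply/measurable_EFinP; exact: measurable_norm_fun|by apply/measurable_EFinP; exact: measurable_normpow].
by rewrite EFinD; apply: leeD; [exact: L1_bound|exact: HB].
Qed.

Lemma integrable_powt u : W u -> mu.-integrable setT (EFin \o powt u).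
Proof.
move=> Wu; have /weightedHsP[mU _ _] := Wu.
have K0 : 0 <= wnorm2 u * (1 + V0^-1).
  by rewrite mulr_ge0 ?wnorm2_ge0// addr_ge0// invr_ge0 ltW.
have [B HB] := powt_bound K0.
apply: ge0_integrable_lty.
- by apply: measurable_funD; [exact: measurable_norm_fun|exact: measurable_normpow].
- by move=> x; rewrite addr_ge0// powR_ge0.
- by apply: le_lt_trans (HB _ (wnorm2_bounded Wu (lexx _))) _; rewrite ltry.
Qed.

Lemma integrable_normpow (p : R) u : 1 <= p <= t -> W u ->
  mu.-integrable setT (EFin \o (fun x => `|u x| `^ p)).
Proof.
move=> hp Wu; apply: integrable_le (integrable_powt Wu).
  by apply: measurable_normpow; exact: weightedHs_measurable Wu.
by move=> x; rewrite ger0_norm ?powR_ge0//; exact: powR_le_sum.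
Qed.

Lemma measurable_spow (p : R) u : measurable_fun setT u ->
  measurable_fun setT (fun x => spow p (u x)).
Proof. by move=> mU; apply: measurable_funM => //; exact: measurable_normpow. Qed.

Lemma integrable_spow (p : R) u f : 1 <= p <= t -> W u -> W f ->
  mu.-integrable setT (EFin \o (fun x => spow p (u x) * f x)).
Proof.
move=> hp Wu Wf.
apply: (@integrable_le _ _ _ _ _ (fun x => powt u x + powt f x)).
- have mU := weightedHs_measurable Wu; have mf := weightedHs_measurable Wf.
  by apply: measurable_funM => //; exact: measurable_spow.
- have /andP[p1 _] := hp; move=> x; apply: le_trans (norm_spow_mul_le _ _ p1) _.
  by apply: lerD; exact: powR_le_sum.
- exact: (integrableD measurableT (integrable_powt Wu) (integrable_powt Wf)).
Qed.

End weighted_space.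

Section Lnorm_pow_integral.
Context {R : realType} {N : nat}.
Local Notation mu := (leb N : {measure set 'rV[R]_N -> \bar R}).

Lemma Lnorm_powE (p : R) (u : 'rV[R]_N -> R) : p != 0 ->
  Lnorm_pow p u = \int[mu]_x (`|u x| `^ p).
Proof. by move=> p0; rewrite /Lnorm_pow -fine_poweR powR_Lnorm. Qed.

End Lnorm_pow_integral.

(** * Pairs of functions: scaling, perturbation and compactness *)

Section product_space.
Context {R : realType} {N : nat}.
Local Notation T := 'rV[R]_N.
Local Notation mu := (leb N : {measure set 'rV[R]_N -> \bar R}).
Local Notation mu2 := (leb N \x leb N)%E.

(* [t] is any exponent strictly between [alpha + beta] and the critical one. *)
Variables (s V0 : R) (V1 V2 : T -> R) (alpha beta p q t : R).
Hypotheses (s0 : 0 < s) (hN : 2 * s < N%:R) (V00 : 0 < V0).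
Hypotheses (hV1 : forall x, V0 <= V1 x) (hV2 : forall x, V0 <= V2 x).
Hypothesis (iV1 : mu.-integrable setT (fun x => ((V1 x)^-1)%:E)).
Hypothesis (iV2 : mu.-integrable setT (fun x => ((V2 x)^-1)%:E)).
Hypotheses (ha : 1 < alpha) (hb : 1 < beta) (hp : 1 <= p) (hpq : p <= q) (hq : q < 2).
Hypotheses (hab : 2 < alpha + beta) (habt : alpha + beta < t).
Hypothesis (ht : t < sobolev_exponent N s).
Let t2 : 2 < t. Proof. exact: lt_trans habt. Qed.
Let p0 : 0 < p. Proof. exact: lt_le_trans hp. Qed.
Let q0 : 0 < q. Proof. exact: lt_le_trans hpq. Qed.
Let pt : 1 <= p <= t. Proof. by move: hp hpq hq t2; lra. Qed.
Let qt : 1 <= q <= t. Proof. by move: hp hpq hq t2; lra. Qed.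
Let gt' : 1 <= alpha + beta < t. Proof. by move: hab habt; lra. Qed.

Local Notation W1 := (weightedHs s V1).
Local Notation W2 := (weightedHs s V2).
Local Notation X := (spaceX s V1 V2).
Local Notation A := (sqnormX s V1 V2).
Local Notation C := (coupling alpha beta).

Let iVs1 := @integrable_Vsqr R N s V0 V1 V00 hV1 iV1.
Let iVs2 := @integrable_Vsqr R N s V0 V2 V00 hV2 iV2.
Let ipt1 := @integrable_powt R N s V0 V1 s0 V00 hV1 iV1 t hN t2 ht.
Let ipt2 := @integrable_powt R N s V0 V2 s0 V00 hV2 iV2 t hN t2 ht.
Let iN1 := @integrable_normpow R N s V0 V1 s0 V00 hV1 iV1 t hN t2 ht.
Let iN2 := @integrable_normpow R N s V0 V2 s0 V00 hV2 iV2 t hN t2 ht.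

Lemma sqnormXE w : X w -> A w = wnorm2 s V1 w.1 + wnorm2 s V2 w.2.
Proof.
move=> [Wu Wv]; rewrite /sqnormX /wnorm2 RintegralD//; last 2 first.
- exact: iVs1.
- exact: iVs2.
by rewrite addrACA.
Qed.

Lemma sqnormX_ge0 w : X w -> 0 <= A w.
Proof.
move=> Xw; rewrite sqnormXE//; apply: addr_ge0.
  exact: wnorm2_ge0 V00 hV1 _.
exact: wnorm2_ge0 V00 hV2 _.
Qed.

Lemma weightedHs_scale V c u : (forall x, V0 <= V x) ->
  mu.-integrable setT (fun x => ((V x)^-1)%:E) -> weightedHs s V u ->
  weightedHs s V (fun x => c * u x).
Proof.
move=> hV iV Wu; have := weightedHs_comb V00 hV iV c 0 Wu Wu.
by under eq_fun do rewrite mul0r addr0.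
Qed.

Lemma wnorm2_scale V c u : (forall x, V0 <= V x) ->
  mu.-integrable setT (fun x => ((V x)^-1)%:E) -> weightedHs s V u ->
  wnorm2 s V (fun x => c * u x) = c ^+ 2 * wnorm2 s V u.
Proof.
move=> hV iV Wu; rewrite /wnorm2.
have [_ ] := gagliardo2_comb V00 hV iV c 0 Wu Wu.
have [_ ] := Vsqr_comb V00 hV iV c 0 Wu Wu.
under eq_Rintegral do rewrite mul0r addr0.
under [X in gagliardo2 s X]eq_fun do rewrite mul0r addr0.
by move=> -> ->; ring.
Qed.

Lemma spaceX_scale c w : X w -> X (scale c w).
Proof. by move=> [Wu Wv]; split; exact: weightedHs_scale. Qed.

Lemma sqnormX_scale c w : X w -> A (scale c w) = A w * c ^+ 2.
Proof.
move=> Xw; rewrite !sqnormXE//; last exact: spaceX_scale.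
by case: Xw => Wu Wv; rewrite /scale/= !wnorm2_scale// -mulrDr mulrC.
Qed.

Lemma Rintegral_normpow_scale (r c : R) (u : T -> R) : 0 < c ->
  mu.-integrable setT (EFin \o (fun x => `|u x| `^ r)) ->
  \int[mu]_x (`|c * u x| `^ r) = \int[mu]_x (`|u x| `^ r) * c `^ r.
Proof.
move=> c0 iu; rewrite mulrC -RintegralZl//; apply: eq_Rintegral => x _.
by rewrite normrM powRM// gtr0_norm.
Qed.

Lemma Lnorm_pow1_scale c w : 0 < c -> X w ->
  Lnorm_pow p (scale c w).1 = Lnorm_pow p w.1 * c `^ p.
Proof.
move=> c0 [Wu _]; rewrite !Lnorm_powE ?gt_eqF//; apply: Rintegral_normpow_scale => //.
exact: iN1.
Qed.

Lemma Lnorm_pow2_scale c w : 0 < c -> X w ->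
  Lnorm_pow q (scale c w).2 = Lnorm_pow q w.2 * c `^ q.
Proof.
move=> c0 [_ Wv]; rewrite !Lnorm_powE ?gt_eqF//; apply: Rintegral_normpow_scale => //.
exact: iN2.
Qed.

Lemma Lnorm_pow_ge0 (r : R) (u : T -> R) : 0 <= Lnorm_pow r u.
Proof. exact: powR_ge0. Qed.

Definition cdens (u v : T -> R) x : R := `|u x| `^ alpha * `|v x| `^ beta.

Lemma cdens_ge0 u v x : 0 <= cdens u v x.
Proof. by rewrite mulr_ge0 ?powR_ge0. Qed.

Lemma measurable_cdens u v : measurable_fun setT u -> measurable_fun setT v ->
  measurable_fun setT (cdens u v).
Proof. by move=> mU mv; apply: measurable_funM; exact: measurable_normpow. Qed.

Lemma cdens_le_max (a b : R) : 0 <= a -> 0 <= b ->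
  a `^ alpha * b `^ beta <= Num.max a b `^ (alpha + beta).
Proof.
move=> a0 b0; have m0 : 0 <= Num.max a b by rewrite le_max a0.
have [ma mb] : a <= Num.max a b /\ b <= Num.max a b by rewrite !le_max !lexx orbT.
have a1 : alpha != 0 by rewrite gt_eqF//; move: ha; lra.
rewrite powRD; last by rewrite (gt_eqF (_ : 0 < alpha + beta)) ?implybF//; move: hab; lra.
by apply: ler_pM; rewrite ?powR_ge0//; apply: ge0_ler_powR;
  rewrite ?nnegrE//; [move: ha|move: hb]; lra.
Qed.

Lemma cdens_le u v x : cdens u v x <= powt t u x + powt t v x.
Proof.
apply: le_trans (cdens_le_max (normr_ge0 _) (normr_ge0 _)) _.
have gt1 : 1 <= alpha + beta <= t by move: gt'; lra.
have h y : powt t u y + powt t v y = powt t v y + powt t u y by rewrite addrC.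
have P0 (f : T -> R) y : 0 <= powt t f y by rewrite addr_ge0 ?powR_ge0.
have [uv|uv] := leP `|u x| `|v x|.
  by apply: le_trans (powR_le_sum gt1 (normr_ge0 _)) _; rewrite lerDr P0.
by apply: le_trans (powR_le_sum gt1 (normr_ge0 _)) _; rewrite lerDl P0.
Qed.

Lemma integrable_cdens w : X w -> mu.-integrable setT (EFin \o cdens w.1 w.2).
Proof.
move=> [Wu Wv]; apply: (@integrable_le _ _ _ _ _ (fun x => powt t w.1 x + powt t w.2 x)).
- by apply: measurable_cdens; [exact: (weightedHs_measurable V00 hV1 iV1 Wu)|exact: (weightedHs_measurable V00 hV2 iV2 Wv)].
- by move=> x; rewrite ger0_norm ?cdens_ge0// cdens_le.
- exact: (integrableD measurableT (ipt1 Wu) (ipt2 Wv)).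
Qed.

Lemma coupling_ge0 (w : (T -> R) * (T -> R)) : 0 <= C w.
Proof. by apply: Rintegral_ge0 => x _; exact: cdens_ge0. Qed.

Lemma coupling_scale c w : 0 < c -> X w -> C (scale c w) = C w * c `^ (alpha + beta).
Proof.
move=> c0 Xw; rewrite mulrC -RintegralZl//; last exact: integrable_cdens.
apply: eq_Rintegral => x _; rewrite /scale/= !normrM !powRM// gtr0_norm//.
rewrite powRD; first by rewrite mulrACA.
by rewrite (gt_eqF c0) implybT.
Qed.

Lemma ball_bound_X : exists B : R, forall w, X w -> A w <= 1 ->
  [/\ Lnorm_pow p w.1 <= B, Lnorm_pow q w.2 <= B & C w <= B].
Proof.
have K0 : 0 <= 1 * (1 + V0^-1) :> R by rewrite mul1r addr_ge0// invr_ge0 ltW.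
have [B1 HB1] := powt_bound s0 V00 hV1 iV1 hN t2 ht K0.
have [B2 HB2] := powt_bound s0 V00 hV2 iV2 hN t2 ht K0.
have lem (x y : R) : x <= B1 -> y <= B2 ->
    [/\ x <= `|B1| + `|B2|, y <= `|B1| + `|B2| & x + y <= `|B1| + `|B2|].
  have := ler_norm B1; have := ler_norm B2.
  by have := normr_ge0 B1; have := normr_ge0 B2; split; lra.
exists (`|B1| + `|B2|) => w Xw; rewrite sqnormXE// => A1; have [Wu Wv] := Xw.
have u1 : wnorm2 s V1 w.1 <= 1.
  by apply: le_trans A1; rewrite lerDl; exact: wnorm2_ge0 V00 hV2 _.
have v1 : wnorm2 s V2 w.2 <= 1.
  by apply: le_trans A1; rewrite lerDr; exact: wnorm2_ge0 V00 hV1 _.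
have := HB1 _ (wnorm2_bounded V00 hV1 iV1 Wu u1); rewrite -EFin_Rintegral ?lee_fin; last exact: ipt1.
have := HB2 _ (wnorm2_bounded V00 hV2 iV2 Wv v1); rewrite -EFin_Rintegral ?lee_fin; last exact: ipt2.
move=> b2 b1; have [b3 b4 b5] := lem _ _ b1 b2; split.
- rewrite Lnorm_powE ?gt_eqF//; apply: le_trans b3.
  apply: le_Rintegral => //; [exact: iN1|exact: ipt1|].
  by move=> x _; exact: powR_le_sum.
- rewrite Lnorm_powE ?gt_eqF//; apply: le_trans b4.
  apply: le_Rintegral => //; [exact: iN2|exact: ipt2|].
  by move=> x _; exact: powR_le_sum.
- apply: le_trans b5; rewrite -RintegralD//; [|exact: ipt1|exact: ipt2].
  apply: le_Rintegral => //; [exact: integrable_cdens| |by move=> x _; exact: cdens_le].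
  exact: (integrableD measurableT (ipt1 Wu) (ipt2 Wv)).
Qed.

Definition addX (w f : (T -> R) * (T -> R)) (e : R) : (T -> R) * (T -> R) :=
  ((fun x => w.1 x + e * f.1 x), (fun x => w.2 x + e * f.2 x)).

Lemma weightedHs_add V e u f : (forall x, V0 <= V x) ->
  mu.-integrable setT (fun x => ((V x)^-1)%:E) -> weightedHs s V u -> weightedHs s V f ->
  weightedHs s V (fun x => u x + e * f x).
Proof.
move=> hV iV Wu Wf; have := weightedHs_comb V00 hV iV 1 e Wu Wf.
by under eq_fun do rewrite mul1r.
Qed.

Lemma wnorm2_add V e u f : (forall x, V0 <= V x) ->
  mu.-integrable setT (fun x => ((V x)^-1)%:E) -> weightedHs s V u -> weightedHs s V f ->
  wnorm2 s V (fun x => u x + e * f x) = wnorm2 s V u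
  + 2 * e * (gagliardo_form s u f + \int[mu]_x (V x * u x * f x)) + e ^+ 2 * wnorm2 s V f.
Proof.
move=> hV iV Wu Wf; rewrite /wnorm2.
have [_ ] := gagliardo2_comb V00 hV iV 1 e Wu Wf.
have [_ ] := Vsqr_comb V00 hV iV 1 e Wu Wf.
under eq_Rintegral do rewrite mul1r.
under [X in gagliardo2 s X]eq_fun do rewrite mul1r.
by move=> -> ->; ring.
Qed.

Lemma spaceX_add w f e : X w -> X f -> X (addX w f e).
Proof. by move=> [Wu Wv] [Wf Wg]; split; exact: weightedHs_add. Qed.

Lemma innerXE w f : X w -> X f -> innerX s V1 V2 w f =
  (gagliardo_form s w.1 f.1 + \int[mu]_x (V1 x * w.1 x * f.1 x))
  + (gagliardo_form s w.2 f.2 + \int[mu]_x (V2 x * w.2 x * f.2 x)).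
Proof.
move=> [Wu Wv] [Wf Wg]; rewrite /innerX RintegralD//; last 2 first.
- exact: (integrable_Vmul V00 hV1 iV1 Wu Wf).
- exact: (integrable_Vmul V00 hV2 iV2 Wv Wg).
by rewrite addrACA.
Qed.

Lemma sqnormX_add w f e : X w -> X f ->
  A (addX w f e) = A w + 2 * e * innerX s V1 V2 w f + e ^+ 2 * A f.
Proof.
move=> Xw Xf; rewrite !sqnormXE//; last exact: spaceX_add.
rewrite innerXE//; case: Xw Xf => [Wu Wv] [Wf Wg].
by rewrite /addX/= !wnorm2_add//; ring.
Qed.

(** The weight [m] is 1 for the Lebesgue norms and a power of the other component for the coupling.
    The lower bound supplies the first variation; the upper one only controls the size of the
    perturbation. *)
Lemma weighted_add_bounds (r e : R) (u f m : T -> R) : 1 <= r -> 0 < e <= 1 ->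
  (forall x, 0 <= m x) ->
  mu.-integrable setT (EFin \o (fun x => `|u x| `^ r * m x)) ->
  mu.-integrable setT (EFin \o (fun x => spow r (u x) * f x * m x)) ->
  mu.-integrable setT (EFin \o (fun x => `|u x + 1 * f x| `^ r * m x)) ->
  mu.-integrable setT (EFin \o (fun x => `|u x + e * f x| `^ r * m x)) ->
  \int[mu]_x (`|u x| `^ r * m x) + e * (r * \int[mu]_x (spow r (u x) * f x * m x)) <=
  \int[mu]_x (`|u x + e * f x| `^ r * m x) <=
  \int[mu]_x (`|u x| `^ r * m x) + e * \int[mu]_x (`|u x + 1 * f x| `^ r * m x).
Proof.
move=> r1 /andP[e0 e1] m0 iu is1 i1 ie; apply/andP; split.
  have j := integrableZl measurableT (e * r) is1.
  rewrite mulrA -RintegralZl// -RintegralD//.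
  apply: le_Rintegral => //; first exact: (integrableD measurableT iu j).
  move=> x _ /=; rewrite mulrA -mulrDl ler_wpM2r//.
  have := powR_norm_tangent (u x) (e * f x) r1.
  by rewrite (_ : r * _ = e * r * (spow r (u x) * f x))//; ring.
have j := integrableZl measurableT e i1.
rewrite -RintegralZl// -RintegralD//.
apply: le_Rintegral => //; first exact: (integrableD measurableT iu j).
move=> x _ /=; rewrite mulrA -mulrDl ler_wpM2r// mul1r.
by apply: powR_norm_convex => //; rewrite ltW.
Qed.

Lemma Lnorm_pow_add_bounds V (r e : R) u f : (forall x, V0 <= V x) ->
  mu.-integrable setT (fun x => ((V x)^-1)%:E) -> 1 <= r <= t -> 0 < e <= 1 ->
  weightedHs s V u -> weightedHs s V f ->
  Lnorm_pow r u + e * (r * \int[mu]_x (spow r (u x) * f x)) <=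
  Lnorm_pow r (fun x => u x + e * f x) <=
  Lnorm_pow r u + e * Lnorm_pow r (fun x => u x + 1 * f x).
Proof.
move=> hV iV rt e01 Wu Wf; have r1 : 1 <= r by case/andP: rt.
have r0 : 0 < r := lt_le_trans ltr01 r1.
have m1 (h : T -> R) : (fun x => h x * (fun=> 1) x) = h by apply/funext => x; rewrite mulr1.
have iN c := integrable_normpow s0 V00 hV iV hN t2 ht rt (weightedHs_add c hV iV Wu Wf).
have := @weighted_add_bounds r e u f (fun=> 1) r1 e01 (fun=> ler01).
rewrite !m1 -!Lnorm_powE ?gt_eqF//.
apply; [|exact: (integrable_spow s0 V00 hV iV hN t2 ht rt Wu Wf)|exact: iN|exact: iN].
exact: (integrable_normpow s0 V00 hV iV hN t2 ht rt Wu).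
Qed.

Lemma integrable_cdens_spow1 w f : X w -> W1 f ->
  mu.-integrable setT (EFin \o (fun x => spow alpha (w.1 x) * f x * `|w.2 x| `^ beta)).
Proof.
move=> [Wu Wv] Wf.
apply: (@integrable_le _ _ _ _ _ (fun x => cdens w.1 w.2 x + cdens f w.2 x)).
- apply: measurable_funM; last by apply: measurable_normpow; exact: (weightedHs_measurable V00 hV2 iV2 Wv).
  apply: measurable_funM; last exact: (weightedHs_measurable V00 hV1 iV1 Wf).
  by apply: measurable_spow; exact: (weightedHs_measurable V00 hV1 iV1 Wu).
- move=> x; rewrite /cdens -mulrDl normrM (ger0_norm (powR_ge0 _ _)) ler_wpM2r ?powR_ge0//.
  exact/norm_spow_mul_le/ltW.
- exact: (integrableD measurableT (@integrable_cdens (w.1, w.2) (conj Wu Wv))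
    (@integrable_cdens (f, w.2) (conj Wf Wv))).
Qed.

Lemma integrable_cdens_spow2 w f : X w -> W2 f ->
  mu.-integrable setT (EFin \o (fun x => spow beta (w.2 x) * f x * `|w.1 x| `^ alpha)).
Proof.
move=> [Wu Wv] Wf.
apply: (@integrable_le _ _ _ _ _ (fun x => cdens w.1 w.2 x + cdens w.1 f x)).
- apply: measurable_funM; last by apply: measurable_normpow; exact: (weightedHs_measurable V00 hV1 iV1 Wu).
  apply: measurable_funM; last exact: (weightedHs_measurable V00 hV2 iV2 Wf).
  by apply: measurable_spow; exact: (weightedHs_measurable V00 hV2 iV2 Wv).
- move=> x; rewrite /cdens -mulrDr mulrC normrM (ger0_norm (powR_ge0 _ _)) ler_wpM2l ?powR_ge0//.
  exact/norm_spow_mul_le/ltW.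
- exact: (integrableD measurableT (@integrable_cdens (w.1, w.2) (conj Wu Wv))
    (@integrable_cdens (w.1, f) (conj Wu Wf))).
Qed.

Lemma coupling_add1_bounds (e : R) w f : 0 < e <= 1 -> X w -> W1 f ->
  C w + e * (alpha * \int[mu]_x (spow alpha (w.1 x) * f x * `|w.2 x| `^ beta)) <=
  C ((fun x => w.1 x + e * f x), w.2) <=
  C w + e * C ((fun x => w.1 x + 1 * f x), w.2).
Proof.
move=> e01 Xw Wf; have [Wu Wv] := Xw.
have i1 c := @integrable_cdens (_, _) (conj (weightedHs_add c hV1 iV1 Wu Wf) Wv).
apply: (weighted_add_bounds (ltW ha) e01 (fun x => powR_ge0 _ _)).
- exact: integrable_cdens Xw.
- exact: integrable_cdens_spow1.
- exact: i1.
- exact: i1.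
Qed.

Lemma coupling_add2_bounds (e : R) w f : 0 < e <= 1 -> X w -> W2 f ->
  C w + e * (beta * \int[mu]_x (`|w.1 x| `^ alpha * spow beta (w.2 x) * f x)) <=
  C (w.1, (fun x => w.2 x + e * f x)) <=
  C w + e * C (w.1, (fun x => w.2 x + 1 * f x)).
Proof.
move=> e01 Xw Wf; have [Wu Wv] := Xw.
have i0 v : W2 v -> mu.-integrable setT (EFin \o (fun x => `|v x| `^ beta * `|w.1 x| `^ alpha)).
  move=> Wv'; have := @integrable_cdens (_, _) (conj Wu Wv'); rewrite /cdens/=.
  by under eq_fun do rewrite mulrC.
have CE v : C (w.1, v) = \int[mu]_x (`|v x| `^ beta * `|w.1 x| `^ alpha).
  by apply: eq_Rintegral => x _; rewrite mulrC.
rewrite (_ : C w = C (w.1, w.2))// !CE.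
have -> : \int[mu]_x (`|w.1 x| `^ alpha * spow beta (w.2 x) * f x) =
    \int[mu]_x (spow beta (w.2 x) * f x * `|w.1 x| `^ alpha).
  by apply: eq_Rintegral => x _; rewrite -mulrA mulrC.
apply: (weighted_add_bounds (ltW hb) e01 (fun x => powR_ge0 _ _)).
- exact: i0.
- exact: integrable_cdens_spow2.
- by apply: i0; exact: weightedHs_add.
- by apply: i0; exact: weightedHs_add.
Qed.

(** A null set yields two null strips in the product, so convergence almost everywhere passes to
    pairs and Fatou's lemma applies to the Gagliardo quotient. *)
Lemma ae_pair (P : T -> Prop) : {ae mu, forall x, P x} ->
  {ae mu2, forall z : T * T, P z.1 /\ P z.2}.
Proof.
move=> [B [mB B0 PB]].
have n1 : mu2.-negligible (B `*` setT).
  exists (B `*` setT); split => //; first exact: measurableX.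
  by rewrite [LHS](product_measure1E _ _ mB measurableT) B0 mul0e.
have n2 : mu2.-negligible (setT `*` B).
  exists (setT `*` B); split => //; first exact: measurableX.
  by rewrite [LHS](product_measure1E _ _ measurableT mB) B0 mule0.
apply: negligibleS (negligibleU n1 n2) => z /= /not_andP[|] nP; [left|right];
  by split => //; apply: PB.
Qed.

(** Fatou's lemma for the two nonnegative parts separately. An infinite part would eventually exceed
    [K], so the limit belongs to the space; then each part loses at most eps/2. *)
Lemma wnorm2_lsc (V : T -> R) (f : nat -> T -> R) (u : T -> R) (K : R) : (forall x, V0 <= V x) ->
  mu.-integrable setT (fun x => ((V x)^-1)%:E) ->
  (forall n, weightedHs s V (f n)) -> (forall n, wnorm2 s V (f n) <= K) ->
  measurable_fun setT u -> {ae mu, forall x, f n x @[n --> \oo] --> u x} ->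
  weightedHs s V u /\ forall eps, 0 < eps ->
    \forall n \near \oo, wnorm2 s V u - eps < wnorm2 s V (f n).
Proof.
move=> hV iV Wf fK mU fu.
have mV := measurable_V V00 hV iV.
have Vp x : 0 <= V x by apply: le_trans (hV x); exact: ltW.
have mf n : measurable_fun setT (f n) by exact: weightedHs_measurable V00 hV iV _ (Wf n).
have g0 n : 0 <= fine (gagliardo2 s (f n)) by rewrite fine_ge0// gagliardo2_ge0.
have v0 n : 0 <= \int[mu]_x (V x * f n x ^+ 2).
  by apply: Rintegral_ge0 => x _; rewrite mulr_ge0 ?sqr_ge0.
have gE n : (\int[mu2]_z (gquot s (f n) z)%:E)%E = (fine (gagliardo2 s (f n)))%:E.
  by rewrite -(EFin_Rintegral (integrable_gquot V00 hV iV (Wf n))) fine_gagliardo2.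
have vE n : (\int[mu]_x (V x * f n x ^+ 2)%:E)%E = (\int[mu]_x (V x * f n x ^+ 2))%:E.
  by rewrite -(EFin_Rintegral (integrable_Vsqr V00 hV iV (Wf n))).
have gF c : (c%:E < gagliardo2 s u)%E ->
    \forall n \near \oo, c < fine (gagliardo2 s (f n)).
  move=> cg; have : \forall n \near \oo, (c%:E < \int[mu2]_z (gquot s (f n) z)%:E)%E.
    apply: (@fatou_near _ _ _ mu2 (fun n => gquot s (f n)) (gquot s u) c) => //.
    - by move=> n; exact: measurable_gquot.
    - exact: measurable_gquot.
    - by move=> n x; exact: gquot_ge0.
    - by move=> x; exact: gquot_ge0.
    - apply: filterS (ae_pair fu) => z [h1 h2]; apply: cvgMl.
      by apply: cvgM; apply: cvgB.
  by apply: filterS => n; rewrite gE lte_fin.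
have vF c : (c%:E < \int[mu]_x (V x * u x ^+ 2)%:E)%E ->
    \forall n \near \oo, c < \int[mu]_x (V x * f n x ^+ 2).
  move=> cv; have : \forall n \near \oo, (c%:E < \int[mu]_x (V x * f n x ^+ 2)%:E)%E.
    apply: (@fatou_near _ _ _ mu (fun n x => V x * f n x ^+ 2) (fun x => V x * u x ^+ 2) c) => //.
    - by move=> n; exact: measurable_Vsqr V00 hV iV _ (mf n).
    - exact: measurable_Vsqr V00 hV iV _ mU.
    - by move=> n x; rewrite mulr_ge0 ?sqr_ge0.
    - by move=> x; rewrite mulr_ge0 ?sqr_ge0.
    - by apply: filterS fu => z h1; apply: cvgMr; apply: cvgM.
  by apply: filterS => n; rewrite vE lte_fin.
have Wu : weightedHs s V u.
  apply/(weightedHsP s V00 hV iV); split => //.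
  - rewrite ltey; apply/eqP => gy; have := gF K; rewrite gy ltry => /(_ isT)[m _ /(_ m (leqnn _))/=].
    by have := fK m; rewrite /wnorm2; have := v0 m; lra.
  - rewrite ltey; apply/eqP => gy; have := vF K; rewrite gy ltry => /(_ isT)[m _ /(_ m (leqnn _))/=].
    by have := fK m; rewrite /wnorm2; have := g0 m; lra.
split=> // eps eps0.
have gEu : gagliardo2 s u = (fine (gagliardo2 s u))%:E.
  by rewrite fine_gagliardo2 (EFin_Rintegral (integrable_gquot V00 hV iV Wu)).
have vEu : (\int[mu]_x (V x * u x ^+ 2)%:E)%E = (\int[mu]_x (V x * u x ^+ 2))%:E.
  by rewrite -(EFin_Rintegral (integrable_Vsqr V00 hV iV Wu)).
have h1 : \forall n \near \oo, fine (gagliardo2 s u) - eps / 2 < fine (gagliardo2 s (f n)).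
  by apply: gF; rewrite gEu lte_fin ltrBlDr ltrDl divr_gt0.
have h2 : \forall n \near \oo, \int[mu]_x (V x * u x ^+ 2) - eps / 2 < \int[mu]_x (V x * f n x ^+ 2).
  by apply: vF; rewrite vEu lte_fin ltrBlDr ltrDl divr_gt0.
near=> n.
have k1 : fine (gagliardo2 s u) - eps / 2 < fine (gagliardo2 s (f n)) by near: n.
have k2 : \int[mu]_x (V x * u x ^+ 2) - eps / 2 < \int[mu]_x (V x * f n x ^+ 2) by near: n.
rewrite /wnorm2; apply: le_lt_trans (ltrD k1 k2).
by rewrite addrACA -opprD -splitr.
Unshelve. all: by end_near.
Qed.

Lemma powt_ge (u : T -> R) x : `|u x| `^ t <= powt t u x.
Proof. by rewrite lerDr. Qed.

Lemma measurable_powt (u : T -> R) : measurable_fun setT u -> measurable_fun setT (powt t u).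
Proof. by move=> mU; apply: measurable_funD; [exact: measurable_norm_fun|exact: measurable_normpow]. Qed.

Lemma powt_ge0 (u : T -> R) x : 0 <= powt t u x.
Proof. by rewrite addr_ge0 ?powR_ge0. Qed.

Lemma cvg_powt (f : nat -> T -> R) (u : T -> R) x : f n x @[n --> \oo] --> u x ->
  powt t (f n) x @[n --> \oo] --> powt t u x.
Proof.
move=> fu; apply: cvgD; first exact: cvg_norm.
by apply: cvg_powR_norm => //; move: t2; lra.
Qed.

Lemma Lnorm_pow_cvg (r B : R) (f : nat -> T -> R) (u g : T -> R) : 1 <= r < t ->
  (forall n, measurable_fun setT (f n)) -> measurable_fun setT u -> measurable_fun setT g ->
  (forall x, 0 <= g x) -> (\int[mu]_x (g x)%:E < +oo)%E ->
  (forall n, (\int[mu]_x (powt t (f n) x)%:E <= B%:E)%E) ->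
  {ae mu, forall x, f n x @[n --> \oo] --> u x /\ forall n, `|f n x| <= g x} ->
  forall e, 0 < e -> \forall n \near \oo, `|Lnorm_pow r (f n) - Lnorm_pow r u| < e.
Proof.
move=> rt mf mU mg g0 gy fB fu e e0; have r0 : 0 < r by case/andP: rt; lra.
have HU := @uniform_integrable_cvg _ _ _ mu (fun n x => `|f n x| `^ r)
  (fun n => powt t (f n)) (fun x => `|u x| `^ r) (powt t u) g B
  (fun n => measurable_normpow _ (mf n)) (fun n => measurable_powt (mf n))
  (measurable_normpow _ mU) (measurable_powt mU) mg (fun n x => powR_ge0 _ _)
  (fun n x => powt_ge0 _ _) (fun x => powR_ge0 _ _) (powt_ge0 u) g0 gy fB.
have [||_ /(_ e e0)] := HU.
- by apply: filterS fu => x [fux _]; split; [exact: cvg_powR_norm|exact: cvg_powt].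
- move=> eps eps0; have [D D0 HD] := powR_le_weighted rt eps0.
  exists D => //; apply: filterS fu => x [_ fg] n.
  apply: le_trans (HD _ (normr_ge0 _)) _; apply: lerD; first exact: ler_wpM2l.
  by rewrite ler_pM2l// powt_ge.
by apply: filterS => n; rewrite !Lnorm_powE ?gt_eqF.
Qed.

(** The product of powers is at most the power [alpha + beta] of the larger absolute value, and
    [alpha + beta < t] leaves room for [powR_le_weighted]. *)
Lemma coupling_cvg (B1 B2 : R) (f h : nat -> T -> R) (u v g1 g2 : T -> R) :
  (forall n, measurable_fun setT (f n)) -> (forall n, measurable_fun setT (h n)) ->
  measurable_fun setT u -> measurable_fun setT v ->
  measurable_fun setT g1 -> measurable_fun setT g2 ->
  (forall x, 0 <= g1 x) -> (\int[mu]_x (g1 x)%:E < +oo)%E ->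
  (forall x, 0 <= g2 x) -> (\int[mu]_x (g2 x)%:E < +oo)%E ->
  (forall n, (\int[mu]_x (powt t (f n) x)%:E <= B1%:E)%E) ->
  (forall n, (\int[mu]_x (powt t (h n) x)%:E <= B2%:E)%E) ->
  {ae mu, forall x, f n x @[n --> \oo] --> u x /\ forall n, `|f n x| <= g1 x} ->
  {ae mu, forall x, h n x @[n --> \oo] --> v x /\ forall n, `|h n x| <= g2 x} ->
  forall e, 0 < e -> \forall n \near \oo, `|C (f n, h n) - C (u, v)| < e.
Proof.
move=> mf mh mU mv mg1 mg2 g10 g1y g20 g2y fB hB fu hv e e0.
have g0 x : 0 <= g1 x + g2 x by rewrite addr_ge0.
have gy : (\int[mu]_x (g1 x + g2 x)%:E < +oo)%E.
  under eq_integral do rewrite EFinD.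
  rewrite ge0_integralD//; first exact: lte_add_pinfty.
  - by move=> x _; rewrite lee_fin.
  - exact/measurable_EFinP.
  - by move=> x _; rewrite lee_fin.
  - exact/measurable_EFinP.
have HB n : (\int[mu]_x (powt t (f n) x + powt t (h n) x)%:E <= (B1 + B2)%:E)%E.
  under eq_integral do rewrite EFinD.
  rewrite ge0_integralD//; [by rewrite EFinD leeD|..].
  - by move=> x _; rewrite lee_fin powt_ge0.
  - by apply/measurable_EFinP; exact: measurable_powt.
  - by move=> x _; rewrite lee_fin powt_ge0.
  - by apply/measurable_EFinP; exact: measurable_powt.
have HU := @uniform_integrable_cvg _ _ _ mu (fun n => cdens (f n) (h n))
  (fun n x => powt t (f n) x + powt t (h n) x) (cdens u v)
  (fun x => powt t u x + powt t v x) (fun x => g1 x + g2 x) (B1 + B2)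
  (fun n => measurable_cdens (mf n) (mh n))
  (fun n => measurable_funD (measurable_powt (mf n)) (measurable_powt (mh n)))
  (measurable_cdens mU mv) (measurable_funD (measurable_powt mU) (measurable_powt mv))
  (measurable_funD mg1 mg2) (fun n => cdens_ge0 _ _)
  (fun n x => addr_ge0 (powt_ge0 _ _) (powt_ge0 _ _)) (cdens_ge0 u v)
  (fun x => addr_ge0 (powt_ge0 _ _) (powt_ge0 _ _)) g0 gy HB.
have [||_ /(_ e e0)//] := HU.
- apply: filterS2 fu hv => x [fux _] [hvx _]; split.
    apply: cvgM; apply: cvg_powR_norm => //; [move: ha|move: hb]; lra.
  by apply: cvgD; exact: cvg_powt.
- move=> eps eps0; have [D D0 HD] := powR_le_weighted gt' eps0.
  exists D => //; apply: filterS2 fu hv => x [_ fg] [_ hg] n.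
  apply: le_trans (cdens_le_max (normr_ge0 _) (normr_ge0 _)) _.
  have m0 : 0 <= Num.max `|f n x| `|h n x| by rewrite le_max normr_ge0.
  apply: le_trans (HD _ m0) _; apply: lerD.
    apply: ler_wpM2l => //; rewrite ge_max; apply/andP; split.
      by apply: le_trans (fg n) _; rewrite lerDl.
    by apply: le_trans (hg n) _; rewrite lerDr.
  rewrite ler_pM2l//; have [_|_] := leP `|f n x| `|h n x|.
    by apply: le_trans (powt_ge _ _) _; rewrite lerDr powt_ge0.
  by apply: le_trans (powt_ge _ _) _; rewrite lerDl powt_ge0.
Qed.

Lemma cluster_X (K : R) (w : nat -> (T -> R) * (T -> R)) :
  (forall n, X (w n) /\ A (w n) <= K) ->
  exists z a, [/\ X z, A z <= a & forall (e : R) m, 0 < e -> exists2 n, (m <= n)%N &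
    [/\ `|A (w n) - a| < e, `|Lnorm_pow p (w n).1 - Lnorm_pow p z.1| < e,
        `|Lnorm_pow q (w n).2 - Lnorm_pow q z.2| < e & `|C (w n) - C z| < e]].
Proof.
move=> wK; have Xw n : X (w n) by have [] := wK n.
have W1w n : W1 (w n).1 by have [] := Xw n.
have W2w n : W2 (w n).2 by have [] := Xw n.
have n1 n : 0 <= wnorm2 s V1 (w n).1 := wnorm2_ge0 s V00 hV1 _.
have n2 n : 0 <= wnorm2 s V2 (w n).2 := wnorm2_ge0 s V00 hV2 _.
have AE n : A (w n) = wnorm2 s V1 (w n).1 + wnorm2 s V2 (w n).2 by exact: sqnormXE.
have k1 n : wnorm2 s V1 (w n).1 <= K.
  by have [_] := wK n; apply: le_trans; rewrite AE lerDl.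
have k2 n : wnorm2 s V2 (w n).2 <= K.
  by have [_] := wK n; apply: le_trans; rewrite AE lerDr.
have K0 : 0 <= K := le_trans (n1 0%N) (k1 0%N).
set K' := K * (1 + V0^-1).
have K'0 : 0 <= K' by rewrite mulr_ge0// addr_ge0// invr_ge0 ltW.
have b1 n : bounded_Hs s V1 K' (w n).1 := wnorm2_bounded V00 hV1 iV1 (W1w n) (k1 n).
have b2 n : bounded_Hs s V2 K' (w n).2 := wnorm2_bounded V00 hV2 iV2 (W2w n) (k2 n).
have [B1 HB1] := powt_bound s0 V00 hV1 iV1 hN t2 ht K'0.
have [B2 HB2] := powt_bound s0 V00 hV2 iV2 hN t2 ht K'0.
(* One ultrafilter for both components and for the squared norms, so that a single subsequence
   serves all three. *)
have [U [UU ooU]] : exists U, UltraFilter U /\ (\oo : set_system nat) `<=` U.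
  exact: ultraFilterLemma.
have half0 j : 0 < (2^-1 ^+ j : R) by rewrite exprn_gt0.
have /choice[S1 HS1] : forall j, exists S, U S /\ forall k l, S k -> S l ->
    (\int[mu]_x (`|(w k).1 x - (w l).1 x|)%:E <= (2^-1 ^+ j)%:E)%E.
  move=> j; have [S US HS] := L1_precompact s0 V00 hV1 iV1 UU K'0 b1 (half0 j).
  by exists S.
have /choice[S2 HS2] : forall j, exists S, U S /\ forall k l, S k -> S l ->
    (\int[mu]_x (`|(w k).2 x - (w l).2 x|)%:E <= (2^-1 ^+ j)%:E)%E.
  move=> j; have [S US HS] := L1_precompact s0 V00 hV2 iV2 UU K'0 b2 (half0 j).
  by exists S.
have AK n : `|A (w n)| <= K.
  by rewrite ger0_norm ?sqnormX_ge0//; have [] := wK n.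
have [a Ha] := ultra_bounded_cvg UU AK.
pose S j := S1 j `&` S2 j `&` [set n | `|A (w n) - a| < 2^-1 ^+ j].
have US j : U (S j).
  by apply: filterI; [apply: filterI; [have [] := HS1 j|have [] := HS2 j]|exact: Ha].
have [sg Hsg] := ultra_extraction UU ooU US.
pose f j := (w (sg j)).1; pose h j := (w (sg j)).2.
have mf j : measurable_fun setT (f j) := weightedHs_measurable V00 hV1 iV1 (W1w _).
have mh j : measurable_fun setT (h j) := weightedHs_measurable V00 hV2 iV2 (W2w _).
have [u [g1 [mU mg1 g10 g1y fu]]] : exists u g : T -> R,
    [/\ measurable_fun setT u, measurable_fun setT g,
      forall x, 0 <= g x, (\int[mu]_x (g x)%:E < +oo)%E &
      {ae mu, forall x, f n x @[n --> \oo] --> u x /\ forall n, `|f n x| <= g x}].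
  apply: fast_cauchy_cvg => //.
    by apply: le_lt_trans (L1_bound V00 hV1 iV1 (b1 _)) _; rewrite ltry.
  (* Both [sg n] and [sg n.+1] satisfy condition n, so the increments are at most 2^-n in L^1. *)
  move=> n; have [_ HS] := HS1 n; apply: HS.
    by have [_ /(_ n (leqnSn _))[[]]] := Hsg n.+1.
  by have [_ /(_ n (leqnn _))[[]]] := Hsg n.
have [v [g2 [mv mg2 g20 g2y hv]]] : exists u g : T -> R,
    [/\ measurable_fun setT u, measurable_fun setT g,
      forall x, 0 <= g x, (\int[mu]_x (g x)%:E < +oo)%E &
      {ae mu, forall x, h n x @[n --> \oo] --> u x /\ forall n, `|h n x| <= g x}].
  apply: fast_cauchy_cvg => //.
    by apply: le_lt_trans (L1_bound V00 hV2 iV2 (b2 _)) _; rewrite ltry.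
  move=> n; have [_ HS] := HS2 n; apply: HS.
    by have [_ /(_ n (leqnSn _))[[]]] := Hsg n.+1.
  by have [_ /(_ n (leqnn _))[[]]] := Hsg n.
have fu' : {ae mu, forall x, f n x @[n --> \oo] --> u x} by apply: filterS fu => x [].
have hv' : {ae mu, forall x, h n x @[n --> \oo] --> v x} by apply: filterS hv => x [].
have [Wu lu] := wnorm2_lsc hV1 iV1 (fun n => W1w (sg n)) (fun n => k1 (sg n)) mU fu'.
have [Wv lv] := wnorm2_lsc hV2 iV2 (fun n => W2w (sg n)) (fun n => k2 (sg n)) mv hv'.
have ca e : 0 < e -> \forall n \near \oo, `|A (w (sg n)) - a| < e.
  move=> e0; have : (2^-1 ^+ n : R) @[n --> \oo] --> 0.
    by apply: cvg_expr; rewrite ger0_norm// invf_lt1// ltr1n.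
  move=> /cvgr0Pnorm_lt/(_ _ e0); apply: filterS => n.
  rewrite ger0_norm ?exprn_ge0//; apply: lt_trans.
  by have [_ /(_ n (leqnn _))[]] := Hsg n.
have Xz : X (u, v) by [].
have pt' : 1 <= p < t by move: hp hpq hq t2; lra.
have qt'' : 1 <= q < t by move: hp hpq hq t2; lra.
exists (u, v), a; split => //.
- rewrite sqnormXE//=; apply/ler_addgt0Pr => e e0.
  have e3 : 0 < e / 3 by rewrite divr_gt0.
  have : exists n, [/\ wnorm2 s V1 u - e / 3 < wnorm2 s V1 (f n),
      wnorm2 s V2 v - e / 3 < wnorm2 s V2 (h n) & `|A (w (sg n)) - a| < e / 3].
    near \oo => n; exists n; split.
    + by near: n; exact: lu.
    + by near: n; exact: lv.
    + by near: n; exact: ca.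
  move=> [n [h1 h2]]; rewrite AE => /ltr_normlW h3.
  move: h1 h2 h3; rewrite -/(f n) -/(h n).
  by move: (wnorm2 s V1 u) (wnorm2 s V1 (f n)) (wnorm2 s V2 v) (wnorm2 s V2 (h n)) => *; lra.
- move=> e m e0.
  have fB n : (\int[mu]_x (powt t (f n) x)%:E <= B1%:E)%E by exact: HB1 (b1 _).
  have hB n : (\int[mu]_x (powt t (h n) x)%:E <= B2%:E)%E by exact: HB2 (b2 _).
  near \oo => n; exists (sg n).
    apply: (@leq_trans n); last by have [] := Hsg n.
    by near: n; exact: nbhs_infty_ge.
  split.
  + by near: n; exact: ca.
  + by near: n; exact: (Lnorm_pow_cvg pt' mf mU mg1 g10 g1y fB fu e0).
  + by near: n; exact: (Lnorm_pow_cvg qt'' mh mv mg2 g20 g2y hB hv e0).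
  + rewrite (_ : w (sg n) = (f n, h n)); last by rewrite /f /h; case: (w (sg n)).
    near: n.
    exact: (coupling_cvg mf mh mU mv mg1 mg2 g10 g1y g20 g2y fB hB fu hv e0).
Unshelve. all: by end_near.
Qed.

(** * The ground state *)

Lemma coupling_ae0 w : X w -> w.1 = cst 0 %[ae mu] -> C w = 0.
Proof.
move=> [Wu Wv] u0; rewrite /coupling /Rintegral.
have mw1 := weightedHs_measurable V00 hV1 iV1 Wu.
have mw2 := weightedHs_measurable V00 hV2 iV2 Wv.
have mc : measurable_fun setT (fun x => (cdens w.1 w.2 x)%:E).
  by apply/measurable_EFinP; exact: measurable_cdens.
rewrite (_ : (\int[mu]_x _)%E = 0%E)//.
rewrite (_ : 0%E = (\int[mu]_x (cst 0%E x))%E); last by rewrite integral_cst// mul0e.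
apply: ge0_ae_eq_integral => //.
apply: filterS u0 => x /(_ Logic.I) ux _.
by rewrite /= ux /= normr0 powR0 ?mul0r// gt_eqF//; move: ha; lra.
Qed.

(** If the first component vanished almost everywhere, so would the coupling. Hence the Rayleigh
    quotients have positive denominators along the rays of admissible pairs. *)
Lemma Lnorm_pow_gt0 w : X w -> 0 < C w -> 0 < Lnorm_pow p w.1.
Proof.
move=> Xw Cw; have [Wu Wv] := Xw; rewrite lt_neqAle Lnorm_pow_ge0 andbT.
apply: contraTneq Cw => P0; rewrite coupling_ae0 ?ltxx//.
have mw1 := weightedHs_measurable V00 hV1 iV1 Wu.
have mp : measurable_fun setT (fun x => (`|w.1 x| `^ p)%:E).
  by apply/measurable_EFinP; exact: measurable_normpow.
have : (\int[mu]_x `|(`|w.1 x| `^ p)%:E|)%E = 0%E.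
  under eq_integral do rewrite gee0_abs ?lee_fin ?powR_ge0//.
  rewrite -(EFin_Rintegral (iN1 pt Wu)); congr EFin.
  by rewrite -Lnorm_powE ?gt_eqF.
move=> /(ae_eq_integral_abs mu measurableT mp); apply: filterS => x /(_ Logic.I) + _.
by move=> /= [] /powR_eq0_eq0/normr0_eq0.
Qed.

Variable theta : R.
Hypothesis htheta : 0 < theta.
Let P (w : (T -> R) * (T -> R)) : R := Lnorm_pow p w.1.
Let Q (w : (T -> R) * (T -> R)) : R := Lnorm_pow q w.2.
Local Notation g := (alpha + beta).
Local Notation k := (fibX p q g theta A P Q C).
Local Notation phi := (fibEX p q g theta A P Q C).
Local Notation nehari := (nehariX p q g theta X A P Q C).
Local Notation level := (ground_level p q g theta X A P Q C).

Lemma Rayleigh_n_scale w c : X w -> 0 < C w -> 0 < c ->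
  0 < P w * c `^ p + Q w * c `^ q /\
  Rayleigh_n s V1 V2 alpha beta p q theta (scale c w) =
  (A w * c ^+ 2 - theta * (C w * c `^ g)) / (P w * c `^ p + Q w * c `^ q).
Proof.
move=> Xw Cw c0; split.
  by rewrite ltr_pwDl ?mulr_ge0 ?Lnorm_pow_ge0 ?powR_ge0// mulr_gt0 ?Lnorm_pow_gt0// powR_gt0.
by rewrite /Rayleigh_n sqnormX_scale// coupling_scale// Lnorm_pow1_scale// Lnorm_pow2_scale.
Qed.

Lemma Rayleigh_e_scale w c : X w -> 0 < C w -> 0 < c ->
  0 < P w * c `^ p / p + Q w * c `^ q / q /\
  Rayleigh_e s V1 V2 alpha beta p q theta (scale c w) =
  (2^-1 * (A w * c ^+ 2) - theta / g * (C w * c `^ g)) / (P w * c `^ p / p + Q w * c `^ q / q).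
Proof.
move=> Xw Cw c0; split.
  rewrite ltr_pwDl ?divr_ge0 ?mulr_ge0 ?Lnorm_pow_ge0 ?powR_ge0 ?(ltW q0)//.
  by rewrite divr_gt0// mulr_gt0 ?Lnorm_pow_gt0// powR_gt0.
rewrite /Rayleigh_e sqnormX_scale// coupling_scale// Lnorm_pow1_scale// Lnorm_pow2_scale//.
by rewrite (mulrC p^-1) (mulrC q^-1).
Qed.

(** Clearing the positive denominator: R_n is the parameter for which the derivative of the energy
    along the ray vanishes, just as R_e is the one for which the energy vanishes. This turns
    [lambda_upper] and [lambda_lower] into statements about rays. *)
Lemma lt_Rayleigh_n lambda w c : X w -> 0 < C w -> 0 < c ->
  (lambda < Rayleigh_n s V1 V2 alpha beta p q theta (scale c w)) = (0 < k lambda w c).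
Proof.
move=> Xw Cw c0; have [d0 ->] := Rayleigh_n_scale Xw Cw c0.
rewrite ltr_pdivlMr// -subr_gt0 /fibX /fibk.
by congr (_ < _); ring.
Qed.

Lemma lt_Rayleigh_e lambda w c : X w -> 0 < C w -> 0 < c ->
  (lambda < Rayleigh_e s V1 V2 alpha beta p q theta (scale c w)) = (0 < phi lambda w c).
Proof.
move=> Xw Cw c0; have [d0 ->] := Rayleigh_e_scale Xw Cw c0.
rewrite ltr_pdivlMr// -subr_gt0 /fibEX /fibE.
by congr (_ < _); ring.
Qed.

Lemma Rayleigh_e_le lambda w c : X w -> 0 < C w -> 0 < c ->
  (Rayleigh_e s V1 V2 alpha beta p q theta (scale c w) <= lambda) = (phi lambda w c <= 0).
Proof. by move=> Xw Cw c0; rewrite !leNgt lt_Rayleigh_e. Qed.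

Lemma Rayleigh_e_lt lambda w c : X w -> 0 < C w -> 0 < c ->
  (Rayleigh_e s V1 V2 alpha beta p q theta (scale c w) < lambda) = (phi lambda w c < 0).
Proof.
move=> Xw Cw c0; have [d0 ->] := Rayleigh_e_scale Xw Cw c0.
rewrite ltr_pdivrMr// -subr_lt0 /fibEX /fibE.
by congr (_ < _); ring.
Qed.

Lemma energyE lambda w : energy s V1 V2 alpha beta p q theta lambda w = phi lambda w 1.
Proof. by rewrite /energy /fibEX /fibE /P /Q !powR1 expr1n; ring. Qed.

(** The Nehari identity turns [d2energy] into [fibsX], and a positive coupling excludes the zero
    pair. *)
Lemma nehariX_Nehari_minus lambda w : nehari lambda w ->
  d2energy s V1 V2 alpha beta p q theta lambda w < 0 /\
  Nehari_minus s V1 V2 alpha beta p q theta lambda w.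
Proof.
move=> [Xw Cw k1 s1].
have k1' : A w - lambda * P w - lambda * Q w - theta * C w = 0.
  by move: k1; rewrite /fibX /fibk !powR1 expr1n !mulr1.
have d0 : d2energy s V1 V2 alpha beta p q theta lambda w < 0.
  apply: le_lt_trans s1; rewrite le_eqVlt; apply/orP; left; apply/eqP.
  rewrite /d2energy /fibsX /fibs; have -> : A w = lambda * P w + lambda * Q w + theta * C w.
    by apply/eqP; rewrite -subr_eq0 -k1'; apply/eqP; ring.
  by rewrite -/(P w) -/(Q w); ring.
split=> //; split => //; split => //.
- by move=> [u0 _]; move: Cw; rewrite coupling_ae0// ltxx.
- apply/eqP; rewrite -/(P w) -/(Q w) eq_sym -subr_eq0 -[X in _ == X]k1'.
  by apply/eqP; ring.
Qed.

Let g2 : 2 < g := hab.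
Let sX (c : R) w (_ : 0 < c) := @spaceX_scale c w.
Let sA (c : R) w (_ : 0 < c) := @sqnormX_scale c w.
Let sP c w (c0 : 0 < c) : X w -> P (scale c w) = P w * c `^ p := Lnorm_pow1_scale c0 (w := w).
Let sQ c w (c0 : 0 < c) : X w -> Q (scale c w) = Q w * c `^ q := Lnorm_pow2_scale c0 (w := w).
Let sC c w (c0 : 0 < c) : X w -> C (scale c w) = C w * c `^ g := coupling_scale c0 (w := w).
Let A0 := @sqnormX_ge0.
Let P0 w (_ : X w) : 0 <= P w := Lnorm_pow_ge0 p w.1.
Let Q0 w (_ : X w) : 0 <= Q w := Lnorm_pow_ge0 q w.2.

(** * Sign of the ground level and the Euler equation below the upper threshold *)

Section subcritical_lambda.
Variable lambda : R.
Hypothesis l0 : 0 < lambda.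
Hypothesis hl : (lambda%:E < lambda_upper s V1 V2 alpha beta p q theta)%E.

Lemma lambda_upper_fib w : X w -> 0 < C w -> exists2 c, 0 < c & 0 < k lambda w c.
Proof.
move=> Xw Cw; have : (lambda%:E < Lambda_n s V1 V2 alpha beta p q theta w)%E.
  by apply: lt_le_trans hl _; apply: ereal_inf_lbound; exists w.
move=> /ereal_sup_gt[_ [c /= c0 <-]]; rewrite lte_fin lt_Rayleigh_n// => kc.
by exists c.
Qed.

Lemma lambda_lower_energy_gt0 z : nehari lambda z ->
  (lambda%:E < lambda_lower s V1 V2 alpha beta p q theta)%E -> 0 < phi lambda z 1.
Proof.
move=> nz ll; have [Xz Cz _ _] := nz.
have : (lambda%:E < Lambda_e s V1 V2 alpha beta p q theta z)%E.
  by apply: lt_le_trans ll _; apply: ereal_inf_lbound; exists z.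
move=> /ereal_sup_gt[_ [c /= c0 <-]]; rewrite lte_fin lt_Rayleigh_e// => kc.
exact: (nehariX_energy_gt0 hp hpq hq g2 htheta P0 Q0 l0 nz c0 kc).
Qed.

Lemma Lambda_e_le w (l : R) : X w -> 0 < C w ->
  (Lambda_e s V1 V2 alpha beta p q theta w <= l%:E)%E <->
  forall c, 0 < c -> phi l w c <= 0.
Proof.
move=> Xw Cw; split => [h c c0|h].
  rewrite -Rayleigh_e_le// -lee_fin; apply: le_trans h.
  by apply: ereal_sup_ubound; exists c.
by apply: ge_ereal_sup => _ [c /= c0 <-]; rewrite lee_fin Rayleigh_e_le// h.
Qed.

(** Pairs with [Lambda_e] below [lambda + eta] show that the level is at most 0. A negative energy
    at [z] would give [Lambda_e] at [z] below [lambda], against the definition of the infimum. *)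
Lemma lambda_lower_energy_eq0 z : nehari lambda z -> phi lambda z 1 = level lambda ->
  lambda%:E = lambda_lower s V1 V2 alpha beta p q theta -> phi lambda z 1 = 0.
Proof.
move=> nz zl ll; have [Xz Cz _ _] := nz; apply/eqP; rewrite eq_le; apply/andP; split.
  have [B ball] := ball_bound_X.
  rewrite zl; apply: (ground_level_le0 hp hpq hq g2 htheta sX sA sP sQ sC A0 P0 Q0 ball l0 lambda_upper_fib).
  move=> eta eta0.
  have : (lambda_lower s V1 V2 alpha beta p q theta < (lambda + eta)%:E)%E.
    by rewrite -ll lte_fin ltrDl.
  move=> /ereal_inf_lt[_ [w [Xw Cw] <-] /ltW/(Lambda_e_le _ Xw Cw) h].
  exists w; split => // c c0.
  have -> : phi lambda w c = phi (lambda + eta) w c +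
      eta * (P w * c `^ p / p + Q w * c `^ q / q) by rewrite /fibEX /fibE; ring.
  by rewrite gerDr h.
rewrite leNgt; apply/negP => neg.
have [l [l1 ll' h]] := nehariX_energy_lt0 hp hpq hq g2 htheta sX sA sP sQ sC A0 P0 Q0 l0 nz neg.
have : (lambda_lower s V1 V2 alpha beta p q theta <= l%:E)%E.
  apply: (@le_trans _ _ (Lambda_e s V1 V2 alpha beta p q theta z)).
    by apply: ereal_inf_lbound; exists z.
  exact/(Lambda_e_le _ Xz Cz).
by rewrite -ll lee_fin leNgt ll'.
Qed.

(** Some [w] has [Lambda_e] below [lambda], so the energy is negative on its whole ray, in
    particular at the point of N^-, which bounds the ground level. *)
Lemma lambda_lower_energy_lt0 z : phi lambda z 1 = level lambda ->
  (lambda_lower s V1 V2 alpha beta p q theta < lambda%:E)%E -> phi lambda z 1 < 0.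
Proof.
move=> zl /ereal_inf_lt[_ [w [Xw Cw] <-] wl].
have [c c0 kc] := lambda_upper_fib Xw Cw.
have [x cx nx] := nehariX_proj hp hpq hq g2 htheta sX sA sP sQ sC A0 P0 Q0 (ltW l0) Xw Cw c0 kc.
have x0 : 0 < x by exact: lt_trans cx.
have [B ball] := ball_bound_X.
rewrite zl; apply: le_lt_trans (ground_level_le hp hpq hq g2 sX sA sP sQ A0 P0 Q0 ball l0 nx) _.
rewrite (fibEX_sc theta sA sP sQ sC)//.
rewrite -Rayleigh_e_lt// -lte_fin; apply: le_lt_trans wl.
by apply: ereal_sup_ubound; exists x.
Qed.

Section critical_point.
Variable z : (T -> R) * (T -> R).
Hypotheses (nz : nehari lambda z) (zl : phi lambda z 1 = level lambda).
Let Xz : X z. Proof. by case: nz. Qed.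

(** The partial derivatives in the two components: [denergy] at [z] in the direction [f] is
    [half1 f.1 + half2 f.2]. *)
Let half1 (f : T -> R) : R := gagliardo_form s z.1 f + \int[mu]_x (V1 x * z.1 x * f x)
  - lambda * \int[mu]_x (spow p (z.1 x) * f x)
  - theta * alpha / g * \int[mu]_x (spow alpha (z.1 x) * f x * `|z.2 x| `^ beta).

Let half2 (f : T -> R) : R := gagliardo_form s z.2 f + \int[mu]_x (V2 x * z.2 x * f x)
  - lambda * \int[mu]_x (spow q (z.2 x) * f x)
  - theta * beta / g * \int[mu]_x (`|z.1 x| `^ alpha * spow beta (z.2 x) * f x).

Let X10 f : W1 f -> X (f, fun=> 0).
Proof. by move=> Wf; split => //; exact: weightedHs0 V00 hV2 iV2. Qed.

Let X02 f : W2 f -> X (fun=> 0, f).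
Proof. by move=> Wf; split => //; exact: weightedHs0 V00 hV1 iV1. Qed.

Let gagliardo_form0 (u : T -> R) : gagliardo_form s u (fun=> 0) = 0.
Proof.
rewrite /gagliardo_form (_ : (fun z => _) = cst 0); last first.
  by apply/funext => x /=; rewrite subrr mulr0 mul0r.
by rewrite Rintegral_cst// mul0r.
Qed.

Let Rintegral0 (h : T -> R) : (forall x, h x = 0) -> \int[mu]_x h x = 0.
Proof. by move=> h0; under eq_Rintegral do rewrite h0; rewrite Rintegral_cst// mul0r. Qed.

(** [ground_state_variation] along a curve that moves the first component only: the second power is
    constant, so its slope is 0, and [L] majorizes the upper slopes of the other two terms. *)
Let half1_ge0 f : W1 f -> 0 <= half1 f.
Proof.
move=> Wf; have [Wu Wv] := Xz; have Xf := X10 Wf.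
have [B ball] := ball_bound_X.
pose L : R := Lnorm_pow p (fun x => z.1 x + 1 * f x) + C ((fun x => z.1 x + 1 * f x), z.2).
have Lp : Lnorm_pow p (fun x => z.1 x + 1 * f x) <= L by rewrite lerDl coupling_ge0.
have Lc : C ((fun x => z.1 x + 1 * f x), z.2) <= L by rewrite lerDr Lnorm_pow_ge0.
have L0 : 0 <= L by rewrite addr_ge0 ?coupling_ge0 ?Lnorm_pow_ge0.
pose W e : (T -> R) * (T -> R) := ((fun x => z.1 x + e * f x), z.2).
have WE e : W e = addX z (f, fun=> 0) e.
  by rewrite /W /addX/=; congr pair; apply/funext => x; rewrite mulr0 addr0.
have := @ground_state_variation _ _ _ _ _ hp hpq hq g2 htheta _ _ _ _ _ _ _ sX sA sP sQ sC
  A0 P0 Q0 _ ball _ l0 z W (innerX s V1 V2 z (f, fun=> 0)) (A (f, fun=> 0))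
  (p * \int[mu]_x (spow p (z.1 x) * f x)) 0
  (alpha * \int[mu]_x (spow alpha (z.1 x) * f x * `|z.2 x| `^ beta)) L nz zl.
have -> : innerX s V1 V2 z (f, fun=> 0) - lambda * (p * \int[mu]_x (spow p (z.1 x) * f x)) / p -
    lambda * 0 / q - theta * (alpha * \int[mu]_x (spow alpha (z.1 x) * f x * `|z.2 x| `^ beta)) / g = half1 f.
  rewrite innerXE//= gagliardo_form0 (@Rintegral0 (fun x => V2 x * z.2 x * 0)); last by move=> x; rewrite mulr0.
  by rewrite /half1; field; rewrite !gt_eqF//; move: hab; lra.
apply => e /[dup] e01 /andP[e0 e1]; split.
- by rewrite WE; exact: spaceX_add.
- by rewrite WE sqnormX_add.
- have /andP[h1 h2] := Lnorm_pow_add_bounds hV1 iV1 pt e01 Wu Wf.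
  by rewrite h1/= (le_trans h2)// lerD2l ler_wpM2l// ltW.
- by rewrite mulr0 addr0 lexx/= lerDl mulr_ge0// ltW.
- have /andP[h1 h2] := coupling_add1_bounds e01 Xz Wf.
  by rewrite h1/= (le_trans h2)// lerD2l ler_wpM2l// ltW.
Qed.

Let half2_ge0 f : W2 f -> 0 <= half2 f.
Proof.
move=> Wf; have [Wu Wv] := Xz; have Xf := X02 Wf.
have [B ball] := ball_bound_X.
pose L : R := Lnorm_pow q (fun x => z.2 x + 1 * f x) + C (z.1, (fun x => z.2 x + 1 * f x)).
have Lp : Lnorm_pow q (fun x => z.2 x + 1 * f x) <= L by rewrite lerDl coupling_ge0.
have Lc : C (z.1, (fun x => z.2 x + 1 * f x)) <= L by rewrite lerDr Lnorm_pow_ge0.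
have L0 : 0 <= L by rewrite addr_ge0 ?coupling_ge0 ?Lnorm_pow_ge0.
pose W e : (T -> R) * (T -> R) := (z.1, (fun x => z.2 x + e * f x)).
have WE e : W e = addX z (fun=> 0, f) e.
  by rewrite /W /addX/=; congr pair; apply/funext => x; rewrite mulr0 addr0.
have := @ground_state_variation _ _ _ _ _ hp hpq hq g2 htheta _ _ _ _ _ _ _ sX sA sP sQ sC
  A0 P0 Q0 _ ball _ l0 z W (innerX s V1 V2 z (fun=> 0, f)) (A (fun=> 0, f)) 0
  (q * \int[mu]_x (spow q (z.2 x) * f x))
  (beta * \int[mu]_x (`|z.1 x| `^ alpha * spow beta (z.2 x) * f x)) L nz zl.
have -> : innerX s V1 V2 z (fun=> 0, f) - lambda * 0 / p -
    lambda * (q * \int[mu]_x (spow q (z.2 x) * f x)) / q -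
    theta * (beta * \int[mu]_x (`|z.1 x| `^ alpha * spow beta (z.2 x) * f x)) / g = half2 f.
  rewrite innerXE//= gagliardo_form0 (@Rintegral0 (fun x => V1 x * z.1 x * 0)); last by move=> x; rewrite mulr0.
  by rewrite /half2; field; rewrite !gt_eqF//; move: hab; lra.
apply => e /[dup] e01 /andP[e0 e1]; split.
- by rewrite WE; exact: spaceX_add.
- by rewrite WE sqnormX_add.
- by rewrite mulr0 addr0 lexx/= lerDl mulr_ge0// ltW.
- have /andP[h1 h2] := Lnorm_pow_add_bounds hV2 iV2 qt e01 Wv Wf.
  by rewrite h1/= (le_trans h2)// lerD2l ler_wpM2l// ltW.
- have /andP[h1 h2] := coupling_add2_bounds e01 Xz Wf.
  by rewrite h1/= (le_trans h2)// lerD2l ler_wpM2l// ltW.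
Qed.

Let RintegralN1 d (U : measurableType d) (nu : {measure set U -> \bar R}) (h h' : U -> R) :
  nu.-integrable setT (EFin \o h) -> (forall x, h' x = - h x) ->
  \int[nu]_x h' x = - \int[nu]_x h x.
Proof.
move=> ih hh'; rewrite -mulN1r -RintegralZl//.
by apply: eq_Rintegral => x _; rewrite hh' mulN1r.
Qed.

Let gagliardo_formN V (u f : T -> R) : (forall x, V0 <= V x) ->
  mu.-integrable setT (fun x => ((V x)^-1)%:E) -> weightedHs s V u -> weightedHs s V f ->
  gagliardo_form s u (fun x => (-1) * f x) = - gagliardo_form s u f.
Proof.
move=> hV iV Wu Wf.
by apply: (RintegralN1 (integrable_gcross V00 hV iV Wu Wf)) => x; rewrite /gcross; ring.
Qed.

Let half1N f : W1 f -> half1 (fun x => (-1) * f x) = - half1 f.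
Proof.
move=> Wf; have [Wu Wv] := Xz; rewrite /half1 (gagliardo_formN hV1 iV1 Wu Wf).
rewrite (RintegralN1 (integrable_Vmul V00 hV1 iV1 Wu Wf)
  (h' := fun x => V1 x * z.1 x * (-1 * f x))); last by move=> x; ring.
rewrite (RintegralN1 (integrable_spow s0 V00 hV1 iV1 hN t2 ht pt Wu Wf)
  (h' := fun x => spow p (z.1 x) * (-1 * f x))); last by move=> x; ring.
rewrite (RintegralN1 (integrable_cdens_spow1 Xz Wf) (h' := fun x => spow alpha (z.1 x) * (-1 * f x) * `|z.2 x| `^ beta)); last by move=> x; ring.
by ring.
Qed.

Let half2N f : W2 f -> half2 (fun x => (-1) * f x) = - half2 f.
Proof.
move=> Wf; have [Wu Wv] := Xz; rewrite /half2 (gagliardo_formN hV2 iV2 Wv Wf).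
have iC : mu.-integrable setT (EFin \o (fun x => `|z.1 x| `^ alpha * spow beta (z.2 x) * f x)).
  by have := integrable_cdens_spow2 Xz Wf; under eq_fun do rewrite mulrC mulrA.
rewrite (RintegralN1 (integrable_Vmul V00 hV2 iV2 Wv Wf)
  (h' := fun x => V2 x * z.2 x * (-1 * f x))); last by move=> x; ring.
rewrite (RintegralN1 (integrable_spow s0 V00 hV2 iV2 hN t2 ht qt Wv Wf)
  (h' := fun x => spow q (z.2 x) * (-1 * f x))); last by move=> x; ring.
rewrite (RintegralN1 iC (h' := fun x => `|z.1 x| `^ alpha * spow beta (z.2 x) * (-1 * f x))); last by move=> x; ring.
by ring.
Qed.

(** The halves are odd in the test function, so their nonnegativity in the directions f and -f makes
    them vanish. *)
Lemma ground_state_weak_solution : weak_solution s V1 V2 alpha beta p q theta lambda z.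
Proof.
split=> // f Xf; have [Wf Wh] := Xf.
have h1 : half1 f.1 = 0.
  apply/eqP; rewrite eq_le half1_ge0// andbT -oppr_ge0 -half1N//.
  by apply: half1_ge0; exact: weightedHs_scale.
have h2 : half2 f.2 = 0.
  apply/eqP; rewrite eq_le half2_ge0// andbT -oppr_ge0 -half2N//.
  by apply: half2_ge0; exact: weightedHs_scale.
rewrite /denergy innerXE// -[RHS](addr0 0) -[X in _ = X + _]h1 -[X in _ = _ + X]h2.
by rewrite /half1 /half2; ring.
Qed.

End critical_point.

Lemma ground_state_solution : (exists w, admissible s V1 V2 alpha beta w) ->
  exists z, [/\ admissible s V1 V2 alpha beta z,
    weak_solution s V1 V2 alpha beta p q theta lambda z,
    d2energy s V1 V2 alpha beta p q theta lambda z < 0 /\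
    Nehari_minus s V1 V2 alpha beta p q theta lambda z &
    [/\ (lambda%:E < lambda_lower s V1 V2 alpha beta p q theta)%E ->
          0 < energy s V1 V2 alpha beta p q theta lambda z,
        lambda%:E = lambda_lower s V1 V2 alpha beta p q theta ->
          energy s V1 V2 alpha beta p q theta lambda z = 0 &
        (lambda_lower s V1 V2 alpha beta p q theta < lambda%:E)%E ->
          energy s V1 V2 alpha beta p q theta lambda z < 0]].
Proof.
move=> [w0 [Xw0 Cw0]]; have [B ball] := ball_bound_X.
have ex : exists2 w, X w & 0 < C w by exists w0.
have [z nz zl] := ground_state_exists hp hpq hq g2 htheta sX sA sP sQ sC A0 P0 Q0 ball
  cluster_X l0 lambda_upper_fib ex.
exists z; split; first by case: nz.
- exact: ground_state_weak_solution.
- exact: nehariX_Nehari_minus.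
rewrite energyE; split.
- exact: lambda_lower_energy_gt0.
- exact: lambda_lower_energy_eq0.
- exact: lambda_lower_energy_lt0.
Qed.

End subcritical_lambda.

End product_space.

(** * The admissible set is not empty *)

Section tent.
Context {R : realType} {N : nat}.
Local Notation T := 'rV[R]_N.
Local Notation mu := (leb N : {measure set 'rV[R]_N -> \bar R}).
Local Notation mu2 := (leb N \x leb N)%E.
Implicit Types (x y : T) (a : R) (B : set T).

Definition close_pairs a : set (T * T) := [set z | enorm (z.1 - z.2) <= a].

Lemma measurable_close_pairs a : measurable (close_pairs a).
Proof.
rewrite (_ : close_pairs a = (fun z : T * T => enorm (z.1 - z.2)) @^-1` `]-oo, a]).
  by rewrite -[X in measurable X]setTI; exact: measurable_enorm_sub.
by apply/seteqP; split => z /=; rewrite in_itv.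
Qed.

Lemma measurable_close_indic a : measurable_fun setT (\1_(close_pairs a) : T * T -> R).
Proof. by apply: measurable_indic; exact: measurable_close_pairs. Qed.

Lemma measurable_closed_box (b1 b2 : T) :
  measurable [set x : T | forall i, b1 ord0 i <= x ord0 i <= b2 ord0 i].
Proof.
rewrite [X in measurable X](_ : _ = \bigcap_(i in [set: 'I_N])
    ((fun x : T => x ord0 i) @^-1` `[b1 ord0 i, b2 ord0 i])).
  apply: fin_bigcap_measurable => // i _.
  by rewrite -[X in measurable X]setTI; exact: measurable_coord.
apply/seteqP; split => y /= H i; first by move=> _ /=; rewrite in_itv/=.
by have := H i I; rewrite /= in_itv.
Qed.

Lemma leb_ball_le x a : 0 <= a -> measurable [set y | enorm (x - y) <= a] /\
  (leb N [set y | enorm (x - y) <= a]%R <= ((2 * a) ^+ N)%:E)%E.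
Proof.
move=> a0; have mx : measurable [set y | enorm (x - y) <= a].
  have := measurable_xsection x (measurable_close_pairs a).
  by rewrite (_ : xsection _ _ = [set y | enorm (x - y) <= a])//;
    apply/seteqP; split => y; rewrite /xsection/= inE.
split => //.
have bx := @leb_box R N (\row_i (x ord0 i - a)) (\row_i (x ord0 i + a)).
have -> : (2 * a) ^+ N = \prod_(i < N)
    ((\row_i (x ord0 i + a)) ord0 i - (\row_i (x ord0 i - a)) ord0 i).
  rewrite -[in LHS](card_ord N) -prodr_const.
  by apply: eq_bigr => i _; rewrite !mxE; ring.
rewrite -bx; last by move=> i; rewrite !mxE; lra.
apply: le_measure; rewrite ?inE//.
  exact: measurable_closed_box.
move=> y /= ya i; rewrite !mxE; have := le_trans (coord_le_enorm (x - y) i) ya.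
by rewrite !mxE ler_norml => /andP[? ?]; apply/andP; split; lra.
Qed.

Let mD1 B a : measurable B ->
  measurable_fun setT (fun z : T * T => \1_B z.1 * \1_(close_pairs a) z : R).
Proof.
move=> mB; apply: measurable_funM; last exact: measurable_close_indic.
by apply: (measurableT_comp _ measurable_fst); exact: measurable_indic.
Qed.

Let mD2 B a : measurable B ->
  measurable_fun setT (fun z : T * T => \1_B z.2 * \1_(close_pairs a) z : R).
Proof.
move=> mB; apply: measurable_funM; last exact: measurable_close_indic.
by apply: (measurableT_comp _ measurable_snd); exact: measurable_indic.
Qed.

Let pair_dens B a (z : T * T) : \bar R := (\1_B z.1 * \1_(close_pairs a) z)%:E.

Let pair_dens_ge0 B a z : (0 <= pair_dens B a z)%E.
Proof. by rewrite lee_fin mulr_ge0. Qed.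

Let measurable_pair_dens B a : measurable B -> measurable_fun setT (pair_dens B a).
Proof. by move=> mB; apply/measurable_EFinP; exact: mD1. Qed.

Let iterated_close_pairs B a : measurable B -> 0 <= a ->
  (\int[mu]_x \int[mu]_y pair_dens B a (x, y) <= ((2 * a) ^+ N)%:E * leb N B)%E.
Proof.
move=> mB a0; have mF := @measurable_pair_dens B a mB.
rewrite -[B in leRHS]setIT -integral_indic//= -ge0_integralZl_EFin//; last 2 first.
- by apply/measurable_EFinP; exact: measurable_indic.
- by rewrite exprn_ge0// mulr_ge0.
apply: ge0_le_integral => //.
- by move=> x _; apply: integral_ge0 => y _; exact: pair_dens_ge0.
- by apply: (@measurable_fun_fubini_tonelli_F _ _ _ _ _ (leb N) (pair_dens B a)).
- by apply: measurable_funeM; apply/measurable_EFinP; exact: measurable_indic.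
move=> x _; have [mx lx] := leb_ball_le x a0.
under eq_integral do rewrite /pair_dens /= EFinM.
rewrite ge0_integralZl_EFin//; last first.
  apply/measurable_EFinP.
  exact: (measurableT_comp (measurable_close_indic a) (pair1_measurable x)).
rewrite muleC; apply: lee_wpmul2r; first by rewrite lee_fin.
apply: le_trans lx; rewrite -[X in leb N X]setIT -integral_indic//.
Qed.

Lemma close_pairs_integral1 B a : measurable B -> 0 <= a ->
  (\int[mu2]_z (\1_B z.1 * \1_(close_pairs a) z)%:E <= ((2 * a) ^+ N)%:E * leb N B)%E.
Proof.
move=> mB a0; apply: le_trans (iterated_close_pairs mB a0).
rewrite (fubini_tonelli1 _ (@measurable_pair_dens B a mB) (pair_dens_ge0 B a)).
exact: lexx.
Qed.

Lemma close_pairs_integral2 B a : measurable B -> 0 <= a ->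
  (\int[mu2]_z (\1_B z.2 * \1_(close_pairs a) z)%:E <= ((2 * a) ^+ N)%:E * leb N B)%E.
Proof.
move=> mB a0; apply: le_trans (iterated_close_pairs mB a0).
pose h (z : T * T) : \bar R := (\1_B z.2 * \1_(close_pairs a) z)%:E.
have mh : measurable_fun setT h by apply/measurable_EFinP; exact: mD2.
rewrite (fubini_tonelli2 _ mh) /fubini_G; last by move=> z; rewrite lee_fin mulr_ge0.
rewrite le_eqVlt; apply/orP; left; apply/eqP; apply: eq_integral => y _.
apply: eq_integral => x _; rewrite /h /pair_dens/= !indicE; congr (_ * _)%:E.
by congr (nat_of_bool _)%:R; apply/idP/idP; rewrite !inE /close_pairs/= enormC.
Qed.

(** At least 1 on the pairs at distance at most [a] having a point in [B]; a function vanishing off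
    [B] has equal values on all other pairs at that distance. *)
Let D B a (z : T * T) : R := \1_B z.1 * \1_(close_pairs a) z + \1_B z.2 * \1_(close_pairs a) z.

Let D_ge0 B a z : 0 <= D B a z.
Proof. by rewrite addr_ge0// mulr_ge0. Qed.

Let mD B a : measurable B -> measurable_fun setT (D B a).
Proof. by move=> mB; apply: measurable_funD; [exact: mD1|exact: mD2]. Qed.

Let integral_D B a : measurable B -> 0 <= a ->
  (\int[mu2]_z (D B a z)%:E <= (2 * (2 * a) ^+ N)%:E * leb N B)%E.
Proof.
move=> mB a0; rewrite /D; under eq_integral do rewrite EFinD.
rewrite ge0_integralD//; last 2 first.
- by apply/measurable_EFinP; exact: mD1.
- by apply/measurable_EFinP; exact: mD2.
rewrite (_ : 2 * (2 * a) ^+ N = (2 * a) ^+ N + (2 * a) ^+ N); last by rewrite mulr_natl mulr2n.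
have p0 : 0 <= (2 * a) ^+ N by rewrite exprn_ge0// mulr_ge0.
rewrite EFinD ge0_muleDl ?lee_fin//; apply: leeD.
  exact: close_pairs_integral1.
exact: close_pairs_integral2.
Qed.

Lemma dyadic_scale (y : R) : 1 <= y -> exists j, 2 ^+ j <= y < 2 ^+ j.+1.
Proof.
move=> y1; have y0 : 0 <= y by apply: le_trans y1.
have ex : exists n, y < 2 ^+ n.
  exists (Num.bound y); apply: lt_le_trans (archi_boundP y0) _.
  by rewrite -natrX ler_nat ltnW// ltn_expl.
have [[|m] ym mmin] := ex_minnP ex; first by move: ym; rewrite expr0 ltNge y1.
exists m; rewrite ym andbT leNgt; apply/negP => /mmin.
by rewrite ltnn.
Qed.

(* The region [2^-(j+1) < |x - y| <= 2^-j] contributes a multiple of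
   [2^(-j (2 - 2 s))] and the region [2^j <= |x - y| < 2^(j+1)] a multiple of
   [2^(-2 s j)]. *)
Lemma gagliardo2_lipschitz (s L : R) (u : T -> R) B : 0 < s < 1 -> 0 <= L ->
  measurable B -> (leb N B < +oo)%E -> measurable_fun setT u ->
  (forall x, 0 <= u x <= 1) -> (forall x, ~ B x -> u x = 0) ->
  (forall x y, `|u x - u y| <= L * enorm (x - y)) -> (gagliardo2 s u < +oo)%E.
Proof.
move=> /andP[s0 s1] L0 mB By mU u01 uB uL.
pose e : R := N%:R + 2 * s; have e0 : 0 < e by rewrite ltr_wpDl// mulr_gt0.
(* [0 < s < 1] puts [k] strictly between 1 and 4: the sums over near and far shells are geometric
   with ratios k/4 and 1/k. *)
pose k : R := 2 `^ (2 * s).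
have k1 : 1 < k by rewrite -(powRr0 2) /k /powR pnatr_eq0/= ltr_expR ltr_pM2r ?mulr_gt0// ln_gt0// ltr1n.
have k4 : k < 4.
  have -> : 4 = 2 `^ 2 :> R by rewrite -[X in _ = _ `^ X]/(2%:R) powR_mulrn//; ring.
  by rewrite /k /powR pnatr_eq0/= ltr_expR ltr_pM2r ?ln_gt0 ?ltr1n//; lra.
have k0 : 0 < k by lra.
pose ce : R := 2 ^+ N * k.
have ceE : 2 `^ e = ce by rewrite /e powRD ?pnatr_eq0 ?implybT// powR_mulrn.
have ce0 : 0 < ce by rewrite mulr_gt0// exprn_gt0.
have powj j : (2 ^+ j) `^ e = ce ^+ j.
  by rewrite -ceE -(powR_mulrn j (ler0n R 2)) -(powR_mulrn j (powR_ge0 2 e)) -!powRrM mulrC.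
(* Bounds of the quotient on the shells: (L 2^-j)^2 times 2^(e (j+1)) near the diagonal, by the
   Lipschitz condition, and 2^(-e j) far from it, where |u x - u y| <= 1. *)
pose c1 j : R := L ^+ 2 * ce * (ce / 4) ^+ j.
pose c2 j : R := (ce^-1) ^+ j.
have c10 j : 0 <= c1 j by rewrite !mulr_ge0 ?exprn_ge0 ?divr_ge0// ltW.
have c20 j : 0 <= c2 j by rewrite exprn_ge0// invr_ge0 ltW.
pose t j (z : T * T) : R := c1 j * D B (2 ^- j) z + c2 j * D B (2 ^+ j.+1) z.
have t0 j z : 0 <= t j z by rewrite addr_ge0// mulr_ge0.
have mt j : measurable_fun setT (t j).
  by apply: measurable_funD; apply: measurable_funM => //; exact: mD.
have key z : exists j, gquot s u z <= t j z.
  case: z => x y; have d0 := enorm_ge0 (x - y); set d := enorm (x - y) in d0 *.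
  have [dz|dn0] := eqVneq d 0.
    exists 0%N; rewrite /gquot/=; have -> : x = y by apply: subr0_eq; exact: enorm_eq0.
    by rewrite subrr expr0n mul0r.
  have dp : 0 < d by rewrite lt_neqAle eq_sym dn0.
  have de : 0 < d `^ e by rewrite powR_gt0.
  have [[nBx nBy]|Bxy] := pselect (~ B x /\ ~ B y).
    by exists 0%N; rewrite /gquot/= !uB// subrr expr0n mul0r.
  have DE a : d <= a -> 1 <= D B a (x, y).
    move=> da; have -> : D B a (x, y) = \1_B x + \1_B y.
      by rewrite /D/= [\1_(close_pairs a) _]indicE mem_set// !mulr1.
    have [Bx|nBx] := pselect (B x); first by rewrite [\1_B x]indicE mem_set// lerDl.
    have By' : B y by apply: contrapT => nBy; exact: Bxy.
    by rewrite [\1_B y]indicE mem_set// lerDr.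
  have [d1|d1] := leP 1 d.
    have [j /andP[j1 j2]] := dyadic_scale d1; exists j.
    apply: (@le_trans _ _ (c2 j)); last first.
      by apply: ler_wpDl; [exact: mulr_ge0|apply: ler_peMr => //; apply: DE; exact: ltW].
    rewrite /gquot/= -/d -/e ler_pdivrMr// /c2 exprVn -(powj j) mulrC.
    have p0 : 0 < (2 ^+ j) `^ e :> R by rewrite powR_gt0// exprn_gt0.
    rewrite ler_pdivlMr//; apply: (@le_trans _ _ (1 * (2 ^+ j) `^ e)).
      rewrite ler_wpM2r ?powR_ge0// -(real_normK (num_real _)) exprn_ile1//.
      by have := u01 x; have := u01 y; rewrite ler_norml => /andP[? ?] /andP[? ?]; apply/andP; split; lra.
    by rewrite mul1r; apply: ge0_ler_powR; rewrite ?nnegrE ?exprn_ge0// ltW.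
  have y1 : 1 <= d^-1 by rewrite invf_ge1// ltW.
  have [j /andP[j1 j2]] := dyadic_scale y1; exists j.
  have dj : d <= 2 ^- j by rewrite -[d]invrK lef_pV2 ?posrE ?invr_gt0 ?exprn_gt0.
  apply: (@le_trans _ _ (c1 j)); last first.
    by apply: ler_wpDr; [exact: mulr_ge0|apply: ler_peMr => //; exact: DE].
  rewrite /gquot/= -/d -/e.
  have -> : c1 j = (L * 2 ^- j) ^+ 2 * ce ^+ j.+1.
    have h2 : 4 ^+ j = (2 ^+ j) ^+ 2 :> R.
      by rewrite -exprM mulnC exprM; congr (_ ^+ _); ring.
    rewrite /c1 (exprMn j) exprVn h2 (exprS _ j).
    have : 2 ^+ j != 0 :> R by rewrite expf_neq0.
    by move: (2 ^+ j) (ce ^+ j) => X Y X0; field.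
  apply: ler_pM; rewrite ?sqr_ge0 ?invr_ge0 ?powR_ge0//.
    rewrite -(real_normK (num_real (u x - u y))) lerXn2r ?nnegrE ?mulr_ge0 ?invr_ge0 ?exprn_ge0//.
    by apply: le_trans (uL x y) _; rewrite ler_wpM2l.
  rewrite -[leLHS]mul1r ler_pdivrMr// -(powj j.+1) -powRM ?exprn_ge0//.
  rewrite [leLHS](_ : 1 = 1 `^ e); last by rewrite powR1.
  apply: ge0_ler_powR; rewrite ?nnegrE ?(ltW e0) ?mulr_ge0 ?exprn_ge0//.
  by rewrite -ler_pdivrMr// mul1r ltW.
have tE j z : (0 <= (t j z)%:E)%E by rewrite lee_fin.
pose b := fine (leb N B).
have bE : leb N B = b%:E by rewrite /b fineK// ge0_fin_numE.
have b0 : 0 <= b by rewrite fine_ge0.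
pose K1 : R := 2 * b * (L ^+ 2 * ce * 2 ^+ N); pose K2 : R := 2 * b * 4 ^+ N.
have it j : (\int[mu2]_z (t j z)%:E <= (K1 * (k / 4) ^+ j + K2 * k^-1 ^+ j)%:E)%E.
  rewrite /t; under eq_integral do rewrite EFinD.
  have nD a : measurable_fun setT (EFin \o D B a) by apply/measurable_EFinP; exact: mD.
  rewrite ge0_integralD//; last 4 first.
  - by move=> z _; rewrite lee_fin mulr_ge0.
  - by apply/measurable_EFinP; apply: measurable_funM => //; exact: mD.
  - by move=> z _; rewrite lee_fin mulr_ge0.
  - by apply/measurable_EFinP; apply: measurable_funM => //; exact: mD.
  rewrite EFinD; under eq_integral do rewrite EFinM.
  under [X in (_ + X <= _)%E]eq_integral do rewrite EFinM.
  have pD a : forall z, setT z -> (0 <= (D B a z)%:E)%E by move=> z _; rewrite lee_fin.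
  rewrite !ge0_integralZl_EFin//; do ?[exact: nD|exact: pD].
  apply: leeD.
    apply: (@le_trans _ _ ((c1 j)%:E * ((2 * (2 * 2 ^- j) ^+ N)%:E * b%:E))%E).
      by rewrite lee_wpmul2l ?lee_fin// -bE; apply: integral_D; rewrite ?invr_ge0 ?exprn_ge0.
    rewrite -!EFinM lee_fin /c1 /K1 le_eqVlt; apply/orP; left; apply/eqP.
    rewrite (_ : ce / 4 = 2 ^+ N * (k / 4)); last by rewrite mulrA.
    rewrite (exprMn j) (exprMn N) exprVn -(exprM 2 j) mulnC exprM; field.
    by rewrite gt_eqF// !exprn_gt0.
  apply: (@le_trans _ _ ((c2 j)%:E * ((2 * (2 * 2 ^+ j.+1) ^+ N)%:E * b%:E))%E).
    by rewrite lee_wpmul2l ?lee_fin// -bE; apply: integral_D; rewrite ?exprn_ge0.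
  rewrite -!EFinM lee_fin /c2 /K2 le_eqVlt; apply/orP; left; apply/eqP.
  rewrite (_ : 2 * 2 ^+ j.+1 = 4 * 2 ^+ j); last by rewrite exprS mulrA; congr (_ * _); ring.
  rewrite /ce invfM (exprMn j) (exprMn N) -(exprM 2 j) mulnC exprM [(2 ^+ N)^-1 ^+ j]exprVn; field.
  by rewrite gt_eqF// !exprn_gt0.
have mtE j : measurable_fun setT (fun z => (t j z)%:E) by apply/measurable_EFinP.
apply: (@le_lt_trans _ _ (\int[mu2]_z (\sum_(0 <= j <oo) (t j z)%:E))%E).
  rewrite /gagliardo2; apply: ge0_le_integral => //.
  - by move=> z _; rewrite lee_fin; exact: gquot_ge0.
  - by apply/measurable_EFinP; exact: measurable_gquot.
  - by apply: ge0_emeasurable_sum.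
  - move=> z _; have [j tj] := key z.
    apply: (@le_trans _ _ (t j z)%:E); first by rewrite lee_fin.
    exact: (@nneseries_ge_term _ (fun j => (t j z)%:E)).
rewrite integral_nneseries//.
apply: (@le_lt_trans _ _ (K1 / (1 - k / 4) + K2 / (1 - k^-1))%:E); last by rewrite ltry.
apply: nneseries_le_bound; first by move=> j; apply: integral_ge0 => z _.
move=> n; apply: (@le_trans _ _ (\sum_(0 <= j < n) (K1 * (k / 4) ^+ j + K2 * k^-1 ^+ j)%:E)%E).
  by apply: lee_sum => j _.
rewrite sumEFin lee_fin big_split/=; apply: lerD; apply: geometric_sum_le.
- by rewrite !mulr_ge0 ?exprn_ge0// ltW.
- by apply/andP; split; [rewrite divr_ge0// ltW|lra].
- by rewrite !mulr_ge0 ?exprn_ge0.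
- by rewrite invr_ge0 ltW//= invf_lt1.
Qed.

Definition cube (r : R) : set T := [set x | forall i, `|x ord0 i| <= r].

Lemma cubeE r : cube r = [set x | forall i, (\row_(i < N) - r) ord0 i <= x ord0 i
  <= (\row_(i < N) r) ord0 i].
Proof. by apply/seteqP; split => x H i; have := H i; rewrite !mxE ler_norml. Qed.

Lemma measurable_cube r : measurable (cube r).
Proof. by rewrite cubeE; exact: measurable_closed_box. Qed.

Lemma leb_cube r : 0 <= r -> leb N (cube r) = ((r + r) ^+ N)%:E.
Proof.
move=> r0; rewrite cubeE leb_box; last by move=> i; rewrite !mxE; lra.
congr EFin; rewrite -[in RHS](card_ord N) -prodr_const.
by apply: eq_bigr => i _; rewrite !mxE opprK.
Qed.

(** The admissible pair is built from this l^1 cone: it is Lipschitz, hence of finite Gagliardo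
    seminorm, and vanishes off a cube on which the continuous weights are bounded. *)
Definition tent (r : R) (x : T) : R := Num.max 0 (r - \sum_i `|x ord0 i|).

Lemma measurable_tent r : measurable_fun setT (tent r).
Proof.
apply: measurable_maxr; first exact: measurable_cst.
apply: measurable_funB => //; apply: measurable_sum => i.
exact: (measurableT_comp (@normr_measurable R setT) (measurable_coord i)).
Qed.

Lemma tent_ge0 r x : 0 <= tent r x.
Proof. by rewrite le_max lexx. Qed.

Lemma tent_le r x : 0 <= r -> tent r x <= r.
Proof. by move=> r0; rewrite ge_max r0 gerBl sumr_ge0. Qed.

Lemma tent_out r x : ~ cube r x -> tent r x = 0.
Proof.
move=> /existsNP[i /negP]; rewrite -ltNge => ri; apply/max_idPl.
by rewrite subr_le0 (le_trans (ltW ri))// (bigD1 i)//= lerDl sumr_ge0.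
Qed.

Lemma tent_in r x : 0 <= r -> cube (r / (2 * N%:R)) x -> r / 2 <= tent r x.
Proof.
move=> r0 cx; rewrite le_max; apply/orP; right; rewrite lerBrDr -lerBrDl.
apply: (@le_trans _ _ (\sum_(i < N) r / (2 * N%:R))); first exact: ler_sum.
rewrite sumr_const card_ord; case: (posnP N) => [->|N0]; first by rewrite mulr0n; lra.
rewrite -mulr_natr le_eqVlt; apply/orP; left; apply/eqP; field.
by rewrite pnatr_eq0 -lt0n.
Qed.

Lemma tent_lipschitz r x y : `|tent r x - tent r y| <= N%:R * enorm (x - y).
Proof.
have h : `|\sum_i `|x ord0 i| - \sum_i `|y ord0 i| | <= N%:R * enorm (x - y).
  rewrite -sumrB; apply: le_trans (ler_norm_sum _ _ _) _.
  apply: (@le_trans _ _ (\sum_(i < N) enorm (x - y))).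
    apply: ler_sum => i _; apply: le_trans (ler_dist_dist _ _) _.
    by have := coord_le_enorm (x - y) i; rewrite !mxE.
  by rewrite sumr_const card_ord mulr_natl.
apply: le_trans h; rewrite /tent.
set a := \sum_i _; set b := \sum_i _.
by case: (leP 0 (r - a)) => ?; case: (leP 0 (r - b)) => ?;
  rewrite ?subr0 ?sub0r ?normrN; case: (ler0P (a - b)) => ?; rewrite ler_norml; apply/andP; split; lra.
Qed.

Lemma gagliardo2_tent (s r : R) : 0 < s < 1 -> 0 <= r <= 1 -> (gagliardo2 s (tent r) < +oo)%E.
Proof.
move=> s01 /andP[r0 r1]; apply: (@gagliardo2_lipschitz s N%:R (tent r) (cube r)) => //.
- exact: measurable_cube.
- by rewrite leb_cube// ltry.
- exact: measurable_tent.
- by move=> x; rewrite tent_ge0 (le_trans (tent_le _ r0)).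
- exact: tent_out.
- exact: tent_lipschitz.
Qed.

Lemma weightedHs_tent (s r V0 M : R) (V : T -> R) : 0 < s < 1 -> 0 <= r <= 1 ->
  0 < V0 -> (forall x, V0 <= V x) -> mu.-integrable setT (fun x => ((V x)^-1)%:E) ->
  (forall x, cube r x -> V x <= M) -> weightedHs s V (tent r).
Proof.
move=> s01 r01 V00 hV iV VM; apply/(weightedHsP s V00 hV iV); split.
- exact: measurable_tent.
- exact: gagliardo2_tent.
- have /andP[r0 r1] := r01; have mT := measurable_tent r.
  apply: (@le_lt_trans _ _ (\int[mu]_x (`|M| * \1_(cube r) x)%:E)%E).
    apply: ge0_le_integralE.
    + exact: measurable_Vsqr V00 hV iV _ mT.
    + by apply: measurable_funM => //; apply: measurable_indic; exact: measurable_cube.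
    + move=> x; rewrite mulr_ge0 ?sqr_ge0 ?(le_trans (ltW V00))//=.
      have [cx|ncx] := pselect (cube r x); last by rewrite tent_out// expr0n mulr0 mulr_ge0.
      rewrite indicE mem_set// ler_pM ?sqr_ge0 ?(le_trans (ltW V00))//.
        exact: le_trans (VM _ cx) (ler_norm _).
      by rewrite exprn_ile1 ?tent_ge0// (le_trans (tent_le _ r0)).
  under eq_integral do rewrite EFinM.
  rewrite ge0_integralZl_EFin//; last first.
    by apply/measurable_EFinP; apply: measurable_indic; exact: measurable_cube.
  rewrite integral_indic//; last exact: measurable_cube.
  by rewrite setIT [X in (_ * X)%E]leb_cube// -EFinM ltry.
Qed.

Lemma coupling_tent_gt0 (alpha beta r : R) : (0 < N)%N -> 0 < r <= 1 ->
  0 < alpha -> 0 < beta -> 0 < coupling alpha beta (tent r, tent r).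
Proof.
move=> N0 /andP[r0 r1] a0 b0; have mT := measurable_tent r.
have NR : 0 < N%:R :> R by rewrite ltr0n.
set c := r / (2 * N%:R); have c0 : 0 < c by rewrite divr_gt0// mulr_gt0.
have m1 : measurable_fun setT (\1_(cube c) : T -> R).
  by apply: measurable_indic; exact: measurable_cube.
have m2 : measurable_fun setT (\1_(cube r) : T -> R).
  by apply: measurable_indic; exact: measurable_cube.
have md := measurable_cdens alpha beta mT mT.
have i2 : mu.-integrable setT (EFin \o (\1_(cube r) : T -> R)).
  apply: ge0_integrable_lty => //; rewrite integral_indic//; last exact: measurable_cube.
  by rewrite setIT [X in (X < _)%E]leb_cube ?ltry// ltW.
have id : mu.-integrable setT (EFin \o cdens alpha beta (tent r) (tent r)).
  apply: (integrable_le md _ i2) => x; rewrite ger0_norm ?cdens_ge0//.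
  have [cx|ncx] := pselect (cube r x); last first.
    by rewrite /cdens tent_out// normr0 powR0 ?mul0r// gt_eqF.
  have t1 a : 0 < a -> `|tent r x| `^ a <= 1.
    move=> a'0; rewrite (_ : 1 = 1 `^ a); last by rewrite powR1.
    apply: ge0_ler_powR; rewrite ?nnegrE ?(ltW a'0)//.
    by rewrite ger0_norm ?tent_ge0// (le_trans (tent_le _ (ltW r0))).
  by rewrite indicE mem_set// mulr_ile1 ?powR_ge0// t1.
rewrite -lte_fin EFin_Rintegral//.
apply: (@lt_le_trans _ _ (\int[mu]_x ((r / 2) `^ alpha * (r / 2) `^ beta * \1_(cube c) x)%:E)%E).
  under eq_integral do rewrite EFinM.
  rewrite ge0_integralZl_EFin//; last 2 first.
  - exact/measurable_EFinP.
  - by rewrite mulr_ge0 ?powR_ge0.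
  rewrite integral_indic//; last exact: measurable_cube.
  rewrite setIT [X in (_ * X)%E]leb_cube ?ltW// -EFinM lte_fin.
  by rewrite !mulr_gt0 ?powR_gt0 ?divr_gt0// exprn_gt0// addr_gt0.
apply: ge0_le_integralE => //; first exact: measurable_funM.
move=> x; rewrite !mulr_ge0 ?powR_ge0//=.
have [cx|ncx] := pselect (cube c x); last first.
  by rewrite indicE memNset// mulr0 cdens_ge0.
have t2 := tent_in (ltW r0) cx; have t0 := tent_ge0 r x.
rewrite indicE mem_set// mulr1 ler_pM ?powR_ge0//;
  by apply: ge0_ler_powR; rewrite ?nnegrE ?(ltW a0) ?(ltW b0) ?divr_ge0 ?(ltW r0) ?ger0_norm.
Qed.

(** Cubes are balls of the supremum norm, so continuity at 0 suffices; halving the radius fits the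
    closed cube into the open ball, and [r <= 1] keeps the tent at most 1. *)
Lemma continuous_bound_cube (V : T -> R) : continuous V ->
  exists2 r, 0 < r <= 1 & forall x, cube r x -> V x <= V 0 + 1.
Proof.
move=> cV; have /cvgrPdist_lt/(_ 1 ltr01) := cV 0.
move=> /nbhs_ballP[e /= e0 He]; exists (Num.min 1 (e / 2)).
  by rewrite lt_min ltr01 divr_gt0//= ge_min lexx.
move=> x cx; have : ball (0 : T) e x.
  split=> // i j; rewrite (ord1 i) /ball/= mxE sub0r normrN.
  apply: le_lt_trans (cx j) _; rewrite gt_min; apply/orP; right.
  by rewrite ltr_pdivrMr// ltr_pMr// ltr1n.
by move=> /He/=; rewrite ltr_norml => /andP[? ?]; lra.
Qed.

Lemma admissible_nonempty (s V0 alpha beta : R) (V1 V2 : T -> R) : (0 < N)%N ->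
  0 < s < 1 -> 0 < V0 -> 0 < alpha -> 0 < beta -> continuous V1 -> continuous V2 ->
  (forall x, V0 <= V1 x) -> (forall x, V0 <= V2 x) ->
  mu.-integrable setT (fun x => ((V1 x)^-1)%:E) ->
  mu.-integrable setT (fun x => ((V2 x)^-1)%:E) ->
  exists w, admissible s V1 V2 alpha beta w.
Proof.
move=> N0 s01 V00 a0 b0 cV1 cV2 hV1 hV2 iV1 iV2.
have [r1 /andP[r10 r11] H1] := continuous_bound_cube cV1.
have [r2 /andP[r20 r21] H2] := continuous_bound_cube cV2.
pose r := Num.min r1 r2.
have r0 : 0 < r by rewrite lt_min r10.
have rr1 : r <= r1 by rewrite ge_min lexx.
have rr2 : r <= r2 by rewrite ge_min lexx orbT.
have r1' : r <= 1 by exact: le_trans r11.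
have r01 : 0 <= r <= 1 by rewrite ltW.
exists (tent r, tent r); split.
  split; [apply: (weightedHs_tent (M := V1 0 + 1) s01 r01 V00 hV1 iV1)|
          apply: (weightedHs_tent (M := V2 0 + 1) s01 r01 V00 hV2 iV2)].
    by move=> x cx; apply: H1 => i; exact: le_trans rr1.
  by move=> x cx; apply: H2 => i; exact: le_trans rr2.
by apply: coupling_tent_gt0; rewrite ?r0.
Qed.

End tent.

Theorem theorem2p2 (R : realType) (N : nat)
    (s alpha beta p q theta V0 : R) (V1 V2 : 'rV[R]_N -> R)
    (hs : 0 < s < 1) (hN : 2 * s < N%:R)
    (halpha : 1 < alpha) (hbeta : 1 < beta)
    (hp : 1 <= p) (hpq : p <= q) (hq : q < 2)
    (hab : 2 < alpha + beta) (hcrit : alpha + beta < sobolev_exponent N s)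
    (htheta : 0 < theta) (hV0 : 0 < V0)
    (cV1 : continuous V1) (cV2 : continuous V2)
    (hV1 : forall x, V0 <= V1 x) (hV2 : forall x, V0 <= V2 x)
    (iV1 : (leb N).-integrable [set: 'rV[R]_N] (fun x => ((V1 x)^-1)%:E))
    (iV2 : (leb N).-integrable [set: 'rV[R]_N] (fun x => ((V2 x)^-1)%:E)) :
  forall lambda : R, 0 < lambda ->
    (lambda%:E < lambda_upper s V1 V2 alpha beta p q theta)%E ->
  exists z w : 'rV[R]_N -> R,
    [/\ admissible s V1 V2 alpha beta (z, w),
        weak_solution s V1 V2 alpha beta p q theta lambda (z, w),
        d2energy s V1 V2 alpha beta p q theta lambda (z, w) < 0 /\
        Nehari_minus s V1 V2 alpha beta p q theta lambda (z, w) &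
        [/\ (lambda%:E < lambda_lower s V1 V2 alpha beta p q theta)%E ->
              0 < energy s V1 V2 alpha beta p q theta lambda (z, w),
            lambda%:E = lambda_lower s V1 V2 alpha beta p q theta ->
              energy s V1 V2 alpha beta p q theta lambda (z, w) = 0 &
            (lambda_lower s V1 V2 alpha beta p q theta < lambda%:E)%E ->
              energy s V1 V2 alpha beta p q theta lambda (z, w) < 0]].
Proof.
move=> lambda l0 hl; have /andP[s0 _] := hs.
have N0 : (0 < N)%N by rewrite -(ltr0n R) (lt_trans _ hN)// mulr_gt0.
(* The midpoint leaves room on both sides: [t] above [alpha + beta] gives uniform integrability, [t]
   below the critical exponent gives the Sobolev bound. *)
pose t := (alpha + beta + sobolev_exponent N s) / 2.
have habt : alpha + beta < t by rewrite /t; lra.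
have ht : t < sobolev_exponent N s by rewrite /t; lra.
have ne := admissible_nonempty N0 hs hV0 (lt_trans ltr01 halpha) (lt_trans ltr01 hbeta)
  cV1 cV2 hV1 hV2 iV1 iV2.
have [[z w] zw] := ground_state_solution s0 hN hV0 hV1 hV2 iV1 iV2 halpha hbeta hp hpq hq
  hab habt ht htheta l0 hl ne.
by exists z, w.
Qed.
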